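(* Let $E$ be a non-elementary hypergeometric equation on $\mathbb{P}^1$ whose local monodromies at $0,1,\infty$ have orders $(p_0,p_1,p_\infty)$, with $2\le p_0\le p_1\le p_\infty\le\infty$, and let $\phi_t:\mathbb{P}^1\to\mathbb{P}^1$ be a $2$-parameter family of ramified coverings of degree $d$ such that $\phi_t^*E$ has $5$ non-apparent singularities. Then $(p_0,p_1,p_\infty)$, $d$ and the ramification type of $\phi_t$ over $(0;1;\infty)$ are one of the following: - $(p_0,p_1)=(2,3)$, $p_\infty\ge 7$ or $p_\infty=\infty$, $d=4$, type $(2+2;\ 3+1;\ 1+1+1+1)$; - $(p_0,p_1)=(2,3)$, $p_\infty\ge 7$ or $p_\infty=\infty$, $d=6$, type $(2+2+2;\ 3+3;\ 2+1+1+1+1)$; - $(p_0,p_1,p_\infty)=(2,3,7)$, $d=12$, type $(2+2+2+2+2+2;\ 3+3+3+3;\ 7+1+1+1+1+1)$.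
   Context: A hypergeometric equation is a Fuchsian (second order, linear, regular singular) equation on $\mathbb{P}^1$ with three singular points $0,1,\infty$. It is non-elementary if its projective monodromy group is Zariski dense in $\mathrm{PGL}(2,\mathbb{C})$; local monodromy orders are those in $\mathrm{PGL}(2,\mathbb{C})$. A singular point is apparent if its local projective monodromy is trivial. A $2$-parameter family of ramified coverings means a family $\phi_t$ of ramified coverings of fixed topological type which ramify over two points distinct from each other and from $0,1,\infty$, these two critical values being free (independently varying) parameters. The ramification type $(\cdots;\cdots;\cdots)$ lists the partitions of $d$ given by the ramification indices in the fibres of $\phi_t$ over $0$, $1$, $\infty$ respectively. *)

(* Defs.v *)
From HB Require Import structures.
From mathcomp Require Import all_boot all_order all_algebra.
From mathcomp Require Import generic_quotient fraction complex.
From mathcomp Require Import all_classical all_reals all_analysis.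
(* The notations of mpoly clash with those of MathComp-Analysis. *)
From mathcomp.multinomials Require Import -(notations) mpoly.

Set Implicit Arguments.
Unset Strict Implicit.
Unset Printing Implicit Defensive.

Import Order.TTheory GRing.Theory Num.Theory.
Import numFieldNormedType.Exports.

Local Open Scope classical_set_scope.
Local Open Scope ring_scope.
Local Open Scope complex_scope.
Local Open Scope quotient_scope.

(* The complex field as a numClosedFieldType, so that it carries the topology
   and the normed structure of MathComp-Analysis and [derive1] on functions
   Cplx R -> Cplx R is the complex derivative. *)
Definition Cplx (R : realType) : numClosedFieldType := R[i].

(* The projective line C \cup {oo}; [None] is the point at infinity. *)
Definition P1 (R : realType) : topologicalType :=
  one_point_compactification (Cplx R).

Notation pt a := (Some a : P1 _) (only parsing).
Notation infty := (None : P1 _) (only parsing).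

Definition ratfun (R : realType) : fieldType := {fraction {poly Cplx R}}.

Section RationalFunctions.
Context {R : realType}.
Implicit Types (f g : ratfun R) (x y : P1 R).

(* [rnum f] and [rden f] are coprime, so the roots of [rden f] are exactly the
   poles of [f]; they are unique only up to a common nonzero constant. *)
Definition rnum f : {poly Cplx R} :=
  let r : {ratio {poly Cplx R}} := repr f in
  (frac r).1 %/ gcdp (frac r).1 (frac r).2.
Definition rden f : {poly Cplx R} :=
  let r : {ratio {poly Cplx R}} := repr f in
  (frac r).2 %/ gcdp (frac r).1 (frac r).2.

(* Meaningful only away from the poles of f. *)
Definition reval f (z : Cplx R) : Cplx R := (rnum f).[z] / (rden f).[z].

Definition rX : ratfun R := tofrac ('X : {poly Cplx R}).

Definition rderiv f : ratfun R :=
  tofrac ((rnum f)^`() * rden f - rnum f * (rden f)^`())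
  / tofrac (rden f) ^+ 2.

(* The composite f \o g; the value is junk if g is constant and equal to a
   pole of f. *)
Definition rcomp f g : ratfun R :=
  let ev (p : {poly Cplx R}) := (map_poly (fun c => tofrac c%:P) p).[g] in
  ev (rnum f) / ev (rden f).

Definition rdeg f : nat := (maxn (size (rnum f)) (size (rden f))).-1.

Definition rvalue_at f (a : Cplx R) : P1 R :=
  if root (rden f) a then infty else pt (reval f a).

(* f as a self-map of the projective line; the point oo is treated in the
   coordinate 1/X. *)
Definition rvalue f x : P1 R :=
  match x with
  | Some a => rvalue_at f a
  | None => rvalue_at (rcomp f rX^-1) 0
  end.

(* For f nonconstant, the finite zeros of [fibre_poly f y], with their
   multiplicities, are the finite points of the fibre of f over y. *)
Definition fibre_poly f y : {poly Cplx R} :=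
  match y with
  | Some c => rnum f - c *: rden f
  | None => rden f
  end.

Definition ramif_at f (a : Cplx R) : nat := mup a (fibre_poly f (rvalue_at f a)).

Definition ramif f x : nat :=
  match x with
  | Some a => ramif_at f a
  | None => ramif_at (rcomp f rX^-1) 0
  end.

(* Ramified coverings of the projective line by itself are the nonconstant
   rational functions. *)
Definition ramified_covering f (d : nat) : Prop := (0 < d)%N /\ rdeg f = d.

(* [s] lists, in some order, the ramification indices of the points of the
   fibre over y. *)
Definition ramification_over f y (s : seq nat) : Prop :=
  exists2 xs : seq (P1 R),
    uniq xs /\ (forall x, x \in xs <-> rvalue f x = y)
    & perm_eq [seq ramif f x | x <- xs] s.

Definition ramification_type f (s0 s1 soo : seq nat) : Prop :=
  [/\ ramification_over f (pt 0) s0, ramification_over f (pt 1) s1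
    & ramification_over f infty soo].

Definition critical_value f y : Prop :=
  exists2 x, rvalue f x = y & (1 < ramif f x)%N.

Definition homeomorphism (h : P1 R -> P1 R) : Prop :=
  continuous h /\
  exists2 k : P1 R -> P1 R, continuous k & cancel h k /\ cancel k h.

End RationalFunctions.

(* A continuous family of coverings of fixed topological type, with exactly
   two critical values c1 t, c2 t outside {0, 1, oo}.  That these are free
   parameters is expressed by openness of t |-> (c1 t, c2 t): near every
   parameter t, the pair of critical values takes all nearby values in C^2. *)
Record two_parameter_family (R : realType) (T : topologicalType)
    (phi : T -> ratfun R) (d : nat) (c1 c2 : T -> Cplx R) : Prop :=
  TwoParameterFamily {
  fam_nonempty : exists t : T, True;
  fam_covering : forall t, ramified_covering (phi t) d;
  fam_continuous : continuous (fun u : T * P1 R => rvalue (phi u.1) u.2);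
  fam_distinct : forall t,
    [/\ c1 t != c2 t, c1 t != 0, c1 t != 1, c2 t != 0 & c2 t != 1];
  fam_critical : forall t (y : P1 R),
    y <> pt 0 -> y <> pt 1 -> y <> infty ->
    critical_value (phi t) y <-> y = pt (c1 t) \/ y = pt (c2 t);
  fam_topological_type : forall s t,
    exists h k : P1 R -> P1 R,
      [/\ homeomorphism h, homeomorphism k,
          forall x, k (rvalue (phi s) x) = rvalue (phi t) (h x),
          [/\ k (pt 0) = pt 0, k (pt 1) = pt 1 & k infty = infty]
        & k (pt (c1 s)) = pt (c1 t) /\ k (pt (c2 s)) = pt (c2 t)];
  fam_param_continuous : continuous (fun t => (c1 t, c2 t));
  fam_param_open : forall t (U : set T),
    nbhs t U -> nbhs (c1 t, c2 t) [set (c1 u, c2 u) | u in U]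
}.

(* The equation y'' + coef1 y' + coef0 y = 0 on the projective line, in the
   affine coordinate. *)
Record lode (R : realType) := Lode { coef1 : ratfun R; coef0 : ratfun R }.

Section Equations.
Context {R : realType}.
Implicit Types (L : lode R) (f : ratfun R) (x : P1 R).

(* The equation satisfied by y \o f for y solution of L, f nonconstant. *)
Definition pullback f L : lode R :=
  Lode (rcomp (coef1 L) f * rderiv f - rderiv (rderiv f) / rderiv f)
       (rcomp (coef0 L) f * rderiv f ^+ 2).

(* A local property of an equation at a point of the projective line; at oo it
   is read in the coordinate 1/X. *)
Definition at_point (P : lode R -> Cplx R -> Prop) L x : Prop :=
  match x with
  | Some a => P L a
  | None => P (pullback rX^-1 L) 0
  end.

Definition singular_at L (a : Cplx R) : Prop :=
  root (rden (coef1 L)) a || root (rden (coef0 L)) a.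

(* Fuchs' condition: a is an ordinary point or a regular singular point. *)
Definition fuchsian_at L (a : Cplx R) : Prop :=
  (mup a (rden (coef1 L)) <= 1)%N && (mup a (rden (coef0 L)) <= 2)%N.

Definition singular := at_point singular_at.

Definition fuchsian L : Prop := forall x, at_point fuchsian_at L x.

Definition hypergeometric L : Prop :=
  fuchsian L /\
  forall x, singular L x <-> [\/ x = pt 0, x = pt 1 | x = infty].

(* A germ of holomorphic function at z is represented by any function
   Cplx R -> Cplx R that coincides with it near z. *)
Definition solution L (z : Cplx R) (y : Cplx R -> Cplx R) : Prop :=
  \forall w \near z,
    [/\ derivable y w 1, derivable (derive1 y) w 1
      & derive1 (derive1 y) w + reval (coef1 L) w * derive1 y w
        + reval (coef0 L) w * y w = 0].

Definition fundamental_system L (z : Cplx R)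
    (y : 'I_2 -> Cplx R -> Cplx R) : Prop :=
  (forall i, solution L z (y i)) /\
  forall c : 'I_2 -> Cplx R,
    (\forall w \near z, \sum_i c i * y i w = 0) -> forall i, c i = 0.

(* Along gamma : [0, 1] -> C, the germ of solution y at gamma 0 continues
   analytically to the germ of y' at gamma 1. *)
Definition continuation L (gamma : R -> Cplx R)
    (y y' : Cplx R -> Cplx R) : Prop :=
  exists F : R -> Cplx R -> Cplx R,
    [/\ \forall w \near gamma 0, F 0 w = y w,
        \forall w \near gamma 1, F 1 w = y' w
      & forall t, 0 <= t <= 1 ->
          solution L (gamma t) (F t) /\
          \forall s \near t, 0 <= s <= 1 ->
            \forall w \near gamma s, F s w = F t w].

Definition monodromy_matrix L (gamma : R -> Cplx R)
    (y : 'I_2 -> Cplx R -> Cplx R) (M : 'M[Cplx R]_2) : Prop :=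
  forall i, continuation L gamma (y i) (fun w => \sum_j M i j * y j w).

Definition loop_at L (z : Cplx R) (gamma : R -> Cplx R) : Prop :=
  [/\ {within `[0, 1], continuous gamma}, gamma 0 = z, gamma 1 = z
    & forall t, 0 <= t <= 1 -> ~ singular_at L (gamma t)].

Definition monodromy_group L (z : Cplx R) (y : 'I_2 -> Cplx R -> Cplx R) :
    set 'M[Cplx R]_2 :=
  [set M | exists2 gamma, loop_at L z gamma & monodromy_matrix L gamma y M].

(* PGL(2, C) is an open subvariety of the projective space of 2 x 2 matrices,
   so its closed subsets are the zero loci of homogeneous polynomials in the
   four entries; G is a set of representatives in GL(2, C). *)
Definition zariski_dense_PGL2 (G : set 'M[Cplx R]_2) : Prop :=
  forall (n : nat) (f : mpoly (2 * 2) (Cplx R)),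
    f \is ishomog1 n (@mdeg (2 * 2)) ->
    (forall M, G M -> meval (fun k => mxvec M 0 k) f = 0) ->
    forall M : 'M[Cplx R]_2, M \in unitmx ->
      meval (fun k => mxvec M 0 k) f = 0.

(* Neither the base point nor the fundamental system matters: another choice
   conjugates the monodromy group. *)
Definition nonelementary L : Prop :=
  exists z y, [/\ ~ singular_at L z, fundamental_system L z y
    & zariski_dense_PGL2 (monodromy_group L z y)].

Definition circle (a : Cplx R) (r t : R) : Cplx R :=
  a + r%:C * (cos (2 * pi * t) +i* sin (2 * pi * t)).

(* M is, in some basis of solutions, the monodromy of L along any small circle
   around a. *)
Definition local_monodromy_at L (a : Cplx R) (M : 'M[Cplx R]_2) : Prop :=
  \forall r \near 0^'+,
    exists2 y, fundamental_system L (circle a r 0) y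
             & monodromy_matrix L (circle a r) y M.

(* Order of the class of M in PGL(2, C); [None] stands for oo. *)
Definition projective_order (M : 'M[Cplx R]_2) (p : option nat) : Prop :=
  match p with
  | Some n => [/\ (0 < n)%N, is_scalar_mx (M ^+ n)
                & forall k, (0 < k < n)%N -> ~~ is_scalar_mx (M ^+ k)]
  | None => forall k, (0 < k)%N -> ~~ is_scalar_mx (M ^+ k)
  end.

Definition local_order L x (p : option nat) : Prop :=
  at_point (fun L' a => exists2 M, local_monodromy_at L' a M
                                 & projective_order M p) L x.

Definition apparent L x : Prop := singular L x /\ local_order L x (Some 1%N).

Definition non_apparent_singularities L : set (P1 R) :=
  [set x | singular L x /\ ~ apparent L x].

End Equations.

(* The order on the extended natural numbers, [None] being oo. *)
Definition le_oo (m n : option nat) : bool :=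
  match m, n with
  | _, None => true
  | None, Some _ => false
  | Some m', Some n' => (m' <= n')%N
  end.

(* Main.v *)
(* If phi maps x to a cusp 0, 1 or oo with ramification index e, the local monodromy of the
   pullback at x is the e-th power of that of E at the cusp, so x is non-apparent as soon as the
   order of the cusp does not divide e.  Hence, if a_i points of the fibre over the i-th cusp have
   an index not divisible by p_i, then a_0 + a_1 + a_oo <= 5, and the i-th fibre has at most
   a_i + (d - a_i) / p_i points.  On the other hand, two critical values lie outside 0, 1, oo, so
   by Riemann-Hurwitz the three fibres together have at least d + 4 points.  For
   1/p_0 + 1/p_1 + 1/p_oo < 1 these inequalities leave only the listed types.

   That 1/p_0 + 1/p_1 + 1/p_oo < 1 follows from Zariski density.  Solutions are continued through
   five charts (the half-planes Im > 0, Im < 0, Re < 0, Re > 1 and the disc with diameter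
   [0, 1]), which shows that the monodromy group is generated by two matrices A, B such
   that A, B and (A B)^-1 are the local monodromies.  Scaled to determinant 1, A and B satisfy
   trace identities expressing every element of the group as a combination of 1, A, B and A B.
   In the excluded cases the orders prescribe the traces of A, B and A B, and the group is
   dihedral, reducible or finite; then finitely many linear forms in the matrix entries cover
   it, and their product is a nonzero form vanishing on the group. *)

Require Import Defs.
From HB Require Import structures.
From mathcomp Require Import all_boot all_order all_algebra.
From mathcomp Require Import generic_quotient fraction complex.
From mathcomp Require Import all_classical all_reals all_analysis.
From mathcomp.multinomials Require Import -(notations) mpoly.
From mathcomp Require Import ring lra zify.

Set Implicit Arguments.
Unset Strict Implicit.
Unset Printing Implicit Defensive.

Import Order.TTheory GRing.Theory Num.Theory.
Import numFieldNormedType.Exports.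

Local Open Scope classical_set_scope.
Local Open Scope ring_scope.

(* The names coef0 and coef1 are shadowed by lemmas on polynomials. *)
Local Notation lcoef1 := Defs.coef1.
Local Notation lcoef0 := Defs.coef0.

(** * Complex derivative *)

(** Homotopy of loops never enters. The five charts are convex, hence so are their overlaps, and on
    a convex domain a solution has constant coefficients in a basis of solutions, because quotients
    of Wronskians have derivative zero along segments. So each overlap carries one transition
    matrix, and continuation along any path becomes a word in these matrices. Winding around a cusp
    is counted by numbering the quarter-turn sectors with natural numbers instead of residues modulo
    4, so that e turns give the e-th power of the matrix of one turn.

    Orders in PGL(2, C) fix traces in SL(2, C) only up to sign. The signs of A and B may be changed
    freely; for (2, 3, r) this also frees the sign of tr(AB), since tr A = 0. For (3, 3, 3) the sign
    of tr A tr B tr(AB) is intrinsic and separates a finite group from a reducible one. The triples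
    (2, 3, 6) and (2, 4, 4) satisfy the trace equation of reducible pairs, and the finite groups are
    enumerated by exact arithmetic on coordinates with respect to 1, A, B, AB. *)

Section Cabs.
Context {R : realType}.
Local Notation C := (Cplx R).
Local Notation RC := (real_complex R).
Implicit Types (z w h : C) (x e d : R).

Definition cabs z : R := ComplexField.Normc.normc z.

Lemma normCE z : `|z| = RC (cabs z) :> C.
Proof. by rewrite normc_def; case: z. Qed.

Lemma cabs_ge0 z : 0 <= cabs z.
Proof. by case: z => a b; apply: sqrtr_ge0. Qed.

Lemma cabs0 : cabs 0 = 0. Proof. exact: ComplexField.Normc.normc0. Qed.
Lemma cabs1 : cabs 1 = 1. Proof. exact: ComplexField.Normc.normc1. Qed.
Lemma cabsM z w : cabs (z * w) = cabs z * cabs w.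
Proof. exact: ComplexField.Normc.normcM. Qed.
Lemma cabsV z : cabs z^-1 = (cabs z)^-1.
Proof. exact: ComplexField.Normc.normcV. Qed.
Lemma cabsN z : cabs (- z) = cabs z. Proof. exact: normcN. Qed.
Lemma ler_cabsD z w : cabs (z + w) <= cabs z + cabs w.
Proof. exact: le_normcD. Qed.
Lemma cabs_eq0 z : (cabs z == 0) = (z == 0).
Proof.
by apply/eqP/eqP => [/(@ComplexField.Normc.eq0_normc R)|->] //; exact: cabs0.
Qed.
Lemma cabs_gt0 z : (0 < cabs z) = (z != 0).
Proof. by rewrite lt0r cabs_ge0 andbT cabs_eq0. Qed.
Lemma cabsX z n : cabs (z ^+ n) = cabs z ^+ n.
Proof. by elim: n => [|n IH]; rewrite ?expr0 ?cabs1 // !exprS cabsM IH. Qed.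
Lemma cabs_div z w : cabs (z / w) = cabs z / cabs w.
Proof. by rewrite cabsM cabsV. Qed.
Lemma cabs_distC z w : cabs (z - w) = cabs (w - z).
Proof. by rewrite -cabsN opprB. Qed.
Lemma ler_cabsB z w : cabs (z - w) <= cabs z + cabs w.
Proof. by rewrite -(cabsN w); exact: ler_cabsD. Qed.
Lemma cabs_real x : cabs (RC x) = `|x|.
Proof. by rewrite /cabs /= expr0n addr0 sqrtr_sqr. Qed.
Lemma cabs_nat n : cabs n%:R = n%:R.
Proof. by rewrite -(rmorph_nat (real_complex R)) cabs_real ger0_norm. Qed.
Lemma cabs_sum (I : Type) (r : seq I) (P : pred I) (F : I -> C) :
  cabs (\sum_(i <- r | P i) F i) <= \sum_(i <- r | P i) cabs (F i).
Proof.
elim/big_rec2: _ => [|i y1 y2 _ h]; first by rewrite cabs0.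
by apply: (le_trans (ler_cabsD _ _)); rewrite lerD2l.
Qed.

Lemma ler_cabs_dist z w t : cabs (z - w) <= cabs (z - t) + cabs (t - w).
Proof. by rewrite -{1}(subrK t z) -addrA; exact: ler_cabsD. Qed.

Definition cre z : R := complex.Re z.
Definition cim z : R := complex.Im z.

Lemma creD z w : cre (z + w) = cre z + cre w.
Proof. by case: z; case: w. Qed.
Lemma cimD z w : cim (z + w) = cim z + cim w.
Proof. by case: z; case: w. Qed.
Lemma creN z : cre (- z) = - cre z. Proof. by case: z. Qed.
Lemma cimN z : cim (- z) = - cim z. Proof. by case: z. Qed.
Lemma creB z w : cre (z - w) = cre z - cre w.
Proof. by rewrite creD creN. Qed.
Lemma cimB z w : cim (z - w) = cim z - cim w.
Proof. by rewrite cimD cimN. Qed.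
Lemma creM z w : cre (z * w) = cre z * cre w - cim z * cim w.
Proof. by case: z; case: w. Qed.
Lemma cimM z w : cim (z * w) = cre z * cim w + cim z * cre w.
Proof. by case: z; case: w. Qed.
Lemma creR x : cre (RC x) = x. Proof. by []. Qed.
Lemma cimR x : cim (RC x) = 0. Proof. by []. Qed.
Lemma cre0 : cre 0 = 0. Proof. by []. Qed.
Lemma cim0 : cim 0 = 0. Proof. by []. Qed.
Lemma cre1 : cre 1 = 1. Proof. by []. Qed.
Lemma cim1 : cim 1 = 0. Proof. by []. Qed.
Lemma cabs_sqr z : cabs z ^+ 2 = cre z ^+ 2 + cim z ^+ 2.
Proof. by case: z => a b; rewrite sqr_sqrtr // addr_ge0 ?sqr_ge0. Qed.
Lemma cplx_ext z w : cre z = cre w -> cim z = cim w -> z = w.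
Proof. by case: z => a b; case: w => c d /= -> ->. Qed.

Lemma cre_le z : `|cre z| <= cabs z.
Proof.
rewrite -(@ler_pXn2r _ 2) ?nnegrE ?cabs_ge0 // cabs_sqr real_normK ?num_real //.
by rewrite lerDl sqr_ge0.
Qed.
Lemma cim_le z : `|cim z| <= cabs z.
Proof.
rewrite -(@ler_pXn2r _ 2) ?nnegrE ?cabs_ge0 // cabs_sqr real_normK ?num_real //.
by rewrite lerDr sqr_ge0.
Qed.
Lemma cabs_le_ReIm z : cabs z <= `|cre z| + `|cim z|.
Proof.
rewrite -(@ler_pXn2r _ 2) ?nnegrE ?cabs_ge0 ?addr_ge0 // cabs_sqr sqrrD.
by rewrite !real_normK ?num_real // addrAC lerDl mulrn_wge0 ?mulr_ge0.
Qed.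

Lemma gtc0_RC (c : C) : 0 < c -> exists2 e, 0 < e & c = RC e.
Proof. by case: c => a b; rewrite ltcE /= => /andP[/eqP -> h]; exists a. Qed.

Lemma nearC z (P : set C) :
  (\forall w \near z, P w) <->
  exists2 e, 0 < e & forall w, cabs (w - z) < e -> P w.
Proof.
split.
  move=> /nbhs_ballP[c /= c0 h]; have [e e0 ce] := gtc0_RC c0.
  exists e => // w hw; apply: h; rewrite -ball_normE /= ce normCE cabs_distC.
  by rewrite ltcR.
move=> [e e0 h]; apply/nbhs_ballP; exists (RC e) => /=; first by rewrite ltcR.
move=> w; rewrite -ball_normE /= normCE cabs_distC ltcR; exact: h.
Qed.

Lemma near_ball z (P : set C) : (\forall w \near z, P w) ->
  exists2 e : R, 0 < e & forall w, cabs (w - z) < e -> P w.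
Proof. by move=> h; apply/nearC. Qed.

Lemma ball_near z (P : set C) (e : R) : 0 < e ->
  (forall w, cabs (w - z) < e -> P w) -> \forall w \near z, P w.
Proof. by move=> e0 h; apply/nearC; exists e. Qed.

(** The division-free form includes the increment h = 0, which the chain rule meets whenever the
    inner function is stationary. *)
Lemma is_deriveCP (f : C -> C) z (l : C) :
  is_derive z 1 f l <->
  forall e, 0 < e -> exists2 d, 0 < d & forall h, cabs h < d ->
    cabs (f (z + h) - f z - h * l) <= e * cabs h.
Proof.
split=> [[dfz <-] e e0|H].
  rewrite /derive; set l' := lim _.
  have /cvgrPdist_le : (fun h => h^-1 *: (f (h *: 1 + z) - f z)) @ 0^' --> l'.
    exact: dfz.
  move=> /(_ (RC e)); rewrite ltcR => /(_ e0).
  rewrite near_withinE => /nearC[d d0 hd]; exists d => // h hh.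
  have [->|h0] := eqVneq h 0.
    by rewrite addr0 subrr mul0r subrr cabs0 mulr0.
  have := hd h; rewrite subr0 => /(_ hh h0).
  rewrite normCE lecR scaler1 (addrC h).
  set A := f _ - f z => hA.
  have -> : A - h * l' = - h * (l' - h^-1 *: A).
    by rewrite -[_ *: A]/(h^-1 * A); field.
  by rewrite cabsM cabsN mulrC ler_wpM2r ?cabs_ge0.
have Hc : (fun h => h^-1 *: (f (h *: 1 + z) - f z)) @ 0^' --> l.
  apply/cvgrPdist_le => c /gtc0_RC[e e0 ->]; rewrite near_withinE; apply/nearC.
  have [d d0 hd] := H e e0; exists d => // h; rewrite subr0 => /hd hh h0.
  rewrite normCE lecR scaler1 (addrC h).
  move: hh; set A := f _ - f z => hA.
  have -> : l - h^-1 *: A = - h^-1 * (A - h * l).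
    by rewrite -[_ *: A]/(h^-1 * A); field.
  rewrite cabsM cabsN cabsV mulrC -(ler_pM2r (x:=cabs h)) ?cabs_gt0 //.
  by rewrite mulrVK // unitfE cabs_eq0.
apply: DeriveDef; first by apply/cvg_ex; exists l.
by apply: cvg_lim => //; exact: norm_hausdorff.
Qed.

End Cabs.

Section ComplexDerivative.
Context {R : realType}.
Local Notation C := (Cplx R).
Local Notation RC := (real_complex R).
Implicit Types (z w l m : C) (x e d : R) (f g : C -> C).

Definition cder f z l := is_derive z (1 : C) f l.

Lemma cder_derivable f z l : cder f z l -> derivable f z 1.
Proof. by case. Qed.

Lemma cder_derive1 f z l : cder f z l -> derive1 f z = l.
Proof. by move=> [? <-]; rewrite derive1E. Qed.

Lemma derivable_cder f z : derivable f z 1 -> cder f z (derive1 f z).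
Proof. by move=> H; rewrite /cder derive1E; exact: derivableP. Qed.

Lemma cder_near f g z l :
  (\forall w \near z, f w = g w) -> cder f z l -> cder g z l.
Proof. exact: near_eq_is_derive. Qed.

Lemma cder_eq f z l m : cder f z l -> l = m -> cder f z m.
Proof. by move=> h <-. Qed.

Lemma cderD f g z l m :
  cder f z l -> cder g z m -> cder (fun w => f w + g w) z (l + m).
Proof. by move=> hf hg; exact: is_deriveD. Qed.

Lemma cderB f g z l m :
  cder f z l -> cder g z m -> cder (fun w => f w - g w) z (l - m).
Proof. by move=> hf hg; exact: is_deriveB. Qed.

Lemma cderM f g z l m :
  cder f z l -> cder g z m ->
  cder (fun w => f w * g w) z (l * g z + f z * m).
Proof.
move=> hf hg; have -> : l * g z + f z * m = f z *: m + g z *: l.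
  by rewrite addrC (mulrC l).
exact: is_deriveM hf hg.
Qed.

Lemma cder_cst (c : C) z : cder (fun=> c) z 0.
Proof. exact: is_derive_cst. Qed.

Lemma cder_id z : cder id z 1.
Proof. exact: is_derive_id. Qed.

Lemma cderZ (c : C) f z l : cder f z l -> cder (fun w => c * f w) z (c * l).
Proof. by move=> hf; exact: is_deriveZ. Qed.

Lemma cderV f z l : f z != 0 -> cder f z l ->
  cder (fun w => (f w)^-1) z (- l / f z ^+ 2).
Proof.
move=> f0 hf; have -> : - l / f z ^+ 2 = - (f z) ^- 2 *: l.
  by rewrite -[_ *: _]/(_ * _) !mulNr (mulrC l).
move: hf => [df <-].
exact: (DeriveDef (derivableV f0 df) (deriveV f0 df)).
Qed.

Lemma cder_div f g z l m : g z != 0 -> cder f z l -> cder g z m ->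
  cder (fun w => f w / g w) z ((l * g z - f z * m) / g z ^+ 2).
Proof.
move=> g0 hf hg.
have -> : (l * g z - f z * m) / g z ^+ 2 = l * (g z)^-1 + f z * (- m / g z ^+ 2).
  by field.
exact: cderM hf (cderV g0 hg).
Qed.

Lemma cder_comp f g z l m : cder g z m -> cder f (g z) l ->
  cder (fun w => f (g w)) z (l * m).
Proof.
move=> /is_deriveCP Hg /is_deriveCP Hf; apply/is_deriveCP => e e0.
(* K bounds the increment of g per unit of h and M the slope of f. Adding 1 keeps both positive, and
   each of the two error terms gets one half of e. *)
pose K := cabs m + 1; pose M := cabs l + 1.
have K0 : 0 < K by rewrite ltr_wpDl ?cabs_ge0.
have M0 : 0 < M by rewrite ltr_wpDl ?cabs_ge0.
have [d1 d10 h1] := Hf (e / 2 / K) (divr_gt0 (divr_gt0 e0 (ltr0Sn _ 1)) K0).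
pose e2 := Num.min 1 (e / 2 / M).
have e20 : 0 < e2 by rewrite lt_min ltr01 divr_gt0 ?divr_gt0.
have [d2 d20 h2] := Hg e2 e20.
exists (Num.min d2 (d1 / K)); first by rewrite lt_min d20 divr_gt0.
move=> h; rewrite lt_min => /andP[hd2 hd1].
have := h2 h hd2; set k := g (z + h) - g z => hk.
have kK : cabs k <= K * cabs h.
  have h3 : cabs k <= cabs (k - h * m) + cabs h * cabs m.
    by rewrite -cabsM -{1}(subrK (h * m) k) ler_cabsD.
  have h4 : e2 * cabs h <= cabs h.
    by rewrite ler_piMl ?cabs_ge0 // ge_min lexx.
  by rewrite /K mulrDl mul1r (mulrC (cabs m)); lra.
have /h1 : cabs k < d1.
  by apply: (le_lt_trans kK); rewrite mulrC -ltr_pdivlMr.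
rewrite [g z + k]addrC subrK => h1k.
have -> : f (g (z + h)) - f (g z) - h * (l * m) =
  (f (g (z + h)) - f (g z) - k * l) + l * (k - h * m) by ring.
apply: (le_trans (ler_cabsD _ _)).
have -> : e * cabs h = e / 2 / K * (K * cabs h) + M * (e / 2 / M * cabs h).
  by field; rewrite !gt_eqF.
apply: lerD.
  by apply: (le_trans h1k); rewrite ler_wpM2l // ltW // divr_gt0 ?divr_gt0.
rewrite cabsM; apply: ler_pM; rewrite ?cabs_ge0 ?lerDl //.
by apply: (le_trans hk); rewrite ler_wpM2r ?cabs_ge0 // ge_min lexx orbT.
Qed.

Lemma cder_horner (p : {poly C}) z : cder (fun w => p.[w]) z (p^`()).[z].
Proof.
elim/poly_ind: p => [|p c IH].
  rewrite deriv0 horner0; rewrite (_ : (fun w => _) = fun=> 0).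
    exact: cder_cst.
  by apply/funext => w; rewrite horner0.
rewrite derivMXaddC.
have -> : (p + p^`() * 'X).[z] = p^`().[z] * z + p.[z] * 1 + 0.
  by rewrite hornerD hornerMX mulr1 addr0 addrC.
rewrite (_ : (fun w => _) = fun w => p.[w] * w + c).
  exact: cderD (cderM IH (cder_id z)) (cder_cst c z).
by apply/funext => w; rewrite hornerMXaddC.
Qed.

Lemma cder_continuous f z l : cder f z l ->
  forall e, 0 < e -> \forall w \near z, cabs (f w - f z) < e.
Proof.
move=> [/derivable1_diffP/differentiable_continuous/cvgrPdist_lt h _] e e0.
have := h (RC e); rewrite ltcR => /(_ e0); apply: filterS => w.
by rewrite normCE ltcR cabs_distC.
Qed.

Lemma is_deriveR_of (f : R -> R) x (l : R) :
  (forall e, 0 < e -> exists2 d : R, 0 < d & forall h : R, `|h| < d ->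
    `|f (x + h) - f x - h * l| <= e * `|h|) -> is_derive x 1 f l.
Proof.
move=> H.
have Hc : (fun h : R => h^-1 *: (f (h *: 1 + x) - f x)) @ 0^' --> l.
  apply/cvgrPdist_le => e e0; rewrite near_withinE.
  have [d d0 hd] := H e e0; apply/nbhs_ballP; exists d => //= h.
  rewrite -ball_normE /ball_ /= sub0r normrN => /hd hh h0.
  rewrite -[h *: 1]/(h * 1) mulr1 (addrC h).
  move: hh; set A := f _ - f x => hA.
  have -> : l - h^-1 *: A = - h^-1 * (A - h * l).
    by rewrite -[_ *: A]/(h^-1 * A); field.
  rewrite normrM normrN normfV mulrC -(ler_pM2r (x:=`|h|)) ?normr_gt0 //.
  by rewrite mulrVK // unitfE normr_eq0.
apply: DeriveDef; first by apply/cvg_ex; exists l.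
by apply: cvg_lim => //; exact: norm_hausdorff.
Qed.

Lemma is_derive_cre_line f z (v : C) x l : cder f (z + RC x * v) l ->
  is_derive x (1 : R) (fun t => cre (f (z + RC t * v))) (cre (v * l)).
Proof.
move=> /is_deriveCP H; apply: is_deriveR_of => e e0.
pose k := cabs v + 1.
have k0 : 0 < k by rewrite ltr_wpDl ?cabs_ge0.
have [d d0 hd] := H (e / k) (divr_gt0 e0 k0).
exists (d / k); first exact: divr_gt0.
move=> h hh.
have hv : cabs (RC h * v) <= `|h| * k.
  by rewrite cabsM cabs_real ler_wpM2l // lerDl.
have /hd : cabs (RC h * v) < d.
  by apply: (le_lt_trans hv); rewrite -ltr_pdivlMr.
have <- : z + RC (x + h) * v = z + RC x * v + RC h * v.
  by rewrite rmorphD mulrDl addrA.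
move=> {}hd; rewrite -creB; have <- : cre (RC h * v * l) = h * cre (v * l).
  by rewrite -mulrA (creM (RC h)) cimR mul0r subr0 creR.
rewrite -creB; apply: (le_trans (cre_le _)); apply: (le_trans hd).
rewrite -mulrA ler_wpM2l ?(ltW e0) // ler_pdivrMl // (mulrC k); exact: hv.
Qed.

(** The real mean value theorem applies to the real part along the segment; the imaginary part of f
    is minus the real part of i f. *)
Lemma cder0_line f (a b : C) :
  (forall x, 0 <= x <= 1 -> cder f (a + RC x * (b - a)) 0) -> f a = f b.
Proof.
have key (g : C -> C) : (forall x, 0 <= x <= 1 -> cder g (a + RC x * (b - a)) 0) ->
    cre (g a) = cre (g b).
  move=> H.
  pose u (t : R) := cre (g (a + RC t * (b - a))).
  have du (t : R) : 0 <= t <= 1 -> is_derive t (1 : R) u 0.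
    by move=> /H /is_derive_cre_line; rewrite mulr0.
  have cu : {within `[(0 : R), 1], continuous u}.
    apply: derivable_within_continuous => t; rewrite in_itv /= => /du.
    by case.
  have [|c _] := @MVT_segment R u (fun=> 0) 0 1 ler01 _ cu.
    by move=> t; rewrite in_itv /= => /andP[t0 t1]; apply: du; rewrite !ltW.
  rewrite mul0r /u rmorph0 rmorph1 mul0r mul1r addr0 (addrC a) subrK.
  by move=> /eqP; rewrite subr_eq0 => /eqP ->.
move=> H; apply: cplx_ext; first exact: key.
pose J : C := Complex 0 1.
have ReJ w : cre (J * w) = - cim w by rewrite creM mul0r mul1r sub0r.
have := @key (fun w => J * f w); rewrite !ReJ => /(_ _)/oppr_inj; apply.
by move=> x /H /(cderZ J); rewrite mulr0.
Qed.

End ComplexDerivative.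

(** * Power series solutions of linear systems *)

Section PowerSeries.
Context {R : realType}.
Local Notation C := (Cplx R).

Definition tends (F : nat -> C) (l : C) : Prop :=
  forall e : R, 0 < e -> exists N, forall n, (N <= n)%N -> cabs (F n - l) < e.

Lemma tends_le F l (K : R) :
  tends F l -> (forall n, cabs (F n) <= K) -> cabs l <= K.
Proof.
move=> Fl FK; rewrite leNgt; apply/negP => Kl.
have e0 : 0 < cabs l - K by rewrite subr_gt0.
have [N /(_ N (leqnn _))] := Fl _ e0.
have := ler_cabsD (l - F N) (F N); rewrite subrK cabs_distC.
have := FK N; lra.
Qed.

Lemma tendsD F G l m :
  tends F l -> tends G m -> tends (fun n => F n + G n) (l + m).
Proof.
move=> Fl Gm e e0; have e2 : 0 < e / 2 by lra.
have [N hN] := Fl _ e2; have [M hM] := Gm _ e2.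
exists (maxn N M) => n; rewrite geq_max => /andP[/hN h1 /hM h2].
rewrite opprD addrACA (le_lt_trans (ler_cabsD _ _)) //.
lra.
Qed.

Lemma tendsZ c F l : tends F l -> tends (fun n => c * F n) (c * l).
Proof.
move=> Fl e e0; have c0 : 0 < cabs c + 1 by rewrite ltr_wpDl ?cabs_ge0.
have [N hN] := Fl _ (divr_gt0 e0 c0); exists N => n /hN h.
rewrite -mulrBr cabsM.
have := cabs_ge0 c; have := cabs_ge0 (F n - l).
rewrite ltr_pdivlMr // in h; nra.
Qed.

Lemma tendsB F G l m :
  tends F l -> tends G m -> tends (fun n => F n - G n) (l - m).
Proof.
move=> Fl /(tendsZ (-1)) /(tendsD Fl); rewrite mulN1r.
by under eq_fun do rewrite mulN1r.
Qed.

Lemma tendsS F l : tends F l -> tends (fun n => F n.+1) l.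
Proof. by move=> Fl e /Fl[N hN]; exists N => n /leqW /hN. Qed.

Lemma tends_unique F l m : tends F l -> tends F m -> l = m.
Proof.
move=> Fl Fm; apply/eqP; rewrite -subr_eq0 -cabs_eq0 eq_le cabs_ge0 andbT.
by apply: (tends_le (tendsB Fl Fm)) => n; rewrite subrr cabs0.
Qed.

(* The power series with coefficients u has radius of convergence at least rho. *)
Definition geo (rho : R) (u : nat -> C) : Prop :=
  forall s : R, 0 < s -> s < rho ->
    exists B : R, forall n, cabs (u n) * s ^+ n <= B.

Lemma geo_sum_le (q : R) n : 0 <= q -> q < 1 ->
  \sum_(k < n) q ^+ k <= (1 - q)^-1.
Proof.
move=> q0 q1; have q1' : 0 < 1 - q by rewrite subr_gt0.
rewrite -[X in _ <= X]mul1r ler_pdivlMr // mulrC.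
have := subrXX 1 q n; rewrite expr1n => E.
have -> : (1 - q) * \sum_(k < n) q ^+ k = 1 - q ^+ n.
  by rewrite E; congr (_ * _); apply: eq_bigr => i _; rewrite expr1n mul1r.
by rewrite lerBlDr lerDl exprn_ge0.
Qed.

(** Each of the n + 1 terms 1, q, ..., q^n of the geometric sum is at least q^n. *)
Lemma nat_geo_le (q : R) n : 0 <= q -> q < 1 -> n.+1%:R * q ^+ n <= (1 - q)^-1.
Proof.
move=> q0 q1; apply: le_trans (geo_sum_le n.+1 q0 q1).
rewrite mulr_natl -[X in _ *+ X](card_ord n.+1) -sumr_const.
apply: ler_sum => i _; apply: ler_wiXn2l => //; first exact: ltW.
by rewrite -ltnS.
Qed.

Lemma geo_ge0 (u : nat -> C) (s B : R) :
  (forall n, cabs (u n) * s ^+ n <= B) -> 0 <= B.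
Proof. by move=> /(_ 0%N); apply: le_trans; rewrite mulr1 cabs_ge0. Qed.

Lemma geo_mid (s rho : R) : s < rho -> exists s', s < s' /\ s' < rho.
Proof. by move=> h; exists ((s + rho) / 2); split; lra. Qed.

Lemma geo_dom (s s' : R) n : 0 < s -> s < s' -> s ^+ n = (s / s') ^+ n * s' ^+ n.
Proof.
move=> s0 ss'; have s'0 : s' != 0 by rewrite gt_eqF // (lt_trans s0).
by rewrite -exprMn divfK.
Qed.

Lemma ratio01 (s s' : R) : 0 <= s -> s < s' -> 0 <= s / s' /\ s / s' < 1.
Proof.
move=> s0 ss'; have s'0 : 0 < s' by exact: le_lt_trans ss'.
by rewrite divr_ge0 ?(ltW s'0) // ltr_pdivrMr // mul1r.
Qed.

(** The linear factor is absorbed by passing from s to a slightly larger s': (n + 1) (s / s')^n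
    stays bounded. The same trick serves convolutions. *)
Lemma geo_mulS rho u : geo rho u -> geo rho (fun k => k.+1%:R * u k).
Proof.
move=> gu s s0 srho; have [s' [ss' s'rho]] := geo_mid srho.
have [B hB] := gu s' (lt_trans s0 ss') s'rho.
have [q0 q1] := ratio01 (ltW s0) ss'.
exists ((1 - s / s')^-1 * B) => n.
rewrite cabsM (geo_dom n s0 ss').
rewrite cabs_nat.
have -> : n.+1%:R * cabs (u n) * ((s / s') ^+ n * s' ^+ n) =
  (n.+1%:R * (s / s') ^+ n) * (cabs (u n) * s' ^+ n) by ring.
apply: ler_pM; rewrite ?nat_geo_le // ?mulr_ge0 ?exprn_ge0 ?cabs_ge0 //.
by rewrite ltW // (lt_trans s0).
Qed.

Lemma geo_shift rho u : geo rho u -> geo rho (fun k => u k.+1).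
Proof.
move=> gu s s0 srho; have [B hB] := gu s s0 srho; exists (B / s) => n.
by rewrite ler_pdivlMr // -mulrA -exprSr.
Qed.

Lemma geoD rho u v : geo rho u -> geo rho v -> geo rho (fun k => u k + v k).
Proof.
move=> gu gv s s0 srho; have [B hB] := gu s s0 srho.
have [B' hB'] := gv s s0 srho; exists (B + B') => n.
apply: le_trans (lerD (hB n) (hB' n)); rewrite -mulrDl.
by rewrite ler_wpM2r ?exprn_ge0 ?(ltW s0) // ler_cabsD.
Qed.

Lemma geoZ rho c u : geo rho u -> geo rho (fun k => c * u k).
Proof.
move=> gu s s0 srho; have [B hB] := gu s s0 srho; exists (cabs c * B) => n.
by rewrite cabsM -mulrA ler_wpM2l ?cabs_ge0.
Qed.

Lemma geo_abs_sum rho u (s : R) : geo rho u -> 0 <= s -> s < rho ->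
  exists B : R, forall n, \sum_(k < n) cabs (u k) * s ^+ k <= B.
Proof.
move=> gu s0 srho; have [s' [ss' s'rho]] := geo_mid srho.
have s'0 : 0 < s' by exact: le_lt_trans ss'.
have [B hB] := gu s' s'0 s'rho.
have [q0 q1] := ratio01 s0 ss'.
exists (B * (1 - s / s')^-1) => n.
apply: (@le_trans _ _ (\sum_(k < n) B * (s / s') ^+ k)).
  apply: ler_sum => k _.
  have -> : s ^+ k = s' ^+ k * (s / s') ^+ k.
    by rewrite -exprMn mulrC divfK // gt_eqF.
  by rewrite mulrA ler_wpM2r // exprn_ge0.
by rewrite -mulr_sumr ler_wpM2l ?geo_sum_le // (geo_ge0 hB).
Qed.

Definition psum (u : nat -> C) (z : C) (n : nat) : C := \sum_(k < n) u k * z ^+ k.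

(** Real and imaginary parts are limits taken separately in R, where absolute convergence yields
    convergence. *)
Definition pser (u : nat -> C) (z : C) : C :=
  Complex (limn (fun n => cre (psum u z n))) (limn (fun n => cim (psum u z n))).

Lemma real_series_cvg (w : nat -> R) (B : R) :
  (forall n, \sum_(k < n) `|w k| <= B) -> cvgn (fun n => \sum_(k < n) w k).
Proof.
move=> hB; have -> : (fun n => \sum_(k < n) w k) = series w.
  by rewrite seriesEord.
apply: normed_cvg; apply: nondecreasing_is_cvgn.
  by apply: nondecreasing_series => n _ _; exact: normr_ge0.
by exists B => _ [n _ <-]; rewrite /normed_series_of seriesEord; exact: hB.
Qed.

Lemma pser_tends rho u z : geo rho u -> cabs z < rho -> tends (psum u z) (pser u z).
Proof.
move=> gu zrho; have [B hB] := geo_abs_sum gu (cabs_ge0 z) zrho.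
have key (p : C -> R) : (forall c, `|p c| <= cabs c) ->
    (forall c d, p (c + d) = p c + p d) -> cvgn (fun n => p (psum u z n)).
  move=> ple pD; have p0 : p 0 = 0.
    by apply/eqP; rewrite -normr_le0 (le_trans (ple 0)) // cabs0.
  have -> : (fun n => p (psum u z n)) = (fun n => \sum_(k < n) p (u k * z ^+ k)).
    by apply/funext => n; rewrite /psum (big_morph p pD p0).
  suff hw n : \sum_(k < n) `|p (u k * z ^+ k)| <= B 
    by exact: (@real_series_cvg (fun k => p (u k * z ^+ k)) B hw).
  apply: le_trans (hB n).
  by apply: ler_sum => k _; rewrite -cabsX -cabsM.
move=> e e0; have e2 : 0 < e / 2 by lra.
have /cvgrPdist_lt/(_ _ e2)[N _ hN] := key _ cre_le creD.
have /cvgrPdist_lt/(_ _ e2)[M _ hM] := key _ cim_le cimD.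
exists (maxn N M) => n; rewrite geq_max => /andP[Nn Mn].
have := hN n Nn; have := hM n Mn; rewrite /= => h1 h2.
rewrite cabs_distC; apply: (le_lt_trans (cabs_le_ReIm _)).
rewrite creB cimB /=; lra.
Qed.

Lemma pserD rho u v z : geo rho u -> geo rho v -> cabs z < rho ->
  pser (fun k => u k + v k) z = pser u z + pser v z.
Proof.
move=> gu gv zr; apply: (tends_unique (pser_tends (geoD gu gv) zr)).
have := tendsD (pser_tends gu zr) (pser_tends gv zr).
congr (tends _ _); apply/funext => n; rewrite /psum -big_split /=.
by apply: eq_bigr => k _; rewrite mulrDl.
Qed.

Lemma pserZ rho c u z : geo rho u -> cabs z < rho ->
  pser (fun k => c * u k) z = c * pser u z.
Proof.
move=> gu zr; apply: (tends_unique (pser_tends (geoZ c gu) zr)).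
have := tendsZ c (pser_tends gu zr).
congr (tends _ _); apply/funext => n; rewrite /psum mulr_sumr.
by apply: eq_bigr => k _; rewrite mulrA.
Qed.

Lemma pser0 u : pser u 0 = u 0%N.
Proof.
have E n : psum u 0 n.+1 = u 0%N.
  rewrite /psum big_ord_recl expr0 mulr1 big1 ?addr0 // => i _.
  by rewrite expr0n mulr0.
have key (p : C -> R) : limn (fun n => p (psum u 0 n)) = p (u 0%N).
  apply: cvg_lim => //; rewrite -(cvg_shiftS (fun n => p (psum u 0 n))) /=.
  under eq_fun do rewrite E; exact: cvg_cst.
by apply: cplx_ext; rewrite /= key.
Qed.

Definition pder (u : nat -> C) k : C := k.+1%:R * u k.+1.

Lemma geo_pder rho u : geo rho u -> geo rho (pder u).
Proof.
move=> gu s s0 srho; have [B hB] := geo_shift (geo_mulS gu) s0 srho.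
exists B => n; apply: le_trans (hB n).
rewrite /pder !cabsM !cabs_nat.
by rewrite ler_wpM2r ?exprn_ge0 ?(ltW s0) // ler_wpM2r ?cabs_ge0 // ler_nat.
Qed.

(** The second-order Taylor remainder of a power. The factor s on the left stands for the exponent k
    - 1 on the right, which makes no sense at k = 0. *)
Lemma expr_diff2_le (z h : C) (s : R) k : cabs z <= s -> cabs (z + h) <= s ->
  s * cabs ((z + h) ^+ k.+1 - z ^+ k.+1 - h * (k.+1%:R * z ^+ k)) <=
  k.+1%:R ^+ 2 * s ^+ k * cabs h ^+ 2.
Proof.
move=> zs zhs; have s0 : 0 <= s by exact: le_trans (cabs_ge0 z) zs.
elim: k => [|k IH].
  have -> : (z + h) ^+ 1 - z ^+ 1 - h * (1 * z ^+ 0) = 0 by ring.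
  by rewrite cabs0 mulr0 mulr_ge0 ?sqr_ge0 // mulr_ge0.
set E := (X in s * cabs X <= _) in IH.
have -> : (z + h) ^+ k.+2 - z ^+ k.+2 - h * (k.+2%:R * z ^+ k.+1) =
   (z + h) * E + k.+1%:R * z ^+ k * h ^+ 2.
  rewrite /E !exprS -(natr1 k.+1); ring.
apply: (@le_trans _ _ (s * (s * cabs E + k.+1%:R * s ^+ k * cabs h ^+ 2))).
  rewrite ler_wpM2l // (le_trans (ler_cabsD _ _)) // lerD //.
    by rewrite cabsM ler_wpM2r ?cabs_ge0.
  rewrite !cabsM cabs_nat !cabsX.
  rewrite ler_wpM2r ?sqr_ge0 // ler_wpM2l // lerXn2r ?nnegrE ?cabs_ge0 //.
have -> : k.+2%:R ^+ 2 * s ^+ k.+1 * cabs h ^+ 2 =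
  s * (k.+1%:R ^+ 2 * s ^+ k * cabs h ^+ 2 + k.+1%:R * s ^+ k * cabs h ^+ 2)
  + k.+2%:R * s ^+ k.+1 * cabs h ^+ 2.
  rewrite !exprS -(natr1 k.+1); ring.
apply: ler_wpDr; first by rewrite mulr_ge0 ?sqr_ge0 // mulr_ge0 ?exprn_ge0.
by rewrite ler_wpM2l // lerD2r.
Qed.

Lemma cder_of_quadratic (f : C -> C) (z l : C) (K d : R) : 0 < d ->
  (forall h, cabs h < d -> cabs (f (z + h) - f z - h * l) <= K * cabs h ^+ 2) ->
  cder f z l.
Proof.
move=> d0 H; apply/is_deriveCP => e e0.
have K0 : 0 < `|K| + 1 by rewrite ltr_wpDl.
exists (Num.min d (e / (`|K| + 1))); first by rewrite lt_min d0 divr_gt0.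
move=> h; rewrite lt_min => /andP[/H hd]; rewrite ltr_pdivlMr // => he.
apply: (le_trans hd); rewrite expr2 mulrA ler_wpM2r ?cabs_ge0 //.
have := ler_norm K; have := cabs_ge0 h; nra.
Qed.

Lemma cder_pser rho u z : geo rho u -> cabs z < rho ->
  cder (pser u) z (pser (pder u) z).
Proof.
move=> gu zr; have [s [zs srho]] := geo_mid zr.
have s0 : 0 < s by exact: le_lt_trans (cabs_ge0 z) zs.
(* B bounds the sums of (k + 1)^2 |u_(k+1)| s^k, which are the weights produced by [expr_diff2_le].
   The quadratic estimate is proved for partial sums and passes to the limit. *)
have [B hB] := geo_abs_sum (geo_mulS (geo_pder gu)) (ltW s0) srho.
have d0 : 0 < s - cabs z by rewrite subr_gt0.
apply: (cder_of_quadratic (K := B / s) d0) => h hd.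
have zhs : cabs (z + h) < s by have := ler_cabsD z h; lra.
have T := tendsB (tendsB (tendsS (pser_tends gu (lt_trans zhs srho)))
  (tendsS (pser_tends gu zr))) (tendsZ h (pser_tends (geo_pder gu) zr)).
apply: (tends_le T) => n {T}.
have -> : psum u (z + h) n.+1 - psum u z n.+1 - h * psum (pder u) z n =
  \sum_(k < n) u k.+1 *
    ((z + h) ^+ k.+1 - z ^+ k.+1 - h * (k.+1%:R * z ^+ k)).
  rewrite /psum !big_ord_recl !expr0 opprD addrACA subrr add0r mulr_sumr.
  rewrite -!sumrB; apply: eq_bigr => k _.
  by rewrite lift0 /pder; ring.
apply: (le_trans (cabs_sum _ _ _)).
apply: (@le_trans _ _ (\sum_(k < n) cabs (k.+1%:R * pder u k) * s ^+ k
   * (cabs h ^+ 2 / s))); last first.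
  rewrite -mulr_suml [X in _ <= X]mulrAC -mulrA.
  by rewrite ler_wpM2r // divr_ge0 ?sqr_ge0 // ltW.
apply: ler_sum => k _.
have := expr_diff2_le k (ltW zs) (ltW zhs).
move=> hE.
rewrite [X in _ <= X]mulrA ler_pdivlMr // /pder !cabsM.
rewrite !cabs_nat.
have -> : k.+1%:R * (k.+1%:R * cabs (u k.+1)) * s ^+ k * cabs h ^+ 2 =
  cabs (u k.+1) * (k.+1%:R ^+ 2 * s ^+ k * cabs h ^+ 2) by ring.
by rewrite -[X in X <= _]mulrA ler_wpM2l ?cabs_ge0 // mulrC; exact: hE.
Qed.

End PowerSeries.

(** * Products of power series and existence of solutions on discs *)

Section Convolution.
Context {R : realType}.
Local Notation C := (Cplx R).

Definition conv (u v : nat -> C) (n : nat) : C := \sum_(i < n.+1) u i * v (n - i)%N.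

Definition trunc N (u : nat -> C) : {poly C} := \poly_(i < N) u i.

Lemma coef_trunc N u i : (i < N)%N -> (trunc N u)`_i = u i.
Proof. by move=> h; rewrite coef_poly h. Qed.

(** Truncation turns convolution into multiplication of polynomials, from which commutativity and
    associativity are inherited. *)
Lemma convE N u v n : (n < N)%N -> conv u v n = (trunc N u * trunc N v)`_n.
Proof.
move=> nN; rewrite coefM; apply: eq_bigr => i _.
rewrite !coef_trunc //; first by rewrite (leq_ltn_trans (leq_subr _ _)).
by rewrite (leq_trans _ nN) // ltn_ord.
Qed.

Lemma convC u v : conv u v = conv v u.
Proof. by apply/funext => n; rewrite !(convE _ _ (ltnSn n)) mulrC. Qed.

Lemma convA u v w : conv u (conv v w) = conv (conv u v) w.
Proof.
apply/funext => n; pose N := n.+1.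
have L a b c : conv (conv a b) c n = (trunc N a * trunc N b * trunc N c)`_n.
  rewrite coefM; apply: eq_bigr => i _; rewrite -convE ?ltn_ord //.
  by rewrite coef_trunc // ltnS leq_subr.
by rewrite convC !L mulrC mulrA.
Qed.

Lemma convDl u v w : conv (fun k => u k + v k) w = fun k => conv u w k + conv v w k.
Proof.
apply/funext => n; rewrite /conv -big_split /=.
by apply: eq_bigr => i _; rewrite mulrDl.
Qed.

Lemma convZl c u w : conv (fun k => c * u k) w = fun k => c * conv u w k.
Proof.
apply/funext => n; rewrite /conv mulr_sumr.
by apply: eq_bigr => i _; rewrite mulrA.
Qed.

Definition delta (n : nat) : C := (n == 0%N)%:R.

Lemma conv_delta u : conv delta u = u.
Proof.
apply/funext => n; rewrite /conv big_ord_recl /delta eqxx mul1r subn0.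
by rewrite big1 ?addr0 // => i _; rewrite lift0 mul0r.
Qed.

Lemma geo_conv (rho : R) u v : geo rho u -> geo rho v -> geo rho (conv u v).
Proof.
move=> gu gv s s0 srho; have [s' [ss' s'rho]] := geo_mid srho.
have s'0 := lt_trans s0 ss'.
have [B hB] := gu s' s'0 s'rho; have [B' hB'] := gv s' s'0 s'rho.
have [q0 q1] := ratio01 (ltW s0) ss'.
exists ((1 - s / s')^-1 * (B * B')) => n.
rewrite (geo_dom n s0 ss') mulrCA mulrC.
apply: (@le_trans _ _ ((n.+1%:R * (B * B')) * (s / s') ^+ n)).
  rewrite ler_wpM2r ?exprn_ge0 //.
  apply: (@le_trans _ _ (\sum_(i < n.+1) B * B')); last first.
    by rewrite sumr_const card_ord mulr_natl.
  rewrite mulrC; apply: (@le_trans _ _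
    (s' ^+ n * \sum_(i < n.+1) cabs (u i) * cabs (v (n - i)%N))).
    rewrite ler_wpM2l ?exprn_ge0 ?(ltW s'0) // (le_trans (cabs_sum _ _ _)) //.
    by apply: ler_sum => i _; rewrite cabsM.
  rewrite mulr_sumr; apply: ler_sum => i _.
  have -> : s' ^+ n = s' ^+ i * s' ^+ (n - i) by rewrite -exprD subnKC // -ltnS.
  rewrite mulrACA [_ * cabs (u _)]mulrC [_ * cabs (v _)]mulrC.
  by apply: ler_pM; rewrite ?mulr_ge0 ?cabs_ge0 ?exprn_ge0 ?(ltW s'0).
rewrite mulrAC ler_wpM2r ?nat_geo_le // mulr_ge0 // ?(geo_ge0 hB) //.
exact: geo_ge0 hB'.
Qed.

Definition cf (p : {poly C}) (n : nat) : C := p`_n.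

Lemma geo_poly rho p : geo rho (cf p).
Proof.
move=> s s0 _; exists (\sum_(i < size p) cabs p`_i * s ^+ i) => n.
have t0 (i : 'I_(size p)) : 0 <= cabs p`_i * s ^+ i.
  by rewrite mulr_ge0 ?cabs_ge0 ?exprn_ge0 ?(ltW s0).
have [ns|ns] := ltnP n (size p); last first.
  have -> : cf p n = 0 by rewrite /cf nth_default.
  by rewrite cabs0 mul0r sumr_ge0.
by rewrite (bigD1 (Ordinal ns)) //= lerDl sumr_ge0.
Qed.

Lemma cfM p q : cf (p * q) = conv (cf p) (cf q).
Proof. by apply/funext => n; rewrite /cf coefM. Qed.

Definition shiftr (u : nat -> C) n : C := if n is k.+1 then u k else 0.

Lemma geo_shiftr (rho : R) u : geo rho u -> geo rho (shiftr u).
Proof.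
move=> gu s s0 srho; have [B hB] := gu s s0 srho.
exists (B * s) => -[|n].
  by rewrite -[shiftr u 0]/(0 : C) cabs0 mul0r mulr_ge0 ?(geo_ge0 hB) // ltW.
by rewrite -[shiftr u n.+1]/(u n) exprSr mulrA ler_wpM2r // ltW.
Qed.

Lemma pser_shiftr (rho : R) u z : geo rho u -> cabs z < rho ->
  pser (shiftr u) z = z * pser u z.
Proof.
move=> gu zr; apply: (tends_unique (tendsS (pser_tends (geo_shiftr gu) zr))).
have := tendsZ z (pser_tends gu zr).
congr (tends _ _); apply/funext => n; rewrite /psum big_ord_recl mul0r add0r.
rewrite mulr_sumr; apply: eq_bigr => k _. rewrite lift0 exprS /=; ring.
Qed.

Lemma conv_cfMXaddC p c u :
  conv (cf (p * 'X + c%:P)) u = fun k => shiftr (conv (cf p) u) k + c * u k.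
Proof.
apply/funext => n; rewrite /conv big_ord_recl subn0 /cf coefD coefMX coefC /=.
rewrite add0r addrC; congr (_ + _).
case: n => [|n]; first by rewrite big_ord0.
by apply: eq_bigr => i _; rewrite coefD coefMX coefC /= addr0 subSS.
Qed.

(** Since one factor is a polynomial, induction along Horner's scheme, with [shiftr] for
    multiplication by the variable, replaces a theorem on Cauchy products. *)
Lemma pser_conv_poly (rho : R) p u z : geo rho u -> cabs z < rho ->
  pser (conv (cf p) u) z = p.[z] * pser u z.
Proof.
move=> gu zr; elim/poly_ind: p => [|p c IH].
  have -> : conv (cf 0) u = fun k => 0 * u k.
    apply/funext => n; rewrite mul0r /conv big1 // => i _.
    by rewrite /cf coef0 mul0r.
  by rewrite (pserZ _ gu zr) horner0.
have gp := geo_conv (geo_poly (rho:=rho) p) gu.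
rewrite conv_cfMXaddC (pserD (geo_shiftr gp) (geoZ c gu) zr).
rewrite (pserZ _ gu zr) (pser_shiftr gp zr) IH hornerMXaddC; ring.
Qed.

(** The inverse is the geometric series of 1 / (X - al), with coefficients - al^-(k+1). *)
Lemma inv_linear_geo (rho : R) (al : C) : 0 < rho -> rho <= cabs al ->
  exists2 r, geo rho r & conv (cf ('X - al%:P)) r = delta.
Proof.
move=> rho0 hal; have al0 : al != 0 by rewrite -cabs_gt0 (lt_le_trans rho0).
exists (fun k => - al^-1 ^+ k.+1).
  move=> s s0 srho; exists (cabs al)^-1 => n.
  rewrite cabsN cabsX cabsV exprS -mulrA -exprMn ler_piMr ?invr_ge0 ?cabs_ge0 //.
  rewrite mulrC exprn_ile1 ?divr_ge0 ?cabs_ge0 ?(ltW s0) //.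
  by rewrite ler_pdivrMr ?cabs_gt0 // mul1r (le_trans (ltW srho)).
have -> : 'X - al%:P = 1 * 'X + (- al)%:P by rewrite mul1r polyCN.
rewrite conv_cfMXaddC; apply/funext => n.
have -> : cf 1 = delta by apply/funext => k; rewrite /cf coef1.
rewrite conv_delta /delta; case: n => [|n] /=; first by field.
by rewrite [in X in _ + X]exprS; field.
Qed.

(** Q is a constant times linear factors whose roots all lie outside the disc; their geometric
    series are multiplied together. *)
Lemma inv_poly_geo (rho : R) (Q : {poly C}) : 0 < rho ->
  (forall z, cabs z < rho -> Q.[z] != 0) ->
  exists2 r, geo rho r & conv (cf Q) r = delta.
Proof.
move=> rho0 Q0; have [rs Qrs] := closed_field_poly_normal Q.
have l0 : lead_coef Q != 0.
  by rewrite lead_coef_eq0; apply: contraNneq (Q0 0 _) => [->|]; rewrite ?horner0 ?cabs0.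
have rsP al : al \in rs -> rho <= cabs al.
  move=> alrs; rewrite leNgt; apply/negP => /Q0/negP; apply.
  by rewrite Qrs hornerZ mulf_eq0 -[X in _ || X]/(root _ _) root_prod_XsubC alrs orbT.
have [r gr hr] : exists2 r, geo rho r &
    conv (cf (\prod_(z <- rs) ('X - z%:P))) r = delta.
  elim: rs rsP {Qrs} => [|al rs IH] rsP.
    exists delta.
      have := geo_poly (rho:=rho) 1; have -> // : cf 1 = delta.
      by apply/funext => k; rewrite /cf coef1.
    rewrite big_nil; have -> : cf 1 = delta by apply/funext => k; rewrite /cf coef1.
    by rewrite conv_delta.
  have [|r gr hr] := IH; first by move=> b hb; apply: rsP; rewrite inE hb orbT.
  have [r' gr' hr'] := inv_linear_geo rho0 (rsP al (mem_head _ _)).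
  exists (conv r r'); first exact: geo_conv.
  rewrite big_cons cfM -convA (convA _ r) hr conv_delta.
  by rewrite hr'.
exists (fun k => (lead_coef Q)^-1 * r k); first exact: geoZ.
have EQ : cf Q = fun k => lead_coef Q * cf (\prod_(z <- rs) ('X - z%:P)) k.
  by apply/funext => k; rewrite /cf {1}Qrs coefZ.
rewrite convC convZl; apply/funext => n.
by rewrite (convC r) EQ convZl hr mulKf.
Qed.


(** With q = s / s', the weighted sizes t_n = (|u_n| + |v_n|) s^n satisfy (n + 1) t_(n+1) <= M s
    (t_n + q t_(n-1) + ...). The division by n + 1 eventually beats the constant M s / (1 - q), so
    the t_n stay bounded for every s < rho, whatever the size of the coefficients. *)
Lemma geo_rec (rho : R) (a11 a12 a21 a22 u v : nat -> C) :
  geo rho a11 -> geo rho a12 -> geo rho a21 -> geo rho a22 ->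
  (forall n, n.+1%:R * u n.+1 = conv a11 u n + conv a12 v n) ->
  (forall n, n.+1%:R * v n.+1 = conv a21 u n + conv a22 v n) ->
  geo rho u /\ geo rho v.
Proof.
move=> g11 g12 g21 g22 hu hv.
suff H (s : R) : 0 < s -> s < rho ->
    exists K : R, forall n, (cabs (u n) + cabs (v n)) * s ^+ n <= K.
  by split=> s s0 srho; have [K hK] := H s s0 srho; exists K => n;
    apply: le_trans (hK n); rewrite ler_wpM2r ?exprn_ge0 ?(ltW s0) //
      (lerDl, lerDr) cabs_ge0.
move=> s0 srho; have [s' [ss' s'rho]] := geo_mid srho.
have s'0 := lt_trans s0 ss'; have [q0 q1] := ratio01 (ltW s0) ss'.
set q := s / s' in q0 q1.
have [M [M0 hM]] : exists M : R, 0 <= M /\ forall n,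
    (cabs (a11 n) + cabs (a21 n)) * s' ^+ n <= M /\
    (cabs (a12 n) + cabs (a22 n)) * s' ^+ n <= M.
  have [B1 h1] := g11 s' s'0 s'rho; have [B2 h2] := g12 s' s'0 s'rho.
  have [B3 h3] := g21 s' s'0 s'rho; have [B4 h4] := g22 s' s'0 s'rho.
  have := geo_ge0 h1; have := geo_ge0 h2; have := geo_ge0 h3; have := geo_ge0 h4.
  move=> b4 b3 b2 b1; exists (B1 + B2 + B3 + B4); split; first by lra.
  by move=> n; have := h1 n; have := h2 n; have := h3 n; have := h4 n; rewrite !mulrDl; split; lra.
pose t n := (cabs (u n) + cabs (v n)) * s ^+ n.
have t0 n : 0 <= t n by rewrite mulr_ge0 ?exprn_ge0 ?(ltW s0) // addr_ge0 ?cabs_ge0.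
have rec n : n.+1%:R * t n.+1 <= M * s * \sum_(i < n.+1) q ^+ i * t (n - i)%N.
  have step : n.+1%:R * (cabs (u n.+1) + cabs (v n.+1)) <=
      \sum_(i < n.+1) ((cabs (a11 i) + cabs (a21 i)) * cabs (u (n - i)%N) +
                       (cabs (a12 i) + cabs (a22 i)) * cabs (v (n - i)%N)).
    have := hu n; have := hv n => /(congr1 cabs) + /(congr1 cabs).
    rewrite !cabsM !cabs_nat mulrDr => -> ->.
    apply: (le_trans (lerD (ler_cabsD _ _) (ler_cabsD _ _))).
    apply: (le_trans (lerD (lerD (cabs_sum _ _ _) (cabs_sum _ _ _))
      (lerD (cabs_sum _ _ _) (cabs_sum _ _ _)))).
    rewrite -!big_split /=; apply: ler_sum => i _; rewrite !cabsM; lra.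
  rewrite mulrA; apply: (@le_trans _ _ _ _ _ (ler_wpM2r _ step)).
    by rewrite exprn_ge0 // ltW.
  rewrite mulr_suml mulr_sumr; apply: ler_sum => i _.
  have -> : s ^+ n.+1 = s * (s ^+ i * s ^+ (n - i)).
    by rewrite -exprD subnKC // ?exprS // -ltnS.
  have -> : s ^+ i = q ^+ i * s' ^+ i by exact: geo_dom.
  have [h1 h2] := hM i.
  have -> : M * s * (q ^+ i * t (n - i)%N) = (s * q ^+ i * s ^+ (n - i)) *
     (M * cabs (u (n - i)%N) + M * cabs (v (n - i)%N)) by rewrite /t; ring.
  set a := cabs (a11 i) + _ in h1 *; set b := cabs (a12 i) + _ in h2 *.
  have -> : (a * cabs (u (n - i)%N) + b * cabs (v (n - i)%N)) *
     (s * (q ^+ i * s' ^+ i * s ^+ (n - i))) = (s * q ^+ i * s ^+ (n - i)) *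
     ((a * s' ^+ i) * cabs (u (n - i)%N) + (b * s' ^+ i) * cabs (v (n - i)%N)) by ring.
  rewrite ler_wpM2l ?mulr_ge0 ?exprn_ge0 ?(ltW s0) //.
  by apply: lerD; rewrite ler_wpM2r ?cabs_ge0.
have q1' : 0 < 1 - q by rewrite subr_gt0.
(* From index N on, the recursion cannot exceed a bound valid for all earlier terms. The sum of the
   first N + 1 terms serves as that bound. *)
have [N hN] : exists N, M * s * (1 - q)^-1 <= N%:R.
  exists (Num.truncn (M * s * (1 - q)^-1)).+1; apply/ltW.
  by rewrite truncnS_gt.
exists (\sum_(j < N.+1) t j) => n.
rewrite -/(t n); elim/ltn_ind: n => n IH.
have [nN|nN] := leqP n N.
  rewrite (bigD1 (Ordinal (nN : (n < N.+1)%N))) //= lerDl.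
  by apply: sumr_ge0 => i _; exact: t0.
case: n nN IH => [//|n] nN IH; set K := \sum_(_ < _) _ in IH *.
have K0 : 0 <= K by apply: sumr_ge0 => i _; exact: t0.
have n0 : 0 < n.+1%:R :> R by rewrite ltr0n.
rewrite -(ler_pM2l n0); apply: (le_trans (rec n)).
apply: (@le_trans _ _ (M * s * ((1 - q)^-1 * K))).
  rewrite ler_wpM2l ?mulr_ge0 ?(ltW s0) //.
  apply: (@le_trans _ _ (\sum_(i < n.+1) q ^+ i * K)).
    by apply: ler_sum => i _; rewrite ler_wpM2l ?exprn_ge0 // IH // ltnS leq_subr.
  by rewrite -mulr_suml ler_wpM2r // geo_sum_le.
rewrite mulrA ler_wpM2r // (le_trans hN) // ler_nat.
exact: ltnW.
Qed.

Section Recursion.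
Variables (a11 a12 a21 a22 : nat -> C) (u0 v0 : C).

(** Course-of-values recursion: coefficient m + 1 depends on all earlier ones, so stage n is a whole
    function, correct up to index n. *)
Fixpoint rec_table n : nat -> C * C :=
  if n is m.+1 then
    let T := rec_table m in
    fun k => if (k <= m)%N then T k else
      (m.+1%:R^-1 * (conv a11 (fun j => (T j).1) m + conv a12 (fun j => (T j).2) m),
       m.+1%:R^-1 * (conv a21 (fun j => (T j).1) m + conv a22 (fun j => (T j).2) m))
  else fun=> (u0, v0).

Lemma rec_table_stable n k : (k <= n)%N -> rec_table n k = rec_table k k.
Proof.
elim: n => [|n IH]; first by rewrite leqn0 => /eqP ->.
rewrite leq_eqVlt => /orP[/eqP -> //|]; rewrite ltnS => kn.
by rewrite /= kn IH.
Qed.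

Lemma conv_ext (a u u' : nat -> C) n : (forall k, (k <= n)%N -> u k = u' k) ->
  conv a u n = conv a u' n.
Proof. by move=> h; apply: eq_bigr => i _; rewrite h // leq_subr. Qed.

Lemma rec_exists : exists u v : nat -> C, [/\ u 0%N = u0, v 0%N = v0,
  forall n, n.+1%:R * u n.+1 = conv a11 u n + conv a12 v n &
  forall n, n.+1%:R * v n.+1 = conv a21 u n + conv a22 v n].
Proof.
exists (fun k => (rec_table k k).1), (fun k => (rec_table k k).2).
split=> // n; rewrite [rec_table n.+1 _]/= ltnn /= mulVKf ?pnatr_eq0 //;
  by congr (_ + _); apply: conv_ext => k kn; rewrite rec_table_stable.
Qed.

End Recursion.

(** The formal solution converges on every disc free of zeros of Q. A 2 by 2 system serves both for
    the equation itself, written in (u, u'), and for the first-order equation of the inverse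
    Wronskian in [disc_fund]. *)
Theorem disc_system (c : C) (rho : R) (Q b11 b12 b21 b22 : {poly C}) (u0 v0 : C) :
  0 < rho -> (forall z, cabs (z - c) < rho -> Q.[z] != 0) ->
  exists u v : C -> C, [/\ u c = u0, v c = v0 & forall z, cabs (z - c) < rho ->
    cder u z ((b11.[z] * u z + b12.[z] * v z) / Q.[z]) /\
    cder v z ((b21.[z] * u z + b22.[z] * v z) / Q.[z])].
Proof.
move=> rho0 Q0; pose sh (p : {poly C}) := p \Po ('X + c%:P).
have shE p z : (sh p).[z] = p.[z + c] by rewrite horner_comp !hornerE.
have [|r gr hr] := @inv_poly_geo rho (sh Q) rho0.
  by move=> z zr; rewrite shE Q0 // addrK.
pose a p := conv r (cf (sh p)).
have ga p : geo rho (a p) by apply: geo_conv gr _; exact: geo_poly.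
have [U [V [U0 V0 hU hV]]] := rec_exists (a b11) (a b12) (a b21) (a b22) u0 v0.
have [gU gV] := geo_rec (ga b11) (ga b12) (ga b21) (ga b22) hU hV.
have key W b b' z : geo rho W -> cabs z < rho ->
    (forall n, n.+1%:R * W n.+1 = conv (a b) U n + conv (a b') V n) ->
    cder (pser W) z
      (((sh b).[z] * pser U z + (sh b').[z] * pser V z) / (sh Q).[z]).
  move=> gW zr hW; have Qz : (sh Q).[z] != 0 by rewrite shE Q0 // addrK.
  have -> : ((sh b).[z] * pser U z + (sh b').[z] * pser V z) / (sh Q).[z] =
     pser (pder W) z; last exact: cder_pser gW zr.
  (* After multiplication by Q the claim concerns the series of Q W', where convolution with Q
     cancels the inverse series r inside the coefficients. *)
  apply: (mulIf Qz); rewrite divfK // [X in _ = X]mulrC.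
  rewrite -(pser_conv_poly _ (geo_pder gW) zr).
  have -> : pder W = fun k => conv (a b) U k + conv (a b') V k.
    by apply/funext => n; rewrite /pder hW.
  rewrite convC convDl !(convC _ (cf _)) /a.
  rewrite !(convA (cf (sh Q))) -!(convA (cf (sh Q))) !convA hr !conv_delta.
  rewrite (pserD _ _ zr); try by apply: geo_conv => //; exact: geo_poly.
  by rewrite (pser_conv_poly _ gU zr) (pser_conv_poly _ gV zr).
have sub z : cder (fun w => w - c) z 1.
  by have := cderB (cder_id z) (cder_cst c z); rewrite subr0.
exists (fun z => pser U (z - c)), (fun z => pser V (z - c)).
rewrite subrr !pser0; split=> // z zr.
have E p : p.[z] = (sh p).[z - c] by rewrite shE subrK.
rewrite !E; split.
  by have := cder_comp (sub z) (key U b11 b12 _ gU zr hU); rewrite mulr1.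
by have := cder_comp (sub z) (key V b21 b22 _ gV zr hV); rewrite mulr1.
Qed.

End Convolution.

(** * Solutions and their continuation *)

Section TwoByTwo.
Variable K : fieldType.
Implicit Types (A B g : 'M[K]_2).

Lemma sum2 (V : nmodType) (f : 'I_2 -> V) : \sum_i f i = f ord0 + f ord_max.
Proof. by rewrite !big_ord_recl big_ord0 addr0; congr (_ + f _); apply: val_inj. Qed.

Lemma ord2P (P : 'I_2 -> Prop) : P ord0 -> P ord_max -> forall i, P i.
Proof.
move=> p0 p1 [[|[|//]] h]; first by rewrite (_ : Ordinal h = ord0) //; exact: val_inj.
by rewrite (_ : Ordinal h = ord_max) //; exact: val_inj.
Qed.

Lemma trace2 A : \tr A = A ord0 ord0 + A ord_max ord_max.
Proof. exact: sum2. Qed.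

Lemma mul2E A B i j : (A *m B) i j = A i ord0 * B ord0 j + A i ord_max * B ord_max j.
Proof. by rewrite mxE sum2. Qed.

Lemma det2E A : \det A = A ord0 ord0 * A ord_max ord_max - A ord0 ord_max * A ord_max ord0.
Proof.
rewrite (expand_det_row _ ord0) sum2 /cofactor !det_mx11 !mxE /=.
have -> : lift ord0 (0 : 'I_1) = ord_max :> 'I_2 by apply: val_inj.
have -> : lift ord_max (0 : 'I_1) = ord0 :> 'I_2 by apply: val_inj.
by rewrite expr0 expr1; ring.
Qed.

(** The words in A, B and their inverses grow on the right, as each change of chart along a path
    multiplies the coefficient matrix on the right. *)
Inductive gen2 A B : 'M[K]_2 -> Prop :=
| gen2_1 : gen2 A B 1%:M
| gen2_P g : gen2 A B g -> gen2 A B (g *m A)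
| gen2_PV g : gen2 A B g -> gen2 A B (g *m invmx A)
| gen2_Q g : gen2 A B g -> gen2 A B (g *m B)
| gen2_QV g : gen2 A B g -> gen2 A B (g *m invmx B).

End TwoByTwo.

Section SolutionSpaces.
Context {R : realType}.
Local Notation C := (Cplx R).
Local Notation RC := (real_complex R).
Implicit Types (L : lode R) (U V : set C) (y : C -> C) (w z : C).
Implicit Types (Y Z : 'I_2 -> C -> C) (M : 'M[C]_2).

Definition sol_at L y w : Prop :=
  [/\ derivable y w 1, derivable (derive1 y) w 1
    & derive1 (derive1 y) w + reval (lcoef1 L) w * derive1 y w
      + reval (lcoef0 L) w * y w = 0].

Definition sol_on L U y : Prop := forall w, U w -> sol_at L y w.

Definition opn U : Prop := forall z, U z -> \forall w \near z, U w.

Definition cvx U : Prop := forall a b, U a -> U b ->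
  forall t : R, 0 <= t <= 1 -> U (a + RC t * (b - a)).

Definition regular_at L w : bool := ~~ root (rden (lcoef1 L)) w && ~~ root (rden (lcoef0 L)) w.

Lemma sol_atP L y w : sol_at L y w <->
  [/\ cder y w (derive1 y w) & cder (derive1 y) w
     (- (reval (lcoef1 L) w * derive1 y w + reval (lcoef0 L) w * y w))].
Proof.
split=> [[h1 h2 h3]|[h1 h2]].
  split; first exact: derivable_cder.
  have -> : - (reval (lcoef1 L) w * derive1 y w + reval (lcoef0 L) w * y w) =
    derive1 (derive1 y) w; last exact: derivable_cder.
  by apply/eqP; rewrite eq_sym -addr_eq0 addrA h3.
split; [exact: cder_derivable h1|exact: cder_derivable h2|].
by rewrite (cder_derive1 h2) -addrA addNr.
Qed.

Lemma derive1_near y y' z : (\forall w \near z, y w = y' w) ->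
  \forall w \near z, derive1 y w = derive1 y' w.
Proof.
move=> /near_ball[e e0 h]; apply: (ball_near e0) => w we.
rewrite (derive1E y w) (derive1E y' w); apply: near_eq_derive.
have d0 : 0 < e - cabs (w - z) by rewrite subr_gt0.
apply: (ball_near d0) => t ht; apply: h.
by apply: (le_lt_trans (ler_cabs_dist _ _ w)); lra.
Qed.

Lemma sol_at_near L y y' z : (\forall w \near z, y w = y' w) ->
  sol_at L y z -> sol_at L y' z.
Proof.
move=> yy' /sol_atP[h1 h2]; apply/sol_atP.
have yy1 := derive1_near yy'.
have E0 := nbhs_singleton yy'; have E1 := nbhs_singleton yy1.
by rewrite -E0 -E1; split; [exact: cder_near h1|exact: cder_near h2].
Qed.

Lemma sol_on_pair L U u v : opn U ->
  (forall w, U w -> cder u w (v w) /\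
     cder v w (- (reval (lcoef1 L) w * v w + reval (lcoef0 L) w * u w))) ->
  sol_on L U u /\ forall w, U w -> derive1 u w = v w.
Proof.
move=> oU h; have E w : U w -> derive1 u w = v w.
  by move=> /h[/cder_derive1].
split=> // w Uw; apply/sol_atP; rewrite E //; split; first by have [] := h w Uw.
have [_] := h w Uw; apply: cder_near; apply: filterS (oU w Uw) => t /E.
exact: esym.
Qed.

Lemma sol_at_lin L (c : 'I_2 -> C) Y w : (forall i, sol_at L (Y i) w) ->
  (\forall t \near w, forall i, sol_at L (Y i) t) ->
  sol_at L (fun t => \sum_i c i * Y i t) w /\
  derive1 (fun t => \sum_i c i * Y i t) w = \sum_i c i * derive1 (Y i) w.
Proof.
move=> h hn; pose f t := \sum_i c i * Y i t.
have D t : (forall i, sol_at L (Y i) t) ->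
    cder f t (\sum_i c i * derive1 (Y i) t).
  move=> ht; rewrite /f; under eq_fun do rewrite !big_ord_recl big_ord0.
  rewrite !big_ord_recl big_ord0.
  have /sol_atP[a0 _] := ht ord0; have /sol_atP[a1 _] := ht (lift ord0 ord0).
  exact: cderD (cderZ _ a0) (cderD (cderZ _ a1) (cder_cst 0 t)).
have D1 := cder_derive1 (D w h); split=> //.
apply/sol_atP; rewrite D1; split; first exact: D.
have : cder (fun t => \sum_i c i * derive1 (Y i) t) w
    (- (reval (lcoef1 L) w * (\sum_i c i * derive1 (Y i) w) +
        reval (lcoef0 L) w * (\sum_i c i * Y i w))).
  under eq_fun do rewrite !big_ord_recl big_ord0.
  rewrite !big_ord_recl !big_ord0.
  have /sol_atP[_ h0] := h ord0; have /sol_atP[_ h1] := h (lift ord0 ord0).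
  have := cderD (cderZ (c ord0) h0) (cderD (cderZ (c (lift ord0 ord0)) h1) (cder_cst 0 w)).
  move/cder_eq; apply.
  move: (reval _ w) (reval _ w) (derive1 _ w) (derive1 _ w) (Y _ w) (Y _ w).
  move: (c _) (c _) => *; ring.
have hnE : \forall t \near w, \sum_i c i * derive1 (Y i) t = derive1 f t.
  by apply: filterS hn => t ht; exact: esym (cder_derive1 (D t ht)).
exact: cder_near hnE.
Qed.

Definition wronskian Y w : C :=
  Y ord0 w * derive1 (Y ord_max) w - derive1 (Y ord0) w * Y ord_max w.

(** Independence is stated pointwise by the Wronskian, so it restricts at once to smaller domains
    and needs no base point. *)
Definition fund_on L U Y : Prop :=
  (forall i, sol_on L U (Y i)) /\ forall w, U w -> wronskian Y w != 0.

Lemma solve2 (a b c d x u : C) : a * d - b * c != 0 ->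
  x * a + u * c = 0 -> x * b + u * d = 0 -> x = 0 /\ u = 0.
Proof.
move=> D0 h1 h2; split; apply: (mulIf D0); rewrite mul0r.
  have -> : x * (a * d - b * c) = d * (x * a + u * c) - c * (x * b + u * d) by ring.
  by rewrite h1 h2 !mulr0 subrr.
have -> : u * (a * d - b * c) = a * (x * b + u * d) - b * (x * a + u * c) by ring.
by rewrite h1 h2 !mulr0 subrr.
Qed.

Lemma fund_indep_at L Y w (c : 'I_2 -> C) :
  wronskian Y w != 0 -> \sum_i c i * Y i w = 0 -> \sum_i c i * derive1 (Y i) w = 0 ->
  forall i, c i = 0.
Proof.
move=> W0; rewrite !sum2 => h1 h2.
by have [c0 c1] := solve2 W0 h1 h2; apply: ord2P.
Qed.

Lemma fund_indep L U Y w (c d : 'I_2 -> C) : opn U -> fund_on L U Y -> U w ->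
  (\forall t \near w, \sum_i c i * Y i t = \sum_i d i * Y i t) ->
  forall i, c i = d i.
Proof.
move=> oU [sY wY] Uw E i; apply/eqP; rewrite -subr_eq0; apply/eqP.
have hn : \forall t \near w, forall i, sol_at L (Y i) t.
  by apply: filterS (oU w Uw) => t Ut j; exact: sY.
have S j : sol_at L (Y j) w by exact: sY.
move: i; apply: (@fund_indep_at L Y w (fun i => c i - d i) (wY w Uw)).
  under eq_bigr do rewrite mulrBl.
  by rewrite sumrB (nbhs_singleton E) subrr.
have [_ Dc] := sol_at_lin c S hn; have [_ Dd] := sol_at_lin d S hn.
under eq_bigr do rewrite mulrBl.
by rewrite sumrB -Dc -Dd (nbhs_singleton (derive1_near E)) subrr.
Qed.

(** This is Abel's identity; all Wronskians of L satisfy the same first-order equation, so their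
    quotients are constant. *)
Lemma wronskian_der L Y w : (forall i, sol_at L (Y i) w) ->
  cder (wronskian Y) w (- reval (lcoef1 L) w * wronskian Y w).
Proof.
move=> h; have /sol_atP[a0 b0] := h ord0; have /sol_atP[a1 b1] := h ord_max.
have := cderB (cderM a0 b1) (cderM b0 a1).
move/cder_eq; apply; rewrite /wronskian.
move: (reval _ w) (reval _ w) (derive1 _ w) (derive1 _ w) (Y _ w) (Y _ w).
by move=> *; ring.
Qed.

(* By Cramer's rule the coefficients are quotients of Wronskians, whose derivatives vanish. *)
Lemma fund_rep L U Y y z : opn U -> cvx U -> fund_on L U Y -> sol_on L U y -> U z ->
  exists c : 'I_2 -> C, forall w, U w -> y w = \sum_i c i * Y i w.
Proof.
move=> oU cU [sY wY] sy Uz.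
pose Z0 : 'I_2 -> C -> C := fun i => if i == ord0 then y else Y ord_max.
pose Z1 : 'I_2 -> C -> C := fun i => if i == ord0 then Y ord0 else y.
have S0 w : U w -> forall i, sol_at L (Z0 i) w.
  by move=> Uw; apply: ord2P; [exact: sy|exact: sY].
have S1 w : U w -> forall i, sol_at L (Z1 i) w.
  by move=> Uw; apply: ord2P; [exact: sY|exact: sy].
have const Z : (forall w, U w -> forall i, sol_at L (Z i) w) ->
    forall w, U w -> wronskian Z w / wronskian Y w = wronskian Z z / wronskian Y z.
  move=> SZ w Uw; apply/esym; apply: (@cder0_line _ (fun w => wronskian Z w / wronskian Y w)).
  move=> t t01; set p := z + _; have Up : U p by exact: cU.
  have hZ := wronskian_der (SZ _ Up).
  have hY := wronskian_der (fun i => sY i p Up).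
  have := cder_div (wY p Up) hZ hY.
  move/cder_eq; apply; rewrite -[RHS](mul0r (wronskian Y p ^+ 2)^-1).
  congr (_ / _); move: (reval _ p) (wronskian _ p) (wronskian _ p) => *; ring.
exists (fun i => if i == ord0 then wronskian Z0 z / wronskian Y z
                 else wronskian Z1 z / wronskian Y z) => w Uw.
rewrite sum2 /= -(const Z0 S0 w Uw) -(const Z1 S1 w Uw).
rewrite /wronskian /Z0 /Z1 /=; have := wY w Uw; rewrite /wronskian.
move: (derive1 _ w) (derive1 _ w) (derive1 _ w) (Y _ w) (Y _ w) (y w) => *.
by field.
Qed.

End SolutionSpaces.

(** * Fundamental systems on discs and half-planes *)

Section FundamentalDomains.
Context {R : realType}.
Local Notation C := (Cplx R).
Local Notation RC := (real_complex R).
Implicit Types (L : lode R) (U V : set C) (y : C -> C) (w z b : C).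
Implicit Types (Y Z : 'I_2 -> C -> C).

Definition cdisc (c : C) (rho : R) : set C := [set w | cabs (w - c) < rho].

Lemma opn_cdisc c rho : opn (cdisc c rho).
Proof.
move=> z hz; have d0 : 0 < rho - cabs (z - c) by rewrite subr_gt0.
apply: (ball_near d0) => w hw; rewrite /cdisc /=.
by apply: (le_lt_trans (ler_cabs_dist _ _ z)); lra.
Qed.

Lemma cvx_cdisc c rho : cvx (cdisc c rho).
Proof.
move=> a b ha hb t /andP[t0 t1]; rewrite /cdisc /= in ha hb *.
have -> : a + RC t * (b - a) - c = RC (1 - t) * (a - c) + RC t * (b - c).
  by rewrite rmorphB rmorph1; ring.
apply: (le_lt_trans (ler_cabsD _ _)); rewrite !cabsM !cabs_real.
rewrite !ger0_norm ?subr_ge0 //.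
have [->|t0'] := eqVneq t 0; first by rewrite subr0 mul1r mul0r addr0.
have : 0 < t by rewrite lt_neqAle eq_sym t0' t0.
nra.
Qed.

Lemma disc_fund L c rho : 0 < rho ->
  (forall w, cdisc c rho w -> regular_at L w) -> exists Y, fund_on L (cdisc c rho) Y.
Proof.
move=> rho0 reg; pose Q := rden (lcoef1 L) * rden (lcoef0 L).
pose P1 := rnum (lcoef1 L) * rden (lcoef0 L).
pose P0 := rnum (lcoef0 L) * rden (lcoef1 L).
have Q0 z : cabs (z - c) < rho -> Q.[z] != 0.
  by move=> /reg/andP[h1 h2]; rewrite hornerM mulf_eq0 negb_or; apply/andP.
have q1 w : cdisc c rho w -> P1.[w] / Q.[w] = reval (lcoef1 L) w.
  move=> /reg/andP[h1 h2]; rewrite /reval !hornerM.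
  by move: h1 h2; rewrite /root; move: (_.[w]) (_.[w]) (_.[w]) => *; field; apply/andP.
have q0 w : cdisc c rho w -> P0.[w] / Q.[w] = reval (lcoef0 L) w.
  move=> /reg/andP[h1 h2]; rewrite /reval !hornerM.
  by move: h1 h2; rewrite /root; move: (_.[w]) (_.[w]) (_.[w]) => *; field; apply/andP.
have sys (u0 v0 : C) : exists u : C -> C, [/\ u c = u0, derive1 u c = v0 & sol_on L (cdisc c rho) u].
  have [u [v [uc vc h]]] := disc_system 0 Q (- P0) (- P1) u0 v0 rho0 Q0.
  have [] := @sol_on_pair _ L (cdisc c rho) u v (@opn_cdisc c rho).
    move=> w Uw; have [h1 h2] := h w Uw; split.
      apply: (cder_eq h1); rewrite horner0 mul0r add0r mulrC mulKf //.
      exact: Q0.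
    apply: (cder_eq h2); rewrite -q1 // -q0 // !hornerN.
    by move: (Q0 w Uw); move: (_.[w]) (_.[w]) (_.[w]) (u w) (v w) => *; field.
  move=> su du; exists u; split=> //; rewrite du // /cdisc /= subrr cabs0 //.
have [u [uc duc su]] := sys 1 0; have [v [vc dvc sv]] := sys 0 1.
exists (fun i => if i == ord0 then u else v); split; first by apply: ord2P.
(* T solves T' = p T with T(c) = 1, where p is the first coefficient of L. By Abel's identity the
   product of T and the Wronskian is constant, equal to 1 at c, so the Wronskian has no zero in the
   disc. *)
have [T [T' [Tc _ hT]]] := disc_system P1 0 0 0 1 0 rho0 Q0.
set Y := (fun i => _).
have sY i : sol_on L (cdisc c rho) (Y i) by move: i; apply: ord2P.
move=> w Uw; have Uc : cdisc c rho c by rewrite /cdisc /= subrr cabs0.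
have : wronskian Y c * T c = wronskian Y w * T w.
  apply: (@cder0_line _ (fun w => wronskian Y w * T w)) => t t01.
  set p := c + _; have Up : cdisc c rho p by exact: cvx_cdisc.
  have [hTp _] := hT p Up.
  have hW := wronskian_der (fun i => sY i p Up).
  apply: (cder_eq (cderM hW hTp)); rewrite -q1 // horner0.
  by move: (Q0 p Up); move: (wronskian _ p) (_.[p]) (_.[p]) (T _) (T' _) => *; field.
rewrite Tc mulr1 /wronskian /Y /= uc duc vc dvc mulr1 mul0r subr0 => E.
apply/eqP => W0; move: E; rewrite W0 mul0r => /eqP.
by rewrite oner_eq0.
Qed.

Lemma fund_uniq L U Y y y' z : opn U -> cvx U -> fund_on L U Y ->
  sol_on L U y -> sol_on L U y' -> U z -> y z = y' z -> derive1 y z = derive1 y' z ->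
  forall w, U w -> y w = y' w.
Proof.
move=> oU cU fY sy sy' Uz E0 E1 w Uw.
have [c hc] := fund_rep oU cU fY sy Uz; have [d hd] := fund_rep oU cU fY sy' Uz.
rewrite hc // hd //; apply: eq_bigr => i _; congr (_ * _).
have [sY wY] := fY.
have hn : \forall t \near z, forall i, sol_at L (Y i) t.
  by apply: filterS (oU z Uz) => t Ut j; exact: sY.
have S j : sol_at L (Y j) z by exact: sY.
have Nc : \forall t \near z, y t = \sum_i c i * Y i t.
  by apply: filterS (oU z Uz) => t /hc.
have Nd : \forall t \near z, y' t = \sum_i d i * Y i t.
  by apply: filterS (oU z Uz) => t /hd.
have Dc := nbhs_singleton (derive1_near Nc); rewrite (sol_at_lin c S hn).2 in Dc.
have Dd := nbhs_singleton (derive1_near Nd); rewrite (sol_at_lin d S hn).2 in Dd.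
apply/eqP; rewrite -subr_eq0; apply/eqP; move: i.
apply: (@fund_indep_at _ L Y z (fun i => c i - d i) (wY z Uz)).
  by under eq_bigr do rewrite mulrBl; rewrite sumrB -hc // -hd // E0 subrr.
by under eq_bigr do rewrite mulrBl; rewrite sumrB -Dc -Dd E1 subrr.
Qed.

Lemma fund_lin L U Y (c : 'I_2 -> C) : opn U -> fund_on L U Y ->
  sol_on L U (fun w => \sum_i c i * Y i w) /\
  forall w, U w -> derive1 (fun w => \sum_i c i * Y i w) w = \sum_i c i * derive1 (Y i) w.
Proof.
move=> oU [sY wY].
have H w : U w -> sol_at L (fun t => \sum_i c i * Y i t) w /\
   derive1 (fun t => \sum_i c i * Y i t) w = \sum_i c i * derive1 (Y i) w.
  move=> Uw; apply: sol_at_lin; first by move=> i; exact: sY.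
  by apply: filterS (oU w Uw) => t Ut i; exact: sY.
by split=> w /H[].
Qed.

Definition init0 (i : 'I_2) : C := (i == ord0)%:R.
Definition init1 (i : 'I_2) : C := (i == ord_max)%:R.

(** Fixing the initial values at z makes the system unique, which is what lets systems on nested
    domains be glued. *)
Lemma fund_normalize L U Y z : opn U -> fund_on L U Y -> U z ->
  exists Z, fund_on L U Z /\ forall i, Z i z = init0 i /\ derive1 (Z i) z = init1 i.
Proof.
move=> oU fY Uz; have [sY wY] := fY.
set a := Y ord0 z; set b := derive1 (Y ord0) z; set c := Y ord_max z; set d := derive1 (Y ord_max) z.
have W0 : a * d - b * c != 0 := wY z Uz.
pose W := a * d - b * c.
pose co (i : 'I_2) : 'I_2 -> C := fun j =>
  if i == ord0 then (if j == ord0 then d / W else - b / W)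
  else (if j == ord0 then - c / W else a / W).
pose Z (i : 'I_2) := fun w => \sum_j co i j * Y j w.
have dZ i w : U w -> derive1 (Z i) w = \sum_j co i j * derive1 (Y j) w.
  exact: (fund_lin (co i) oU fY).2.
have zE i : Z i z = init0 i.
  rewrite /Z sum2 -/a -/c; move: i; apply: ord2P; rewrite /co /init0 /=;
  by move: W0; rewrite /W; move: (a) (b) (c) (d) => *; field.
have dzE i : derive1 (Z i) z = init1 i.
  rewrite dZ // sum2 -/b -/d; move: i; apply: ord2P; rewrite /co /init1 /=;
  by move: W0; rewrite /W; move: (a) (b) (c) (d) => *; field.
exists Z; split=> [|i]; last by [].
split=> [i|w Uw]; first exact: (fund_lin (co i) oU fY).1.
have -> : wronskian Z w = wronskian Y w / W.
  rewrite /wronskian !dZ // /Z !sum2 /co /=.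
  move: W0; rewrite /W; move: (a) (b) (c) (d) (derive1 _ w) (derive1 _ w) (Y _ w) (Y _ w) => *.
  by field.
by rewrite mulf_neq0 ?invr_neq0 // wY.
Qed.

(** All systems are normalized at the common point z, so by uniqueness on the convex U n each one
    extends the previous one. *)
Lemma union_fund L (U : nat -> set C) z :
  (forall n, opn (U n)) -> (forall n, cvx (U n)) -> (forall n, U n `<=` U n.+1) ->
  (forall n, U n z) -> (forall n, exists Y, fund_on L (U n) Y) ->
  exists Y, fund_on L (\bigcup_n U n) Y.
Proof.
move=> oU cU mU Uz fU.
have [Z hZ] : {Z : nat -> 'I_2 -> C -> C & forall n, fund_on L (U n) (Z n) /\
    forall i, Z n i z = init0 i /\ derive1 (Z n i) z = init1 i}.
  apply: (@boolp.choice nat ('I_2 -> C -> C) (fun n Z => fund_on L (U n) Z /\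
    forall i, Z i z = init0 i /\ derive1 (Z i) z = init1 i)) => n; have [Y fY] := fU n.
  by have [Z hZ] := fund_normalize (oU n) fY (Uz n); exists Z.
have mU' m n : (m <= n)%N -> U m `<=` U n.
  elim: n => [|n IH]; first by rewrite leqn0 => /eqP ->.
  by rewrite leq_eqVlt => /orP[/eqP -> //|/IH h w /h]; exact: mU.
have agree m n i w : (m <= n)%N -> U m w -> Z m i w = Z n i w.
  move=> mn; have [fm im] := hZ m; have [fn i_n] := hZ n.
  apply: (fund_uniq (oU m) (cU m) fm _ _ (Uz m)); first exact: fm.1.
  - by move=> t /(mU' _ _ mn); exact: fn.1.
  - by rewrite (im i).1 (i_n i).1.
  - by rewrite (im i).2 (i_n i).2.
(* N selects some index whose domain contains w. By [agree] the choice does not affect the value;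
   outside the union the default 0 is harmless. *)
pose N w : nat := xget 0%N [set n | U n w].
have NE w n : U n w -> U (N w) w by move=> h; rewrite /N; case: xgetP => [m _ //|/(_ n)].
pose Y i w := Z (N w) i w.
have YE n i w : U n w -> Y i w = Z n i w.
  move=> Unw; rewrite /Y; have UN := NE w n Unw.
  by have [h|/ltnW h] := leqP (N w) n; [exact: agree|exact/esym/agree].
have Yn n i w : U n w -> \forall t \near w, Z n i t = Y i t.
  by move=> Uw; apply: filterS (oU n w Uw) => t /YE ->.
exists Y; split=> [i w [n _ Uw]|w [n _ Uw]].
  by apply: sol_at_near (Yn n i w Uw) _; exact: (hZ n).1.1.
have dE i := nbhs_singleton (derive1_near (Yn n i w Uw)).
have E i := nbhs_singleton (Yn n i w Uw).
by have := (hZ n).1.2 w Uw; rewrite /wronskian -!dE -!E.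
Qed.

(** The Euclidean scalar product on the plane. In [hplane] the vector v is an inner normal at the
    boundary point b. *)
Definition dotr (w v : C) : R := cre w * cre v + cim w * cim v.

Definition hplane (b v : C) : set C := [set w | 0 < dotr (w - b) v].

Lemma dotrDl w w' v : dotr (w + w') v = dotr w v + dotr w' v.
Proof. by rewrite /dotr creD cimD; ring. Qed.
Lemma dotr_real (t : R) w v : dotr (RC t * w) v = t * dotr w v.
Proof. by rewrite /dotr creM cimM creR cimR; ring. Qed.

Lemma dotr_le w v : dotr w v <= cabs w * (cabs v * 2).
Proof.
have h1 := cre_le w; have h2 := cim_le w; have h3 := cre_le v; have h4 := cim_le v.
rewrite /dotr; apply: (le_trans (ler_norm _)); apply: (le_trans (ler_normD _ _)).
rewrite !normrM; have -> : cabs w * (cabs v * 2) = cabs w * cabs v + cabs w * cabs v by ring.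
by apply: lerD; apply: ler_pM.
Qed.

Lemma opn_hplane b v : opn (hplane b v).
Proof.
move=> z hz; rewrite /hplane /= in hz.
have v0 : 0 < cabs v * 2 + 1 by rewrite ltr_wpDl // mulr_ge0 ?cabs_ge0.
apply: (ball_near (divr_gt0 hz v0)) => w; rewrite ltr_pdivlMr // => hw.
have E : dotr (w - b) v = dotr (z - b) v - dotr (z - w) v.
  by rewrite /dotr !creB !cimB; ring.
have h1 : dotr (z - w) v <= cabs (w - z) * (cabs v * 2).
  by rewrite cabs_distC; exact: dotr_le.
have := cabs_ge0 (w - z).
rewrite /hplane /= E; lra.
Qed.

Lemma cvx_hplane b v : cvx (hplane b v).
Proof.
move=> a c ha hc t /andP[t0 t1]; rewrite /hplane /= in ha hc *.
have -> : a + RC t * (c - a) - b = RC (1 - t) * (a - b) + RC t * (c - b).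
  by rewrite rmorphB rmorph1; ring.
rewrite dotrDl !dotr_real.
have [->|t0'] := eqVneq t 0; first by rewrite subr0 mul1r mul0r addr0.
have : 0 < t by rewrite lt_neqAle eq_sym t0' t0.
nra.
Qed.

(** Power series only reach discs, and the half-plane is the increasing union of the discs of radius
    n + 1 tangent to its boundary at b. All of them contain b + v. *)
Lemma hplane_fund L b v : cabs v = 1 ->
  (forall w, hplane b v w -> regular_at L w) -> exists Y, fund_on L (hplane b v) Y.
Proof.
move=> v1 reg; pose U n := cdisc (b + n.+1%:R * v) n.+1%:R.
have vv : cre v ^+ 2 + cim v ^+ 2 = 1 by rewrite -cabs_sqr v1 expr1n.
have UE n w : U n w <-> cabs (w - b) ^+ 2 < 2 * n.+1%:R * dotr (w - b) v.
  have n0 : 0 <= n.+1%:R :> R by [].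
  rewrite /U /cdisc /= opprD addrA -(@ltr_pXn2r _ 2) ?nnegrE ?cabs_ge0 //.
  have nR : (n.+1%:R : C) = RC n.+1%:R by rewrite rmorph_nat.
  rewrite !cabs_sqr nR !(creB (_ - _)) !(cimB (_ - _)) creM cimM creR cimR /dotr.
  move: n0 vv; move: (n.+1%:R : R) (cre (w - b)) (cim (w - b)) (cre v) (cim v) => n0 x y p q _ h.
  have -> : (x - (n0 * p - 0 * q)) ^+ 2 + (y - (n0 * q + 0 * p)) ^+ 2 =
    x ^+ 2 + y ^+ 2 - 2 * n0 * (x * p + y * q) + n0 ^+ 2 * (p ^+ 2 + q ^+ 2) by ring.
  by rewrite h mulr1; split; lra.
have Uh n w : U n w -> hplane b v w.
  move=> /UE h; have := le_lt_trans (sqr_ge0 _) h.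
  by rewrite pmulr_rgt0 // mulr_gt0.
have -> : hplane b v = \bigcup_n U n.
  apply/seteqP; split=> [w hw|w [n _ /Uh]] //.
  rewrite /hplane /= in hw.
  pose x := cabs (w - b) ^+ 2 / (2 * dotr (w - b) v).
  have x0 : 0 <= x by rewrite divr_ge0 ?sqr_ge0 // mulr_ge0 // ltW.
  have d0 : 0 < 2 * dotr (w - b) v by rewrite mulr_gt0.
  exists (Num.truncn x) => //; apply/UE; have := truncnS_gt x.
  rewrite /x ltr_pdivrMr //; rewrite mulrA (mulrC _ 2) //.
have half1 : cabs (RC 2^-1 * v) = 2^-1 by rewrite cabsM v1 mulr1 cabs_real ger0_norm.
apply: (@union_fund L U (b + v)) => [n|n|n w|n|n].
- exact: opn_cdisc.
- exact: cvx_cdisc.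
- move=> h; have := Uh _ _ h; move: h => /UE h hw; apply/UE; apply: (lt_trans h).
  by rewrite ltr_pM2r // ltr_pM2l // ltr_nat.
- apply/UE; have -> : b + v - b = v by ring.
  rewrite /dotr -!expr2 vv v1 expr1n mulr1.
  have : 1 <= n.+1%:R :> R by rewrite ler1n.
  lra.
- by apply: disc_fund => [|w /Uh /reg]; rewrite ?ltr0n.
Qed.

End FundamentalDomains.

(** * Analytic continuation through charts *)

Section Continuation.
Context {R : realType}.
Local Notation C := (Cplx R).
Local Notation RC := (real_complex R).
Implicit Types (L : lode R) (U V : set C) (y : C -> C) (w z b : C).
Implicit Types (Y Z : 'I_2 -> C -> C) (M D : 'M[C]_2).

(** The supremum of the initial segments on which P holds belongs to them by local constancy, and if
    it were below 1 local constancy would push it further. *)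
Lemma unit_interval_connected (P : R -> Prop) :
  (forall t, 0 <= t <= 1 -> exists2 e : R, 0 < e &
     forall s, 0 <= s <= 1 -> `|s - t| < e -> (P s <-> P t)) ->
  P 0 -> P 1.
Proof.
move=> loc P0.
pose S := [set t : R | 0 <= t <= 1 /\ forall s, 0 <= s <= t -> P s].
have S0 : S 0.
  by split=> [|s /andP[s0 s1]]; rewrite ?lexx ?ler01 // (@le_anti _ _ s 0) // s0 s1.
have hS : has_sup S.
  by split; [exists 0|exists 1 => t [/andP[]]].
set T := sup S.
have T01 : 0 <= T <= 1.
  apply/andP; split; first by apply: ub_le_sup S0; exact: hS.2.
  by apply: ge_sup; [exact: hS.1|move=> t [/andP[]]].
have [e e0 he] := loc T T01.
have [s Ss sT] := sup_adherent e0 hS.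
have sT' : s <= T by apply: ub_le_sup => //; exact: hS.2.
have [s01 hs] := Ss.
have Ps : P s by apply: hs; have /andP[-> _] := s01; rewrite lexx.
have PT : P T by apply/(he s s01) => //; rewrite distrC ger0_norm ?subr_ge0 //; rewrite -/T in sT; lra.
pose t := Num.min 1 (T + e / 2).
have /andP[T0 T1] := T01.
have tS : S t.
  split; first by rewrite /t le_min ler01 ge_min lexx /= andbT; lra.
  move=> r /andP[r0]; rewrite le_min => /andP[r1 rT].
  have [rs|rs] := leP r s; first by apply: hs; rewrite r0.
  apply/(he r); rewrite ?r0 //; rewrite ltr_norml -/T in sT *; apply/andP; split; lra.
have tT : t <= T by apply: ub_le_sup => //; exact: hS.2.
have t1 : t = 1.
  by move: tT; rewrite /t; case: (leP 1 (T + e / 2)) => // h; lra.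
by have [_] := tS; rewrite t1; apply; rewrite lexx ler01.
Qed.

Definition lcomb D Z (i : 'I_2) w : C := \sum_j D i j * Z j w.

Lemma lcombM D M Z i w : lcomb D (lcomb M Z) i w = lcomb (D *m M) Z i w.
Proof.
rewrite /lcomb (eq_bigr (fun j => \sum_k D i j * (M j k * Z k w))); last first.
  by move=> j _; rewrite mulr_sumr.
rewrite exchange_big /=; apply: eq_bigr => k _; rewrite mxE mulr_suml.
by apply: eq_bigr => j _; rewrite mulrA.
Qed.

Lemma lcomb1 Z i w : lcomb 1%:M Z i w = Z i w.
Proof.
rewrite /lcomb (bigD1 i) //= big1 ?addr0; first by rewrite mxE eqxx mul1r.
by move=> j ji; rewrite mxE eq_sym (negPf ji) mul0r.
Qed.

Definition fund_at L z Y : Prop := exists2 e : R, 0 < e & fund_on L (cdisc z e) Y.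

Lemma fund_on_at L U z Y : opn U -> U z -> fund_on L U Y -> fund_at L z Y.
Proof.
move=> oU Uz [sY wY]; have [e e0 h] := near_ball (oU z Uz).
by exists e => //; split=> [i w /h|w /h]; [exact: sY|exact: wY].
Qed.

Lemma fund_at_rep L z Y y : fund_at L z Y -> solution L z y ->
  exists c : 'I_2 -> C, \forall w \near z, y w = \sum_i c i * Y i w.
Proof.
move=> [e e0 [sY wY]] /near_ball[d d0 hd].
have m0 : 0 < Num.min e d by rewrite lt_min e0 d0.
have zz : cdisc z (Num.min e d) z by rewrite /cdisc /= subrr cabs0.
have [|||||c hc] := @fund_rep _ L (cdisc z (Num.min e d)) Y y z.
- exact: opn_cdisc.
- exact: cvx_cdisc.
- by split=> [i w|w]; rewrite /cdisc /= lt_min => /andP[h _]; [exact: sY|exact: wY].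
- by move=> w; rewrite /cdisc /= lt_min => /andP[_ /hd].
- exact: zz.
by exists c; apply: ball_near m0 hc.
Qed.

Lemma fund_at_repM L z Y (Z : 'I_2 -> C -> C) : fund_at L z Y ->
  (forall i, solution L z (Z i)) ->
  exists D, \forall w \near z, forall i, Z i w = lcomb D Y i w.
Proof.
move=> fY sZ.
have [c0 h0] := fund_at_rep fY (sZ ord0); have [c1 h1] := fund_at_rep fY (sZ ord_max).
exists (\matrix_(i, j) (if i == ord0 then c0 j else c1 j)).
apply: filterS2 h0 h1 => w e0 e1; apply: ord2P; rewrite /lcomb ?e0 ?e1;
by apply: eq_bigr => j _; rewrite mxE.
Qed.

Lemma fund_at_inj L z Y D M : fund_at L z Y ->
  (\forall w \near z, forall i, lcomb D Y i w = lcomb M Y i w) -> D = M.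
Proof.
move=> [e e0 fY] h; apply/matrixP => i j.
have zz : cdisc z e z by rewrite /cdisc /= subrr cabs0.
apply: (fund_indep (c := fun j => D i j) (d := fun j => M i j) (@opn_cdisc _ z e) fY zz).
by apply: filterS h => w /(_ i).
Qed.

Lemma near_near z (P : C -> Prop) : (\forall w \near z, P w) ->
  exists2 e : R, 0 < e & forall w, cabs (w - z) < e -> \forall t \near w, P t.
Proof.
move=> /near_ball[e e0 h]; exists e => // w hw.
by apply: filterS (opn_cdisc (hw : cdisc z e w)) => t /h.
Qed.

(* The continuation is tracked through charts, indexed by K, that may depend on the time t and
   not only on the point gamma t, so that a chart can keep count of turns around a puncture. *)
Lemma continuation_charts L (gamma : R -> C) (K : Type) (dom : K -> R -> Prop)
    (Z : K -> 'I_2 -> C -> C) (G : K -> 'M[C]_2 -> Prop) (F : 'I_2 -> R -> C -> C)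
    (k0 : K) (D0 : 'M[C]_2) :
  (forall t, 0 <= t <= 1 -> forall e : R, 0 < e -> exists2 d : R, 0 < d &
     forall s, 0 <= s <= 1 -> `|s - t| < d -> cabs (gamma s - gamma t) < e) ->
  (forall t, 0 <= t <= 1 -> exists2 k, dom k t & exists2 d : R, 0 < d &
     forall s, 0 <= s <= 1 -> `|s - t| < d -> dom k s) ->
  (forall t k, 0 <= t <= 1 -> dom k t -> fund_at L (gamma t) (Z k)) ->
  (forall t k l D, 0 <= t <= 1 -> dom k t -> dom l t -> G k D ->
     exists2 M, (\forall w \near gamma t, forall i, Z k i w = lcomb M (Z l) i w)
              & G l (D *m M)) ->
  (forall i t, 0 <= t <= 1 -> solution L (gamma t) (F i t) /\
     \forall s \near t, 0 <= s <= 1 -> \forall w \near gamma s, F i s w = F i t w) ->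
  dom k0 0 -> G k0 D0 ->
  (\forall w \near gamma 0, forall i, F i 0 w = lcomb D0 (Z k0) i w) ->
  forall k, dom k 1 -> exists2 D, G k D &
    \forall w \near gamma 1, forall i, F i 1 w = lcomb D (Z k) i w.
Proof.
move=> cont cover fund trans HF dom0 G0 F0.
have z01 : (0 : R) <= 0 <= (1 : R) by rewrite lexx ler01.
have o01 : (0 : R) <= (1 : R) <= (1 : R) by rewrite ler01 lexx.
pose P t := exists k D, [/\ dom k t, G k D &
    \forall w \near gamma t, forall i, F i t w = lcomb D (Z k) i w].
have move_to t k l D : 0 <= t <= 1 -> dom k t -> dom l t -> G k D ->
    (\forall w \near gamma t, forall i, F i t w = lcomb D (Z k) i w) ->
    exists2 D', G l D' & \forall w \near gamma t, forall i, F i t w = lcomb D' (Z l) i w.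
  move=> t01 dk dl GD hF; have [M hM GM] := trans t k l D t01 dk dl GD.
  exists (D *m M); first exact: GM.
  apply: filterS2 hF hM => w h1 h2 i.
  rewrite h1 -(lcombM D M); apply: eq_bigr => j _.
  by rewrite h2.
suff [k1 [D1 [d1 g1 h1]]] : P 1 by move=> k dk; exact: move_to h1.
apply: (unit_interval_connected (P := P)); last by exists k0, D0.
move=> t t01; have [k dk [d d0 hd]] := cover t t01.
have fk := fund t k t01 dk.
have [D hD] := fund_at_repM fk (fun i => (HF i t t01).1).
have [e e0 he] := near_near hD.
have [d' d'0 hd'] := cont t t01 e e0.
have nb i : \forall s \near t, 0 <= s <= 1 -> \forall w \near gamma s, F i s w = F i t w.
  exact: (HF i t t01).2.
have /nbhs_ballP[d2 /= d20 hd2] := nb ord0.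
have /nbhs_ballP[d3 /= d30 hd3] := nb ord_max.
pose dd := Num.min (Num.min d d') (Num.min d2 d3).
exists dd; first by rewrite !lt_min d0 d'0 d20 d30.
move=> s s01; rewrite !lt_min => /andP[/andP[sd sd'] /andP[s2 s3]].
have dks := hd s s01 sd.
have Fs : \forall w \near gamma s, forall i, F i s w = lcomb D (Z k) i w.
  have h1 := he _ (hd' s s01 sd').
  have B (r : R) : `|s - t| < r -> ball t r s by rewrite -ball_normE /ball_ /= distrC.
  have h2 := hd2 s (B _ s2) s01; have h3 := hd3 s (B _ s3) s01.
  apply: filterS3 h1 h2 h3 => w e1 e2 e3; apply: ord2P; rewrite ?e2 ?e3; exact: e1.
(* Local constancy is required in both directions. P at any nearby time r can be moved to the chart
   k, and uniqueness of coefficients identifies the resulting matrix with the same D. *)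
have back r : 0 <= r <= 1 -> dom k r ->
    (\forall w \near gamma r, forall i, F i r w = lcomb D (Z k) i w) -> P r -> G k D.
  move=> r01 dkr hr [l [D' [dl GD' h']]].
  have [D2 GD2 h2] := move_to r l k D' r01 dl dkr GD' h'.
  suff -> : D = D2 by [].
  apply: (fund_at_inj (fund r k r01 dkr)).
  by apply: filterS2 hr h2 => w a b i; rewrite -a -b.
split=> [Ps|Pt]; [have GD := back s s01 dks Fs Ps|have GD := back t t01 dk hD Pt].
  by exists k, D.
by exists k, D.
Qed.

End Continuation.

(** * Five convex charts covering the plane without 0 and 1 *)

Section HypergeometricDomains.
Context {R : realType}.
Local Notation C := (Cplx R).
Local Notation RC := (real_complex R).
Implicit Types (L E : lode R) (U V : set C) (y : C -> C) (w z b : C).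
Implicit Types (Y Z : 'I_2 -> C -> C) (M D P Q g : 'M[C]_2).

Lemma hypergeometric_regular E w : hypergeometric E -> w != 0 -> w != 1 -> regular_at E w.
Proof.
move=> [_ /(_ (pt w))] h w0 w1; rewrite /regular_at -negb_or; apply/negP => s.
by have [] := h.1 s => // -[/eqP]; apply/negP.
Qed.

Lemma setI_opn U V : opn U -> opn V -> opn (U `&` V).
Proof. by move=> oU oV z [/oU h /oV h']; exact: filterI. Qed.

Lemma setI_cvx U V : cvx U -> cvx V -> cvx (U `&` V).
Proof. by move=> cU cV a b [a1 a2] [b1 b2] t ht; split; [exact: cU|exact: cV]. Qed.

Lemma fund_onS L U V Y : U `<=` V -> fund_on L V Y -> fund_on L U Y.
Proof. by move=> UV [sY wY]; split=> [i w /UV|w /UV]; [exact: sY|exact: wY]. Qed.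

Lemma lcomb_wronskian L U Z M w : opn U -> fund_on L U Z -> U w ->
  wronskian (lcomb M Z) w = \det M * wronskian Z w.
Proof.
move=> oU fZ Uw; rewrite /wronskian det2E.
rewrite !(fund_lin _ oU fZ).2 // /lcomb !sum2.
move: (M _ _) (M _ _) (M _ _) (M _ _) => *.
move: (derive1 _ w) (derive1 _ w) (Z _ w) (Z _ w) => *; ring.
Qed.

Lemma lcomb_fund L U Z M : opn U -> fund_on L U Z -> M \in unitmx ->
  fund_on L U (lcomb M Z).
Proof.
move=> oU fZ; rewrite unitmxE unitfE => M0; split=> [i|w Uw].
  exact: (fund_lin _ oU fZ).1.
by rewrite (lcomb_wronskian M oU fZ Uw) mulf_neq0 // fZ.2.
Qed.

Lemma fund_transition L U V Y Z z : opn U -> opn V -> cvx U -> cvx V ->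
  fund_on L U Y -> fund_on L V Z -> U z -> V z ->
  exists2 M, M \in unitmx & forall w, U w -> V w -> forall i, Y i w = lcomb M Z i w.
Proof.
move=> oU oV cU cV fY fZ Uz Vz.
have oI := setI_opn oU oV; have cI := setI_cvx cU cV.
have fYI : fund_on L (U `&` V) Y by apply: fund_onS fY => w [].
have fZI : fund_on L (U `&` V) Z by apply: fund_onS fZ => w [].
have zI : (U `&` V) z by [].
have [c0 h0] := fund_rep oI cI fZI (fYI.1 ord0) zI.
have [c1 h1] := fund_rep oI cI fZI (fYI.1 ord_max) zI.
pose M := \matrix_(i < 2, j < 2) (if i == ord0 then c0 j else c1 j).
have E w : U w -> V w -> forall i, Y i w = lcomb M Z i w.
  move=> Uw Vw; apply: ord2P; rewrite /lcomb ?h0 ?h1 //;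
  by apply: eq_bigr => j _; rewrite mxE.
exists M => //; rewrite unitmxE unitfE.
have En i : \forall w \near z, Y i w = lcomb M Z i w.
  by apply: filterS (oI z zI) => w [Uw Vw]; exact: E.
have dE i := nbhs_singleton (derive1_near (En i)).
have := fYI.2 z zI; apply: contraNneq => D0.
have := lcomb_wronskian M oI fZI zI; rewrite D0 mul0r.
have E0 i := nbhs_singleton (En i).
rewrite /wronskian (dE ord0) (dE ord_max) (E0 ord0) (E0 ord_max) => ->.
exact: eqxx.
Qed.

Lemma fund_extend L U V Y z : opn U -> opn V -> cvx U -> cvx V ->
  fund_on L U Y -> (exists Z, fund_on L V Z) -> U z -> V z ->
  exists2 Z, fund_on L V Z & forall w, U w -> V w -> forall i, Y i w = Z i w.
Proof.
move=> oU oV cU cV fY [Z fZ] Uz Vz.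
have [M Mu hM] := fund_transition oU oV cU cV fY fZ Uz Vz.
by exists (lcomb M Z); [exact: lcomb_fund|].
Qed.

(* Names: dP and dM are the half-planes Im > 0 and Im < 0, dL and dR the half-planes Re < 0 and
   Re > 1, and dD is the disc with diameter [0, 1].  They cover C minus {0, 1}. *)
Inductive chart5 := dP | dM | dL | dD | dR.

Definition imI : C := Complex 0 1.

Definition U5 (k : chart5) : set C := match k with
  | dP => hplane 0 imI
  | dM => hplane 0 (- imI)
  | dL => hplane 0 (- 1)
  | dD => cdisc (RC 2^-1) 2^-1
  | dR => hplane 1 1
  end.

Lemma U5E k w : U5 k w <-> match k with
  | dP => 0 < cim w
  | dM => cim w < 0
  | dL => cre w < 0
  | dD => cre w ^+ 2 + cim w ^+ 2 < cre w
  | dR => 1 < cre w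
  end.
Proof.
case: k => /=; rewrite ?/hplane /cdisc /= /dotr ?subr0 ?creN ?cimN ?cre1 ?cim1.
- by rewrite mulr0 add0r mulr1.
- by rewrite oppr0 mulr0 add0r mulrN1 oppr_gt0.
- by rewrite mulrN1 oppr0 mulr0 addr0 oppr_gt0.
- rewrite -(@ltr_pXn2r _ 2) ?nnegrE ?cabs_ge0 ?invr_ge0 //.
  rewrite cabs_sqr creB cimB creR cimR subr0.
  by move: (cre w) (cim w) => x y'; split; lra.
by rewrite mulr0 addr0 mulr1 creB cre1 subr_gt0.
Qed.

Lemma opn5 k : opn (U5 k).
Proof. by case: k; [exact: opn_hplane..|exact: opn_cdisc|exact: opn_hplane]. Qed.

Lemma cvx5 k : cvx (U5 k).
Proof. by case: k; [exact: cvx_hplane..|exact: cvx_cdisc|exact: cvx_hplane]. Qed.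

Lemma U5_avoid k w : U5 k w -> w != 0 /\ w != 1.
Proof.
move=> /U5E h; split; apply/eqP => E; move: h; rewrite E ?cre0 ?cim0 ?cre1 ?cim1;
case: k; lra.
Qed.

Lemma U5_cover w : w != 0 -> w != 1 -> exists k, U5 k w.
Proof.
move=> w0 w1.
have [h|h|h] := ltgtP (cim w) 0; first by exists dM; apply/U5E.
  by exists dP; apply/U5E.
have [h0|h0|h0] := ltgtP (cre w) 0; first by exists dL; apply/U5E.
  have [h1|h1|h1] := ltgtP (cre w) 1; last 1 first.
  - by move/eqP: w1; case; apply: cplx_ext; rewrite ?h ?h1.
  - exists dD; apply/U5E; rewrite h; nra.
  by exists dR; apply/U5E.
by move/eqP: w0; case; apply: cplx_ext; rewrite ?h ?h0.
Qed.

Lemma imI_norm : cabs imI = 1.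
Proof. by rewrite /cabs /= expr0n expr1n add0r sqrtr1. Qed.

Lemma fund5 E k : hypergeometric E -> exists Y, fund_on E (U5 k) Y.
Proof.
move=> hE; have reg w : U5 k w -> regular_at E w.
  by move=> /U5_avoid[w0 w1]; exact: hypergeometric_regular.
case: k reg => reg; try by apply: hplane_fund; rewrite ?cabsN ?imI_norm ?cabs1.
by apply: disc_fund => //; rewrite invr_gt0.
Qed.

Definition adjacent5 (k l : chart5) : bool := match k, l with
  | (dP | dM), (dL | dD | dR) => true
  | (dL | dD | dR), (dP | dM) => true
  | _, _ => false
  end.

Lemma meet5 k l w : U5 k w -> U5 l w -> k = l \/ adjacent5 k l.
Proof.
move=> /U5E h1 /U5E h2; case: k h1; case: l h2 => /= h2 h1; try (by left); try (by right).
all: exfalso; nra.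
Qed.

(* The bases are normalized by continuing the one on dP to dL, dD and dR, and the one on dD to
   dM; P and Q are the remaining transitions, from dM to dL and to dR. *)
Definition trans5 P Q (k l : chart5) : 'M[C]_2 := match k, l with
  | dM, dL => P | dL, dM => invmx P
  | dM, dR => Q | dR, dM => invmx Q
  | _, _ => 1%:M
  end.

Lemma charts5 E : hypergeometric E -> exists (Y : chart5 -> 'I_2 -> C -> C) P Q,
  [/\ P \in unitmx, Q \in unitmx, forall k, fund_on E (U5 k) (Y k) &
   forall k l w, U5 k w -> U5 l w ->
     forall i, Y k i w = lcomb (trans5 P Q k l) (Y l) i w].
Proof.
move=> hE; pose half : R := 2^-1.
pose zz (x y : R) : C := Complex x y.
have [YP fP] := fund5 dP hE.
have ext k l z Y : fund_on E (U5 k) Y -> U5 k z -> U5 l z ->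
   exists2 Z, fund_on E (U5 l) Z & forall w, U5 k w -> U5 l w -> forall i, Y i w = Z i w.
  move=> fY; apply: (fund_extend (@opn5 k) (@opn5 l) (@cvx5 k) (@cvx5 l) fY).
  exact: fund5.
(* One sample point in each of the six overlaps. An overlap is convex, so a transition found from
   one of its points holds on all of it. *)
have a1 : U5 dP (zz (-1) 1) /\ U5 dL (zz (-1) 1).
  by split; apply/U5E; rewrite /cre /cim /=; lra.
have a2 : U5 dP (zz half (2^-1 * half)) /\ U5 dD (zz half (2^-1 * half)).
  by split; apply/U5E; rewrite /cre /cim /half /=; lra.
have a3 : U5 dP (zz 2 1) /\ U5 dR (zz 2 1).
  by split; apply/U5E; rewrite /cre /cim /=; lra.
have a4 : U5 dD (zz half (- (2^-1 * half))) /\ U5 dM (zz half (- (2^-1 * half))).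
  by split; apply/U5E; rewrite /cre /cim /half /=; lra.
have a5 : U5 dM (zz (-1) (-1)) /\ U5 dL (zz (-1) (-1)).
  by split; apply/U5E; rewrite /cre /cim /=; lra.
have a6 : U5 dM (zz 2 (-1)) /\ U5 dR (zz 2 (-1)).
  by split; apply/U5E; rewrite /cre /cim /=; lra.
have [YL fL hL] := ext dP dL _ YP fP a1.1 a1.2.
have [YD fD hD] := ext dP dD _ YP fP a2.1 a2.2.
have [YR fR hR] := ext dP dR _ YP fP a3.1 a3.2.
have [YM fM hM] := ext dD dM _ YD fD a4.1 a4.2.
have [P Pu hP] := fund_transition (@opn5 dM) (@opn5 dL) (@cvx5 dM) (@cvx5 dL) fM fL a5.1 a5.2.
have [Q Qu hQ] := fund_transition (@opn5 dM) (@opn5 dR) (@cvx5 dM) (@cvx5 dR) fM fR a6.1 a6.2.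
pose Y k := match k with dP => YP | dM => YM | dL => YL | dD => YD | dR => YR end.
exists Y, P, Q; split=> //; first by case.
have inv M Z Z' : M \in unitmx -> forall w, (forall i, Z i w = lcomb M Z' i w) ->
    forall i, Z' i w = lcomb (invmx M) Z i w.
  move=> Mu w h i; rewrite -[LHS]lcomb1 -(mulVmx Mu) -lcombM.
  by apply: eq_bigr => j _; rewrite h.
move=> k l w kw lw.
have [<-|] := meet5 kw lw; first by case: (k) => i; rewrite lcomb1.
case: k kw; case: l lw => //= lw kw _ i; rewrite ?lcomb1.
- exact: hL.
- exact: hD.
- exact: hR.
- exact: hP.
- exact/esym/hM.
- exact: hQ.
- exact/esym/hL.
- by apply: inv => // j; exact: hP.
- exact/esym/hD.
- exact: hM.
- exact/esym/hR.
- by apply: inv => // j; exact: hQ.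
Qed.

Lemma within_continuous_path (gamma : R -> C) : {within `[0, 1], continuous gamma} ->
  forall t : R, 0 <= t <= 1 -> forall e : R, 0 < e -> exists2 d : R, 0 < d &
     forall s, 0 <= s <= 1 -> `|s - t| < d -> cabs (gamma s - gamma t) < e.
Proof.
move=> /subspace_continuousP h t t01 e e0.
have tI : `[(0 : R), 1]%classic t by rewrite /= in_itv.
have /cvgrPdist_lt/(_ (RC e)) := h t tI.
rewrite ltcR => /(_ e0); rewrite near_withinE => /nbhs_ballP[d /= d0 hd].
exists d => // s s01 st.
have := hd s; rewrite -ball_normE /ball_ /= distrC in_itv => /(_ st s01).
by rewrite normCE ltcR cabs_distC.
Qed.

End HypergeometricDomains.

(** * Global and local monodromy *)

Section GlobalMonodromy.
Context {R : realType}.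
Local Notation C := (Cplx R).
Local Notation RC := (real_complex R).
Implicit Types (L E : lode R) (U V : set C) (y : C -> C) (w z b : C).
Implicit Types (M D P Q g : 'M[C]_2).

Lemma near_all2 z (P : 'I_2 -> C -> Prop) : (forall i, \forall w \near z, P i w) ->
  \forall w \near z, forall i, P i w.
Proof. by move=> h; apply: filterS2 (h ord0) (h ord_max) => w a b; exact: ord2P. Qed.

Lemma monodromy_continuations L (gamma : R -> C) (y : 'I_2 -> C -> C) M :
  monodromy_matrix L gamma y M -> exists F : 'I_2 -> R -> C -> C,
  [/\ \forall w \near gamma 0, forall i, F i 0 w = y i w,
      \forall w \near gamma 1, forall i, F i 1 w = lcomb M y i w
    & forall i t, 0 <= t <= 1 -> solution L (gamma t) (F i t) /\
     \forall s \near t, 0 <= s <= 1 -> \forall w \near gamma s, F i s w = F i t w].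
Proof.
move=> h; have [F hF] : {F : 'I_2 -> R -> C -> C & forall i,
   [/\ \forall w \near gamma 0, F i 0 w = y i w,
       \forall w \near gamma 1, F i 1 w = lcomb M y i w
     & forall t, 0 <= t <= 1 -> solution L (gamma t) (F i t) /\
     \forall s \near t, 0 <= s <= 1 -> \forall w \near gamma s, F i s w = F i t w]}.
  by apply: (@boolp.choice 'I_2 (R -> C -> C) (fun i F =>
   [/\ \forall w \near gamma 0, F 0 w = y i w,
       \forall w \near gamma 1, F 1 w = lcomb M y i w
     & forall t, 0 <= t <= 1 -> solution L (gamma t) (F t) /\
     \forall s \near t, 0 <= s <= 1 -> \forall w \near gamma s, F s w = F t w])).
exists F; split=> [||i].
- by apply: near_all2 => i; have [] := hF i.
- by apply: near_all2 => i; have [] := hF i.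
- by have [] := hF i.
Qed.

(** A row in the left kernel of D is a linear relation between the y i, hence zero. *)
Lemma fundamental_system_unit L z (y Y : 'I_2 -> C -> C) D : fund_at L z Y -> fundamental_system L z y ->
  (\forall w \near z, forall i, y i w = lcomb D Y i w) -> D \in unitmx.
Proof.
move=> fY [sy indep] hD; rewrite -row_free_unit.
rewrite -kermx_eq0; apply/eqP/matrixP => k i; rewrite [in RHS]mxE.
pose c (i : 'I_2) := kermx D k i.
apply: (indep c); apply: filterS hD => w hw.
rewrite (eq_bigr (fun i => \sum_j (c i * D i j) * Y j w)); last first.
  by move=> j _; rewrite hw mulr_sumr; apply: eq_bigr => l _; rewrite mulrA.
rewrite exchange_big /= big1 // => j _; rewrite -mulr_suml.
have /matrixP/(_ k j) := mulmx_ker D; rewrite !mxE => ->.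
by rewrite mul0r.
Qed.

(* The continuation at the end of the loop is computed by the charts on one side, by M on the other. *)
Lemma monodromy_conj L z (y Y : 'I_2 -> C -> C) D M D' (F : 'I_2 -> C -> C) :
  fund_at L z Y -> D \in unitmx ->
  (\forall w \near z, forall i, y i w = lcomb D Y i w) ->
  (\forall w \near z, forall i, F i w = lcomb M y i w) ->
  (\forall w \near z, forall i, F i w = lcomb D' Y i w) ->
  M = D' *m invmx D.
Proof.
move=> fY Du h1 h2 h3; suff -> : D' = M *m D by rewrite mulmxK.
apply: (fund_at_inj fY); apply: filterS3 h1 h2 h3 => w e1 e2 e3 i.
by rewrite -e3 e2 -lcombM; apply: eq_bigr => j _; rewrite e1.
Qed.

Lemma hypergeometric_nonsingular E w : hypergeometric E -> ~ singular_at E w ->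
  w != 0 /\ w != 1.
Proof.
move=> [_ /(_ (pt w))] h ns; split; apply/eqP => E0; apply: ns; apply: h.2.
  by rewrite E0; constructor 1.
by rewrite E0; constructor 2.
Qed.

(** Every change of chart multiplies on the right by 1, P, Q or an inverse of these, so the
    invariant carried along a loop is D times a word. This inclusion is the direction that
    non-density uses: a form vanishing on all words vanishes on the monodromy group after
    conjugation by D. *)
Lemma monodromy_in_gen E (Y : chart5 -> 'I_2 -> C -> C) P Q z (y : 'I_2 -> C -> C) :
  hypergeometric E ->
  (forall k, fund_on E (U5 k) (Y k)) ->
  (forall k l w, U5 k w -> U5 l w ->
     forall i, Y k i w = lcomb (trans5 P Q k l) (Y l) i w) ->
  ~ singular_at E z -> fundamental_system E z y ->
  exists2 D, D \in unitmx & forall M, monodromy_group E z y M ->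
    exists2 g, gen2 P Q g & M = D *m g *m invmx D.
Proof.
move=> hE fY tY nz fy; have [z0 z1] := hypergeometric_nonsingular hE nz.
have [k0 kz] := U5_cover z0 z1.
have fAt k w : U5 k w -> fund_at E w (Y k).
  by move=> h; exact: fund_on_at (@opn5 _ k) h (fY k).
have [D hD] := fund_at_repM (fAt _ _ kz) fy.1.
have Du := fundamental_system_unit (fAt _ _ kz) fy hD.
exists D => // M [gamma [cg g0 g1 av] mM].
have [F [F0 F1 hF]] := monodromy_continuations mM.
have cont := within_continuous_path cg.
pose dom k t := U5 k (gamma t).
pose G (k : chart5) D' := exists2 g, gen2 P Q g & D' = D *m g.
have [] := @continuation_charts R E gamma chart5 dom Y G F k0 D cont _ _ _ hF _ _ _ k0.
- move=> t t01; have [w0 w1] := hypergeometric_nonsingular hE (av t t01).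
  have [k hk] := U5_cover w0 w1; exists k => //.
  have [e e0 he] := near_ball (@opn5 _ k _ hk).
  have [d d0 hd] := cont t t01 e e0; exists d => // s s01 st.
  by apply: he; exact: hd.
- by move=> t k _; exact: fAt.
- move=> t k l D' t01 dk dl [g hg ->]; exists (trans5 P Q k l).
    have oI := setI_opn (@opn5 R k) (@opn5 R l).
    apply: filterS (oI (gamma t) (conj dk dl)) => w [Uk Ul]; exact: tY.
  rewrite /G; exists (g *m trans5 P Q k l); last by rewrite mulmxA.
  by case: (k); case: (l) => /=; rewrite ?mulmx1 //; constructor.
- by rewrite /dom g0.
- by exists 1%:M; [constructor|rewrite mulmx1].
- rewrite g0 in F0 *; apply: filterS2 F0 hD => w e1 e2 i; by rewrite e1 e2.
- by rewrite /dom g1.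
move=> D' [g hg D'E] hD'; exists g => //.
rewrite g1 in F1 hD'; rewrite -D'E.
exact: monodromy_conj (fAt _ _ kz) Du hD F1 hD'.
Qed.

End GlobalMonodromy.

(** * Angles, and sectors around the cusps *)

Section LocalMonodromy.
Context {R : realType}.
Local Notation C := (Cplx R).
Local Notation RC := (real_complex R).
Implicit Types (L E : lode R) (U V : set C) (w z : C).
Implicit Types (M D P Q g : 'M[C]_2).

Definition cis (x : R) : C := Complex (cos x) (sin x).

Lemma cisD x y : cis (x + y) = cis x * cis y.
Proof. by apply: cplx_ext; rewrite ?creM ?cimM /= ?cosD ?sinD; ring. Qed.

Lemma cis0 : cis 0 = 1.
Proof. by apply: cplx_ext; rewrite /= ?cos0 ?sin0. Qed.

Lemma cabs_cis x : cabs (cis x) = 1.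
Proof. by rewrite /cabs /= cos2Dsin2 sqrtr1. Qed.

Lemma cisX x n : cis x ^+ n = cis (n%:R * x).
Proof.
elim: n => [|n IH]; first by rewrite expr0 mul0r cis0.
by rewrite exprS IH -cisD -natr1 mulrDl mul1r addrC.
Qed.

Lemma dotr_cis x y : dotr (cis x) (cis y) = cos (x - y).
Proof. by rewrite /dotr /= cosB. Qed.

Lemma cis_pihalf (j : nat) : cis (j%:R * (pi / 2)) = imI ^+ j.
Proof.
rewrite -cisX; congr (_ ^+ _).
by rewrite /cis cos_pihalf sin_pihalf.
Qed.

(** The argument is taken nonnegative so that the sectors met later can be numbered by natural
    numbers. *)
Lemma polar (u : C) : u != 0 -> exists2 x : R, 0 <= x & u = RC (cabs u) * cis x.
Proof.
move=> u0; have r0 : 0 < cabs u by rewrite cabs_gt0.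
pose a := cre u / cabs u; pose b := cim u / cabs u.
have ab : a ^+ 2 + b ^+ 2 = 1.
  rewrite /a /b !expr_div_n -mulrDl -cabs_sqr divff // expf_eq0 /= gt_eqF //.
have a1 : -1 <= a <= 1.
  rewrite -ler_norml -(@ler_pXn2r _ 2) ?nnegrE // expr1n real_normK ?num_real //.
  by rewrite -ab lerDl sqr_ge0.
have cosa : cos (acos a) = a by rewrite acosK // in_itv.
have sina : sin (acos a) = `|b|.
  by rewrite sin_acos // -sqrtr_sqr -ab; congr Num.sqrt; ring.
have fin x : 0 <= x -> cos x = a -> sin x = b -> exists2 x : R, 0 <= x & u = RC (cabs u) * cis x.
  move=> x0 cx sx; exists x => //; apply: cplx_ext;
  rewrite ?creM ?cimM creR cimR /= cx sx /a /b mul0r ?subr0 ?addr0 mulrC divfK // gt_eqF //.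
have [b0|b0] := leP 0 b.
  by apply: (fin (acos a)); rewrite ?acos_ge0 // sina ger0_norm.
apply: (fin (pi *+ 2 - acos a)).
- have := acos_lepi a1; have := pi_ge0 R; rewrite mulr2n; lra.
- by rewrite addrC cosD2pi cosN.
- by rewrite addrC sinD2pi sinN sina ltr0_norm // opprK.
Qed.

Lemma cos_near (x e : R) : 0 < e -> exists2 d : R, 0 < d &
  forall y, `|y - x| < d -> `|cos y - cos x| < e.
Proof.
move=> e0; have /cvgrPdist_lt/(_ _ e0)/nbhs_ballP[d /= d0 hd] := @continuous_cos R x.
exists d => // y yx; rewrite distrC; apply: hd.
by rewrite -ball_normE /ball_ /= distrC.
Qed.

Lemma sin_near (x e : R) : 0 < e -> exists2 d : R, 0 < d &
  forall y, `|y - x| < d -> `|sin y - sin x| < e.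
Proof.
move=> e0; have /cvgrPdist_lt/(_ _ e0)/nbhs_ballP[d /= d0 hd] := @continuous_sin R x.
exists d => // y yx; rewrite distrC; apply: hd.
by rewrite -ball_normE /ball_ /= distrC.
Qed.

Lemma circleE (a : C) (r t : R) : circle a r t = a + RC r * cis (2 * pi * t).
Proof. by []. Qed.

Lemma circle_dist (a : C) (r t : R) : 0 < r -> cabs (circle a r t - a) = r.
Proof.
by move=> r0; rewrite circleE addrC addKr cabsM cabs_cis mulr1 cabs_real gtr0_norm.
Qed.

Lemma circle_continuous (a : C) (r : R) : 0 < r -> forall t : R, 0 <= t <= 1 ->
  forall e : R, 0 < e -> exists2 d : R, 0 < d &
  forall s, 0 <= s <= 1 -> `|s - t| < d -> cabs (circle a r s - circle a r t) < e.
Proof.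
move=> r0 t _ e e0; pose k : R := 2 * pi.
have k0 : 0 < k by rewrite mulr_gt0 ?pi_gt0.
have e1 : 0 < e / 2 / r by rewrite !divr_gt0.
have [d1 d10 h1] := cos_near (k * t) e1; have [d2 d20 h2] := sin_near (k * t) e1.
exists (Num.min d1 d2 / k); first by rewrite divr_gt0 // lt_min d10 d20.
move=> s _; rewrite ltr_pdivlMr // mulrC -(gtr0_norm k0) -normrM mulrBr lt_min.
move=> /andP[/h1 c1 /h2 s1].
rewrite !circleE -/k opprD addrACA subrr add0r -mulrBr cabsM cabs_real gtr0_norm //.
rewrite mulrC -ltr_pdivlMr //; apply: (le_lt_trans (cabs_le_ReIm _)).
rewrite creB cimB /=; lra.
Qed.

Inductive cusp3 := cusp_0 | cusp_1 | cusp_oo.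

(** The point with local parameter u at the cusp. *)
Definition cusp_loc (i : cusp3) (u : C) : C := match i with
  | cusp_0 => u | cusp_1 => 1 + u | cusp_oo => u^-1 end.

(** The charts met in turn when the local parameter makes one counterclockwise turn starting from
    the positive direction. At infinity the parameter is the inverse of the coordinate, so the upper
    and lower half-planes come in the opposite order. *)
Definition cyc (i : cusp3) (j : nat) : chart5 :=
  nth dD (match i with
    | cusp_0 => [:: dD; dP; dL; dM]
    | cusp_1 => [:: dR; dP; dD; dM]
    | cusp_oo => [:: dR; dM; dL; dP]
    end) (j %% 4)%N.

(** The product of the four transitions of one turn, in the order given by [cyc]. With A = P^-1 and
    B = Q, the matrix at infinity is (A B)^-1. *)
Definition cusp_mx P Q (i : cusp3) : 'M[C]_2 := match i with
  | cusp_0 => invmx P | cusp_1 => Q | cusp_oo => invmx Q *m P end.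

Fixpoint turn P Q (i : cusp3) (j : nat) : 'M[C]_2 :=
  if j is k.+1 then turn P Q i k *m trans5 P Q (cyc i k) (cyc i k.+1) else 1%:M.

Lemma cyc_period i j : cyc i (j + 4) = cyc i j.
Proof. by rewrite /cyc modnDr. Qed.

Lemma turn4 P Q i j : turn P Q i (j + 4) = cusp_mx P Q i *m turn P Q i j.
Proof.
elim: j => [|j IH]; last by rewrite addSn /= IH -addSn !cyc_period mulmxA.
by rewrite /= mulmx1 !mul1mx; case: i; rewrite /= ?mulmx1 ?mul1mx.
Qed.

Definition mxpow (M : 'M[C]_2) (n : nat) : 'M[C]_2 := iter n (mulmx M) 1%:M.

Lemma turnX P Q i j e : turn P Q i (j + 4 * e) = mxpow (cusp_mx P Q i) e *m turn P Q i j.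
Proof.
elim: e => [|e IH]; first by rewrite muln0 addn0 mul1mx.
by rewrite mulnSr addnA turn4 IH mulmxA.
Qed.

Lemma imI4 : (imI : C) ^+ 4 = 1.
Proof.
have -> : 4%N = (2 * 2)%N by []; rewrite exprM.
have -> : (imI : C) ^+ 2 = -1.
  by apply: cplx_ext; rewrite expr2 ?creM ?cimM /=; ring.
by rewrite sqrrN expr1n.
Qed.

(* The sector around the direction i^j at the cusp lies in the chart [cyc i j]. *)
Lemma sector_chart i j (u : C) : u != 0 -> cabs u < 3^-1 ->
  cabs u / 3 <= dotr u (imI ^+ j) -> U5 (cyc i j) (cusp_loc i u).
Proof.
move=> u0 u3.
have -> : (imI : C) ^+ j = imI ^+ (j %% 4)%N.
  by rewrite [in LHS](divn_eq j 4) exprD mulnC exprM imI4 expr1n mul1r.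
have r0 : 0 < cabs u by rewrite cabs_gt0.
have su := cabs_sqr u.
(* The two hypotheses together give |u|^2 < [dotr] u (i^j). In the relevant direction this
   inequality is exactly membership in the disc [dD] at the cusps 0 and 1, and Re > 1 for 1/u at
   infinity. *)
have s3 : cre u ^+ 2 + cim u ^+ 2 < cabs u / 3.
  by rewrite -su expr2 ltr_pM2l.
have s0 : 0 < cre u ^+ 2 + cim u ^+ 2 by rewrite -su exprn_gt0.
have IE : cusp_loc cusp_oo u = Complex (cre u / (cre u ^+ 2 + cim u ^+ 2))
    (- (cim u / (cre u ^+ 2 + cim u ^+ 2))).
  by rewrite /cusp_loc; case: (u).
have i2 : (imI : C) ^+ 2 = -1 by apply: cplx_ext; rewrite expr2 ?creM ?cimM /=; ring.
have i3 : (imI : C) ^+ 3 = - imI by rewrite exprS i2 mulrN1.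
rewrite /cyc; have : (j %% 4 < 4)%N by rewrite ltn_mod.
case: (j %% 4)%N => [|[|[|[|//]]]] _; rewrite ?expr0 ?expr1 ?i2 ?i3 /dotr
  ?creN ?cimN ?cre1 ?cim1 /= ?oppr0 ?mulr0 ?mulr1 ?add0r ?addr0 ?mulrN1 => h;
case: i; apply/U5E; rewrite ?IE /cusp_loc ?creD ?cimD ?cre1 ?cim1 ?add0r //=.
all: try lra.
all: try (rewrite ltr_pdivlMr // mul1r; lra).
all: try (rewrite oppr_lt0 divr_gt0 //; lra).
all: try (rewrite oppr_gt0 ltr_pdivrMr // mul0r; lra).
all: try (rewrite ltr_pdivrMr // mul0r; lra).
Qed.

End LocalMonodromy.

(** * Monodromy along a small circle covering e turns around a cusp *)

Section CircleMonodromy.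
Context {R : realType}.
Local Notation C := (Cplx R).
Local Notation RC := (real_complex R).
Implicit Types (L E : lode R) (U V : set C) (w z : C).
Implicit Types (M D P Q g : 'M[C]_2).

(* Near the puncture [a], solutions of [E] composed with [f] solve [L], and [f] has
   ramification index [e] over the cusp [i]. *)
Definition cusp_cover E L (a : C) (f : C -> C) (i : cusp3) (e : nat) : Prop :=
  exists (r0 : R) (h0 : C) (h : C -> C),
  [/\ 0 < r0, h0 != 0,
      forall w, 0 < cabs (w - a) < r0 -> f w = cusp_loc i ((w - a) ^+ e * h w) /\
        cabs (h w - h0) < cabs h0 / 8,
      forall w, 0 < cabs (w - a) < r0 -> forall eps : R, 0 < eps ->
        \forall t \near w, cabs (f t - f w) < eps
    & forall w, 0 < cabs (w - a) < r0 -> forall U (Y : 'I_2 -> C -> C),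
        opn U -> fund_on E U Y -> U (f w) -> fund_at L w (fun j t => Y j (f t))].

(** The lifted angle at time t is less than pi/3 away from direction j. The cosine alone does not
    see full turns; the second bound ties j to the lifted angle, so that domains that meet have
    equal or consecutive indices. Neighbouring directions are pi/2 apart, so their domains still
    overlap. *)
Definition turning_domain (e : nat) (x : R) (j : nat) (t : R) : Prop :=
  2^-1 < cos (x + e%:R * (2 * pi * t) - j%:R * (pi / 2)) /\
  `|x + e%:R * (2 * pi * t) - j%:R * (pi / 2)| < pi / 2.

Lemma turning_domain_adjacent e x j k t :
  turning_domain e x j t -> turning_domain e x k t -> [\/ j = k, k = j.+1 | j = k.+1].
Proof.
move=> [_ h1] [_ h2]; have p0 : 0 < pi / 2 :> R by rewrite divr_gt0 ?pi_gt0.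
move: h1 h2; set y := x + _ => h1 h2.
have hjk : `|j%:R * (pi / 2) - k%:R * (pi / 2)| < (2%:R : R) * (pi / 2).
  apply: (le_lt_trans (ler_distD y _ _)).
  rewrite distrC; move: h1 h2; lra.
rewrite -mulrBl normrM (gtr0_norm p0) ltr_pM2r // in hjk.
have [jk|kj] := leqP j k.
  rewrite distrC -natrB // normr_nat ltr_nat in hjk.
  have [->|] := eqVneq j k; first by constructor 1.
  by move=> ne; constructor 2; lia.
rewrite -natrB ?(ltnW kj) // normr_nat ltr_nat in hjk.
by constructor 3; lia.
Qed.

Lemma turning_domain_cover e x t : 0 <= x -> 0 <= t -> exists j, turning_domain e x j t.
Proof.
move=> x0 t0; have p0 : 0 < pi / 2 :> R by rewrite divr_gt0 ?pi_gt0.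
set y := x + e%:R * (2 * pi * t).
have y0 : 0 <= y by rewrite addr_ge0 // mulr_ge0 // mulr_ge0 // mulr_ge0 ?pi_ge0.
(* Adding 1/2 makes truncation choose the nearest direction, at distance at most pi/4. *)
pose q := y / (pi / 2) + 2^-1.
have q0 : 0 <= q.
  by apply: addr_ge0; [apply: divr_ge0 => //; exact: ltW|rewrite invr_ge0].
have /andP[q1 q2] := truncn_itv q0.
exists (Num.truncn q); rewrite /turning_domain -/y.
set j : R := (Num.truncn q)%:R in q1 *; set d := y - j * (pi / 2).
have yE : y = (q - 2^-1) * (pi / 2) by rewrite /q addrK divfK // gt_eqF.
have jS : (Num.truncn q).+1%:R = j + 1 :> R by rewrite -natr1.
rewrite jS in q2.
have d4 : `|d| <= pi / 4.
  have -> : d = (q - 2^-1 - j) * (pi / 2) by rewrite /d {1}yE -mulrBl.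
  have -> : pi / 4 = 2^-1 * (pi / 2) :> R by field.
  rewrite normrM (gtr0_norm p0) ler_pM2r // ler_norml; apply/andP; split; lra.
have pp := pi_gt0 R; clearbody d.
move: d4; rewrite ler_norml => /andP[d4a d4b].
(* A nonnegative cos(2d) means cos(d)^2 >= 1/2, which exceeds the square of the threshold 1/2. *)
have c2 : 0 <= cos (d *+ 2).
  apply: cos_ge0_pihalf; apply/andP; split; lra.
have c1 : 0 <= cos d.
  apply: cos_ge0_pihalf; apply/andP; split; lra.
split; last by rewrite ltr_norml; apply/andP; split; lra.
rewrite cos_mulr2n in c2.
rewrite ltNge; apply/negP => h; have : cos d ^+ 2 <= 2^-1 ^+ 2.
  by rewrite lerXn2r ?nnegrE ?invr_ge0.
rewrite [X in _ <= X]expr2; move: c2; lra.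
Qed.

Lemma turning_domain_open e x j t : turning_domain e x j t -> exists2 d : R, 0 < d &
  forall s, `|s - t| < d -> turning_domain e x j s.
Proof.
move=> [h1 h2]; set y := x + _ - _ in h1 h2.
have /(_ _)[|d1 d10 hd1] := @cos_near R y (cos y - 2^-1); first by rewrite subr_gt0.
pose k : R := e%:R * (2 * pi) + 1.
have k1 : 0 <= e%:R * (2 * pi) :> R by rewrite mulr_ge0 ?mulr_ge0 ?pi_ge0.
have k0 : 0 < k by rewrite ltr_wpDl.
exists (Num.min d1 (pi / 2 - `|y|) / k).
  by rewrite divr_gt0 // lt_min d10 subr_gt0.
move=> s; rewrite ltr_pdivlMr // lt_min => /andP[s1 s2].
set y' := x + e%:R * (2 * pi * s) - j%:R * (pi / 2).
have yy : `|y' - y| <= `|s - t| * k.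
  have -> : y' - y = (s - t) * (e%:R * (2 * pi)) by rewrite /y' /y; ring.
  rewrite normrM (ger0_norm k1) ler_wpM2l // /k lerDl //.
rewrite /turning_domain -/y'; split.
  have := hd1 y' (le_lt_trans yy s1); rewrite ltr_norml => /andP[a b]; lra.
have := ler_normD (y' - y) y; rewrite subrK; lra.
Qed.

(** On a small circle the cusp parameter of f has argument x + 2 pi e t up to a relative error below
    1/8. Starting in sector j0, its image therefore ends in sector j0 + 4e, and [turnX] reads off e
    full turns. *)
Theorem circle_monodromy E (Y : chart5 -> 'I_2 -> C -> C) P Q L a f i e :
  P \in unitmx -> Q \in unitmx -> (0 < e)%N ->
  (forall k, fund_on E (U5 k) (Y k)) ->
  (forall k l w, U5 k w -> U5 l w ->
     forall i, Y k i w = lcomb (trans5 P Q k l) (Y l) i w) ->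
  cusp_cover E L a f i e ->
  exists2 r1 : R, 0 < r1 & forall (r : R) (y : 'I_2 -> C -> C) M, 0 < r < r1 ->
    fundamental_system L (circle a r 0) y -> monodromy_matrix L (circle a r) y M ->
    exists2 D, D \in unitmx & M = D *m mxpow (cusp_mx P Q i) e *m invmx D.
Proof.
move=> Pu Qu e0 fY tY [r0 [h0 [h [r00 h00 hf fcont pull]]]].
have [x x0 h0E] := polar h00.
have ah0 : 0 < cabs h0 by rewrite cabs_gt0.
(* Below r1 one has r^e |h0| <= r |h0| < 1/4, and the relative error 1/8 leaves |u| <= 9/32 < 1/3,
   as [sector_chart] requires. *)
pose r1 := Num.min (Num.min r0 1) ((cabs h0 * 4)^-1).
exists r1; first by rewrite !lt_min r00 ltr01 invr_gt0 mulr_gt0.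
move=> r y M /andP[rr0]; rewrite !lt_min => /andP[/andP[rr r_1] rh] fsy mM.
pose gamma := circle a r.
have gin t : 0 < cabs (gamma t - a) < r0 by rewrite circle_dist // rr0 rr.
pose u t := (gamma t - a) ^+ e * h (gamma t).
have uE t : f (gamma t) = cusp_loc i (u t) by have [] := hf _ (gin t).
pose rho := r ^+ e * cabs h0.
have rho0 : 0 < rho by rewrite mulr_gt0 ?exprn_gt0.
have rho4 : rho < 4^-1.
  have re : r ^+ e <= r.
    by rewrite -[X in _ <= X]expr1; apply: ler_wiXn2l => //; exact: ltW.
  apply: (@le_lt_trans _ _ (r * cabs h0)); first by rewrite ler_wpM2r // ltW.
  rewrite -ltr_pdivlMr //; apply: (lt_le_trans rh).
  by rewrite invfM mulrC.
pose dl t := (h (gamma t) - h0) / RC (cabs h0).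
have RCh0 : RC (cabs h0) != 0 by rewrite -cabs_gt0 cabs_real normr_gt0 gt_eqF.
have dl8 t : cabs (dl t) < 8^-1.
  have [_] := hf _ (gin t); rewrite /dl cabs_div cabs_real gtr0_norm // ltr_pdivrMr //.
  by rewrite mulrC.
have uE2 t : u t = RC rho * (cis (x + e%:R * (2 * pi * t)) +
    cis (e%:R * (2 * pi * t)) * dl t).
  rewrite /u /gamma circleE addrC addKr exprMn cisX.
  have -> : h (a + RC r * cis (2 * pi * t)) = h0 + RC (cabs h0) * dl t.
    by rewrite /dl mulrCA divff // mulr1 [h0 + _]addrC subrK.
  rewrite {1}h0E cisD /rho rmorphM rmorphXn /=; ring.
have cu t : cabs (u t) <= rho * (9 / 8) /\ rho * (7 / 8) <= cabs (u t).
  rewrite uE2 cabsM cabs_real gtr0_norm //; split; rewrite ler_pM2l //.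
    apply: (le_trans (ler_cabsD _ _)); rewrite cabsM !cabs_cis.
    by have := dl8 t; lra.
  have := ler_cabsB (cis (x + e%:R * (2 * pi * t)) + cis (e%:R * (2 * pi * t)) * dl t)
    (cis (e%:R * (2 * pi * t)) * dl t).
  rewrite addrK cabsM !cabs_cis; have := dl8 t; lra.
have u0 t : u t != 0.
  by rewrite -cabs_gt0; have [_] := cu t; apply: lt_le_trans; rewrite mulr_gt0.
have u3 t : cabs (u t) < 3^-1 by have [] := cu t; lra.
have inU j t : turning_domain e x j t -> U5 (cyc i j) (f (gamma t)).
  move=> [hc _]; rewrite uE; apply: sector_chart => //.
  rewrite -cis_pihalf uE2 dotr_real dotrDl dotr_cis.
  have [c9 _] := cu t; rewrite uE2 in c9.
  (* The constant 3/8 fits on both sides: it is (9/8)/3, an upper bound for |u| / (3 rho), and 1/2 -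
     1/8, the cosine threshold minus the error. *)
  apply: (@le_trans _ _ (rho * (3 / 8))); first by move: c9; lra.
  rewrite ler_pM2l //.
  have : - 8^-1 <= dotr (cis (e%:R * (2 * pi * t)) * dl t) (cis (j%:R * (pi / 2))).
    set v := _ * dl t; have va : cabs v < 8^-1 by rewrite /v cabsM cabs_cis mul1r.
    have : `|dotr v (cis (j%:R * (pi / 2)))| <= cabs v.
      rewrite -(@ler_pXn2r _ 2) ?nnegrE ?cabs_ge0 // real_normK ?num_real //.
      rewrite cabs_sqr /dotr /=; move: (j%:R * (pi / 2)) => b.
      have cs := cos2Dsin2 b.
      have : 0 <= (cre v * sin b - cim v * cos b) ^+ 2 by rewrite sqr_ge0.
      have -> : cre v ^+ 2 + cim v ^+ 2 = (cre v * cos b + cim v * sin b) ^+ 2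
        + (cre v * sin b - cim v * cos b) ^+ 2.
        rewrite -[LHS]mulr1 -cs; ring.
      lra.
    rewrite ler_norml => /andP[]; lra.
  lra.
(* Each basis is already continued from sector 0, so consecutive Z agree on overlaps and the matrix
   D never changes along the circle. The monodromy appears only when Z (j0 + 4e) is compared with Z
   j0. *)
pose Z j : 'I_2 -> C -> C := fun k t => lcomb (turn P Q i j) (Y (cyc i j)) k (f t).
have tu j : turn P Q i j \in unitmx.
  elim: j => [|j IH] /=; first exact: unitmx1.
  rewrite unitmx_mul IH /=.
  by case: (cyc i j); case: (cyc i j.+1); rewrite /= ?unitmx1 ?unitmx_inv.
have fZ t j : turning_domain e x j t -> fund_at L (gamma t) (Z j).
  move=> /inU; apply: (pull _ (gin t) _ _ (@opn5 R (cyc i j))).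
  by apply: lcomb_fund => //; exact: opn5.
have near_f t (U : set C) : opn U -> U (f (gamma t)) -> \forall w \near gamma t, U (f w).
  move=> oU /oU/near_ball[d d0 hd]; apply: filterS (fcont _ (gin t) d d0) => w; exact: hd.
have step j t : turning_domain e x j t -> turning_domain e x j.+1 t ->
    \forall w \near gamma t, forall k, Z j k w = Z j.+1 k w.
  move=> /inU h1 /inU h2.
  have oI := setI_opn (@opn5 R (cyc i j)) (@opn5 R (cyc i j.+1)).
  apply: filterS (near_f t _ oI (conj h1 h2)) => w [w1 w2] k.
  rewrite /Z /= -lcombM; apply: eq_bigr => l _; congr (_ * _); exact: tY.
have [F [F0 F1 hF]] := monodromy_continuations mM.
have z0 : (0 : R) <= 0 by [].
have [j0 dj0] := turning_domain_cover e x0 z0.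
have fg0 : gamma 1 = gamma 0.
  rewrite /gamma !circleE mulr1 mulr0 cis0; congr (_ + _ * _).
  have -> : 2 * pi = pi *+ 2 :> R by rewrite mulr2n; ring.
  by rewrite /cis cos2pi sin2pi.
have [D hD] := fund_at_repM (fZ _ _ dj0) fsy.1.
have Du := fundamental_system_unit (fZ _ _ dj0) fsy hD.
have dj1 : turning_domain e x (j0 + 4 * e) 1.
  move: dj0; rewrite /turning_domain.
  have -> : x + e%:R * (2 * pi * 1) - (j0 + 4 * e)%:R * (pi / 2) =
    x + e%:R * (2 * pi * 0) - j0%:R * (pi / 2) :> R.
    by rewrite natrD natrM; field.
  by [].
have [] := @continuation_charts R L gamma nat (turning_domain e x) Z (fun _ D' => D' = D)
   F j0 D (circle_continuous a rr0) _ _ _ hF dj0 erefl _ (j0 + 4 * e)%N dj1.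
- move=> t /andP[t0 t1]; have [j hj] := turning_domain_cover e x0 t0; exists j => //.
  have [d d0 hd] := turning_domain_open hj; exists d => // s _; exact: hd.
- by move=> t j _; exact: fZ.
- move=> t j k D' t01 dj dk ->; exists 1%:M; last by rewrite mulmx1.
  have S : \forall w \near gamma t, forall l, Z j l w = Z k l w.
    have [<-|E1|E1] := turning_domain_adjacent dj dk.
    - by apply: filterS (near_f t _ (@opn5 R (cyc i j)) (inU _ _ dj)).
    - by rewrite E1 in dk *; exact: step.
    by rewrite E1 in dj *; apply: filterS (step _ _ dk dj) => w hw l; rewrite hw.
  by apply: filterS S => w hw l; rewrite hw lcomb1.
- by apply: filterS2 F0 hD => w e1 e2 k; rewrite e1 e2.
move=> D' -> hD'; exists D => //.
rewrite -/gamma fg0 in F1; rewrite fg0 in hD'.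
have cE : cyc i (j0 + 4 * e) = cyc i j0.
  by rewrite /cyc -modnDmr mulnC modnMl addn0.
have hE : \forall w \near gamma 0, forall k,
    F k 1 w = lcomb (D *m mxpow (cusp_mx P Q i) e) (Z j0) k w.
  apply: filterS hD' => w hw k; rewrite hw -lcombM; apply: eq_bigr => l _.
  by rewrite /Z turnX cE -lcombM.
exact: monodromy_conj (fZ _ _ dj0) Du hD F1 hE.
Qed.

End CircleMonodromy.

(** * Pullback by a rational function *)

Section RationalValues.
Context {R : realType}.
Local Notation C := (Cplx R).
Local Notation RC := (real_complex R).
Implicit Types (L E : lode R) (U V : set C) (w z v a c : C).
Implicit Types (f g : ratfun R) (p q : {poly C}).

Local Notation tof := (@FracField.tofrac {poly C}).

Lemma ratio_piE (x : {ratio {poly C}}) :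
  \pi_({fraction {poly C}})%qT x = tof (frac x).1 / tof (frac x).2.
Proof.
have d0 : tof (frac x).2 != 0 by rewrite tofrac_eq0 denom_ratioP.
apply: (mulIf d0); rewrite divfK //; unlock FracField.tofrac.
rewrite -[LHS]FracField.pi_mul; apply/eqmodP.
rewrite /= FracField.equivfE /FracField.mulf !numden_Ratio ?oner_eq0 ?mulf_neq0 ?denom_ratioP //.
by rewrite !mulr1 mulrC.
all: exact: oner_neq0.
Qed.

Lemma rden_neq0 f : rden f != 0.
Proof.
rewrite /rden; set r := repr f; have d0 : (frac r).2 != 0 by exact: denom_ratioP.
rewrite dvdp_div_eq0 ?dvdp_gcdr //.
Qed.

Lemma ratfunE f : f = tof (rnum f) / tof (rden f).
Proof.
rewrite -[LHS](reprK f) ratio_piE; set r := repr f.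
set n := (frac r).1; set d := (frac r).2.
have d0 : d != 0 by exact: denom_ratioP.
have g0 : gcdp n d != 0 by rewrite gcdp_eq0 negb_and d0 orbT.
have nE : n = rnum f * gcdp n d by rewrite /rnum -/r -/n -/d divpK ?dvdp_gcdl.
have dE : d = rden f * gcdp n d by rewrite /rden -/r -/n -/d divpK ?dvdp_gcdr.
have nE' : tof n = tof (rnum f) * tof (gcdp n d) by rewrite {1}nE rmorphM.
have dE' : tof d = tof (rden f) * tof (gcdp n d) by rewrite {1}dE rmorphM.
by rewrite nE' dE' -mulf_div divff ?mulr1 // tofrac_eq0.
Qed.

Lemma coprime_rnum_rden f : coprimep (rnum f) (rden f).
Proof.
apply: coprimep_div_gcd; apply/orP; right; exact: denom_ratioP.
Qed.

Lemma ratfun_cross f p q : q != 0 -> f = tof p / tof q -> rnum f * q = p * rden f.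
Proof.
move=> q0 fE; have /eqP := etrans (esym (ratfunE f)) fE.
by rewrite eqr_div ?tofrac_eq0 ?rden_neq0 // -!rmorphM tofrac_eq => /eqP.
Qed.

Lemma rden_dvd f p q : q != 0 -> f = tof p / tof q -> rden f %| q.
Proof.
move=> q0 fE; have E := ratfun_cross q0 fE.
have : rden f %| rnum f * q by rewrite E dvdp_mull.
by rewrite Gauss_dvdpr // coprimep_sym coprime_rnum_rden.
Qed.

Lemma ratfun_coprime_eq f p q : q != 0 -> coprimep p q -> f = tof p / tof q ->
  exists2 k : C, k != 0 & rnum f = k *: p /\ rden f = k *: q.
Proof.
move=> q0 cpq fE; have dq := rden_dvd q0 fE; have E := ratfun_cross q0 fE.
have qd : q %| rden f.
  have : q %| p * rden f by rewrite -E dvdp_mull.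
  by rewrite Gauss_dvdpr // coprimep_sym.
have /eqpP[[u v] /= /andP[u0 v0] uv] : q %= rden f by rewrite /eqp qd dq.
have dE : rden f = (u / v) *: q.
  by rewrite mulrC -scalerA uv scalerA mulVf // scale1r.
exists (u / v); first by rewrite mulf_neq0 ?invr_neq0.
split=> //; apply: (mulIf q0); rewrite E dE -scalerAr -scalerAl //.
Qed.

(** Any fraction regular at w may serve as witness, so the relation is stable under field operations
    without reduction to lowest terms, whereas [reval] depends on the chosen reduced
    representative. *)
Definition rv f w v : Prop :=
  exists p q, [/\ q.[w] != 0, f = tof p / tof q & v = p.[w] / q.[w]].

Definition reg f w : bool := ~~ root (rden f) w.

Lemma reg_rv f w : reg f w -> rv f w (reval f w).
Proof. by move=> h; exists (rnum f), (rden f); split=> //; exact: ratfunE. Qed.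

Lemma rv_reg f w v : rv f w v -> reg f w /\ reval f w = v.
Proof.
move=> [p [q [qw fE ->]]].
have q0 : q != 0 by apply: contraNneq qw => ->; rewrite horner0.
have [s qE] := dvdpP _ _ (rden_dvd q0 fE).
have dw : (rden f).[w] != 0.
  by apply: contraNneq qw => h; rewrite qE hornerM h mulr0.
split=> //; have := congr1 (fun p => p.[w]) (ratfun_cross q0 fE).
rewrite !hornerM /reval => E; apply: (mulIf dw); apply: (mulIf qw).
by rewrite divfK // E mulrAC divfK.
Qed.

Lemma rv_tof p w : rv (tof p) w p.[w].
Proof. by exists p, 1; rewrite hornerC oner_neq0 rmorph1 !divr1. Qed.

Lemma rvD f g w u v : rv f w u -> rv g w v -> rv (f + g) w (u + v).
Proof.
move=> [p [q [q0 -> ->]]] [p' [q' [q'0 -> ->]]].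
have Q0 : q != 0 by apply: contraNneq q0 => ->; rewrite horner0.
have Q'0 : q' != 0 by apply: contraNneq q'0 => ->; rewrite horner0.
exists (p * q' + p' * q), (q * q'); split.
- by rewrite hornerM mulf_neq0.
- by rewrite rmorphD !rmorphM /= addf_div // tofrac_eq0.
- by rewrite hornerD !hornerM addf_div.
Qed.

Lemma rvM f g w u v : rv f w u -> rv g w v -> rv (f * g) w (u * v).
Proof.
move=> [p [q [q0 -> ->]]] [p' [q' [q'0 -> ->]]].
exists (p * p'), (q * q'); split.
- by rewrite hornerM mulf_neq0.
- by rewrite !rmorphM /= mulf_div.
- by rewrite !hornerM mulf_div.
Qed.

Lemma rvN f w u : rv f w u -> rv (- f) w (- u).
Proof.
move=> [p [q [q0 -> ->]]]; exists (- p), q; split=> //; first by rewrite rmorphN mulNr.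
by rewrite hornerN mulNr.
Qed.

Lemma rvV f w u : u != 0 -> rv f w u -> rv f^-1 w u^-1.
Proof.
move=> u0 [p [q [q0 -> uE]]]; rewrite uE in u0 *.
exists q, p; rewrite !invf_div; split=> //.
by apply: contraNneq u0 => ->; rewrite mul0r.
Qed.

Lemma rvX f w u n : rv f w u -> rv (f ^+ n) w (u ^+ n).
Proof.
move=> h; elim: n => [|n IH]; last by rewrite !exprS; exact: rvM.
by rewrite !expr0; have := rv_tof 1 w; rewrite rmorph1 hornerC.
Qed.

Definition ev_ratfun (p : {poly C}) g : ratfun R :=
  (map_poly (fun c => tof c%:P) p).[g].

Lemma rv_ev p g w v : rv g w v -> rv (ev_ratfun p g) w p.[v].
Proof.
move=> h; rewrite /ev_ratfun.
rewrite [X in rv X _ _](_ : _ = (map_poly (tof \o polyC) p).[g]) //.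
elim/poly_ind: p => [|p c IH].
  by rewrite rmorph0 !horner0; have := rv_tof 0 w; rewrite rmorph0 horner0.
rewrite rmorphD rmorphM /= map_polyX map_polyC /= !hornerE.
apply: rvD; first exact: rvM.
by have := rv_tof c%:P w; rewrite hornerC.
Qed.

Lemma rv_comp f g w v : rv g w v -> reg f v -> rv (rcomp f g) w (reval f v).
Proof.
move=> h rf; rewrite /rcomp /reval; apply: rvM; first exact: rv_ev.
apply: rvV; first exact: rf.
exact: rv_ev.
Qed.

Lemma cder_reval f w : reg f w -> rv (rderiv f) w (derive1 (reval f) w) /\
  cder (reval f) w (derive1 (reval f) w).
Proof.
move=> rf; set n := rnum f; set d := rden f.
have D : cder (reval f) w ((n^`().[w] * d.[w] - n.[w] * d^`().[w]) / d.[w] ^+ 2).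
  exact: cder_div rf (cder_horner n w) (cder_horner d w).
rewrite (cder_derive1 D); split=> //.
exists (n^`() * d - n * d^`()), (d ^+ 2); split.
- by rewrite horner_exp expf_neq0.
- by rewrite /rderiv rmorphXn.
- by rewrite horner_exp hornerD hornerN !hornerM.
Qed.

Lemma opn_reg f : opn (fun w => reg f w).
Proof.
move=> w; rewrite /reg /root => h.
have := cder_continuous (cder_horner (rden f) w) (e := cabs (rden f).[w]).
rewrite cabs_gt0 => /(_ h); apply: filterS => t ht.
by apply: contraTneq ht => ->; rewrite sub0r cabsN ltxx.
Qed.

Lemma near_rderiv f w : reg f w ->
  \forall t \near w, reval (rderiv f) t = derive1 (reval f) t.
Proof.
move=> rf; apply: filterS (opn_reg rf) => t rt.
exact: (rv_reg (cder_reval rt).1).2.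
Qed.

Lemma opn_nz (f : C -> C) (D : C -> C) (U : set C) : opn U -> (forall w, U w -> cder f w (D w)) ->
  opn (fun w => U w /\ f w != 0).
Proof.
move=> oU hD w [Uw fw]; rewrite -cabs_gt0 in fw.
have h := cder_continuous (hD w Uw) fw; apply: filterS2 (oU w Uw) h => t Ut ht; split=> //.
by apply: contraTneq ht => ->; rewrite sub0r cabsN ltxx.
Qed.

(* Near w, the solutions of L' are the composites of the solutions of L with f. *)
Definition pulls L' L (f : C -> C) w : Prop := forall U (Y : 'I_2 -> C -> C),
  opn U -> fund_on L U Y -> U (f w) -> fund_at L' w (fun j t => Y j (f t)).

Lemma pulls_comp L'' L' L (f g : C -> C) w : pulls L'' L' g w -> pulls L' L f (g w) ->
  pulls L'' L (fun t => f (g t)) w.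
Proof.
move=> pg pf U Y oU fY Uw; have [e e0 fe] := pf U Y oU fY Uw.
apply: (pg (cdisc (g w) e) (fun j t => Y j (f t)) (@opn_cdisc R _ _) fe).
by rewrite /cdisc /= subrr cabs0.
Qed.

Definition unramified_at f w : bool := reg f w && (derive1 (reval f) w != 0).

Lemma pullback_coefs L f w : unramified_at f w -> regular_at L (reval f w) ->
  let D := derive1 (reval f) in
  rv (lcoef1 (pullback f L)) w
     (reval (lcoef1 L) (reval f w) * D w - derive1 D w / D w) /\
  rv (lcoef0 (pullback f L)) w (reval (lcoef0 L) (reval f w) * D w ^+ 2).
Proof.
move=> /andP[rf D0] /andP[r1 r0] D.
have vf := reg_rv rf; have [vD cD] := cder_reval rf.
have [rD eD] := rv_reg vD.
have [vD2 cD2] := cder_reval rD.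
have E := near_rderiv rf.
have DE := nbhs_singleton (derive1_near E).
rewrite DE in vD2.
split; first exact: rvD (rvM (rv_comp vf r1) vD) (rvN (rvM vD2 (rvV D0 vD))).
exact: rvM (rv_comp vf r0) (rvX 2 vD).
Qed.

Lemma pullback_regular L f w : unramified_at f w -> regular_at L (reval f w) ->
  regular_at (pullback f L) w.
Proof.
move=> uf rL; have [/rv_reg[h1 _] /rv_reg[h0 _]] := pullback_coefs uf rL.
exact/andP.
Qed.


Lemma opn_regular L : opn (fun w => regular_at L w).
Proof. by move=> w /andP[/opn_reg h1 /opn_reg h0]; apply: filterS2 h1 h0 => t a b; exact/andP. Qed.

Lemma opn_unramified f : opn (fun w => unramified_at f w).
Proof.
move=> w /andP[rf Df]; have [vD _] := cder_reval rf; have [rD _] := rv_reg vD.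
have cD t : reg f t -> cder (derive1 (reval f)) t (derive1 (derive1 (reval f)) t).
  move=> rt; have [vDt _] := cder_reval rt; have [rDt _] := rv_reg vDt.
  have [_ c2] := cder_reval rDt.
  have E := near_rderiv rt.
  by rewrite -(nbhs_singleton (derive1_near E)); exact: cder_near E c2.
have := @opn_nz _ _ _ (@opn_reg f) cD w (conj rf Df).
by apply: filterS => t [a b]; exact/andP.
Qed.

Lemma sol_pullback L f y w : unramified_at f w -> regular_at L (reval f w) ->
  sol_at L y (reval f w) -> (\forall t \near reval f w, sol_at L y t) ->
  sol_at (pullback f L) (fun t => y (reval f t)) w /\
  derive1 (fun t => y (reval f t)) w = derive1 y (reval f w) * derive1 (reval f) w.
Proof.
move=> uf rL sy sn; set u := reval f w; set D := derive1 (reval f).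
have [/rv_reg[_ v1] /rv_reg[_ v0]] := pullback_coefs uf rL.
have /andP[rf D0] := uf; have [vD cD] := cder_reval rf; have [rD _] := rv_reg vD.
have cD2 : cder D w (derive1 D w).
  have [_ c2] := cder_reval rD.
  have E := near_rderiv rf.
  by rewrite -(nbhs_singleton (derive1_near E)); exact: cder_near E c2.
have /sol_atP[a0 a1] := sy.
have c0 := cder_comp cD a0.
have E1 : \forall t \near w, derive1 y (reval f t) * D t = derive1 (fun t => y (reval f t)) t.
  have [e e0 he] := near_ball sn.
  have := cder_continuous cD e0; apply: filterS2 (opn_reg rf) => t rt ht.
  have [_ cDt] := cder_reval rt; have /sol_atP[b0 _] := he _ ht.
  by rewrite (cder_derive1 (cder_comp cDt b0)).
split; last exact: cder_derive1 c0.
apply/sol_atP; rewrite (cder_derive1 c0); split=> //.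
have c1 := cder_near E1 (cderM (cder_comp cD a1) cD2).
apply: (cder_eq c1); rewrite v1 v0 -/u -/D.
move: D0; rewrite -/D; move: (D w) (derive1 D w) (derive1 y u) (y u) (reval _ u) (reval _ u).
by move=> *; field.
Qed.

(** The Wronskian of the composites is the Wronskian of Y at f times f', nonzero where f is
    unramified. *)
Lemma pullback_pulls L f w : unramified_at f w -> regular_at L (reval f w) ->
  pulls (pullback f L) L (reval f) w.
Proof.
move=> uf rL U Y oU [sY wY] Uw.
have N : \forall t \near w, [/\ unramified_at f t, regular_at L (reval f t) & U (reval f t)].
  have [e1 e10 h1] := near_ball (opn_regular rL); have [e2 e20 h2] := near_ball (oU _ Uw).
  have m0 : 0 < Num.min e1 e2 by rewrite lt_min e10 e20.
  have /andP[rf _] := uf; have [_ cD] := cder_reval rf.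
  apply: filterS2 (opn_unramified uf) (cder_continuous cD m0) => t ut.
  by rewrite lt_min => /andP[/h1 a /h2 b].
have [e e0 he] := near_ball N; exists e => //.
have S t : cdisc w e t -> forall i, sol_at (pullback f L) (fun t => Y i (reval f t)) t /\
  derive1 (fun t => Y i (reval f t)) t = derive1 (Y i) (reval f t) * derive1 (reval f) t.
  move=> /he[ut rt Ut] i; apply: sol_pullback => //; first exact: sY.
  by apply: filterS (oU _ Ut) => s; exact: sY.
split=> [i t /S/(_ i)[]//|t ht].
have [/andP[_ D0] _ Ut] := he t ht.
have -> : wronskian (fun j t => Y j (reval f t)) t =
    wronskian Y (reval f t) * derive1 (reval f) t.
  rewrite /wronskian (S t ht ord0).2 (S t ht ord_max).2.
  move: (derive1 _ _) (derive1 _ _) (derive1 _ _) (Y _ _) (Y _ _) => *; ring.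
exact: (mulf_neq0 (wY _ Ut) D0).
Qed.

End RationalValues.

(** * Fibres, multiplicities and the point at infinity *)

Section Fibres.
Context {R : realType}.
Local Notation C := (Cplx R).
Local Notation RC := (real_complex R).
Implicit Types (w z v a c : C) (f g : ratfun R) (p q : {poly C}) (y x : P1 R).
Local Notation tof := (@FracField.tofrac {poly C}).

Lemma rnum_rden_noroot f a : root (rden f) a -> (rnum f).[a] != 0.
Proof.
have := coprime_rnum_rden f; rewrite coprimep_sym => /coprimep_root; exact.
Qed.

Lemma rvalue_atE f a y : rvalue_at f a = y <-> root (fibre_poly f y) a.
Proof.
rewrite /rvalue_at; case: y => [c|] /=; last by case: ifP => h; split.
have -> : root (rnum f - c *: rden f) a = ((rnum f).[a] - c * (rden f).[a] == 0).
  by rewrite /root hornerD hornerN hornerZ.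
case: ifPn => h; last first.
  have d0 : (rden f).[a] != 0 by exact: h.
  split=> [[<-]|]; first by rewrite /reval divfK // subrr.
  by rewrite subr_eq0 => /eqP E; rewrite /reval E mulfK.
split=> // ; have := rnum_rden_noroot h; have /eqP -> : (rden f).[a] == 0 by exact: h.
by rewrite mulr0 subr0 => /negPf ->.
Qed.

Lemma mupZ (k : C) p a : k != 0 -> mup a (k *: p) = mup a p.
Proof.
move=> k0; rewrite -mul_polyC mupMr //.
by rewrite /root hornerC.
Qed.

Lemma mup_factor p a : p != 0 -> exists2 q, q.[a] != 0 & p = q * ('X - a%:P) ^+ mup a p.
Proof.
move=> p0; have [m [q]] := multiplicity_XsubC p a; rewrite p0 /= => qa pE.
exists q; first exact: qa.
by rewrite {2}pE mupMr // mup_XsubCX eqxx.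
Qed.

Lemma horner_near p a (e : R) : 0 < e -> exists2 d : R, 0 < d &
  forall w, cabs (w - a) < d -> cabs (p.[w] - p.[a]) < e.
Proof. by move=> e0; apply: near_ball; exact: cder_continuous (cder_horner p a) e e0. Qed.

Lemma poly_isolated p a : p != 0 -> exists2 d : R, 0 < d &
  forall w, 0 < cabs (w - a) < d -> p.[w] != 0.
Proof.
move=> p0; have [q qa pE] := mup_factor a p0.
have qa0 : 0 < cabs q.[a] by rewrite cabs_gt0.
have [d d0 hd] := horner_near q a qa0; exists d => // w /andP[w0 wd].
rewrite pE hornerM horner_exp hornerXsubC mulf_neq0 ?expf_neq0 // -?cabs_gt0 //.
rewrite cabs_gt0; apply: contraTneq (hd w wd) => ->.
by rewrite sub0r cabsN ltxx.
Qed.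

Lemma quot_near p q a (e : R) : q.[a] != 0 -> 0 < e -> exists2 d : R, 0 < d &
  forall w, cabs (w - a) < d -> q.[w] != 0 /\ cabs (p.[w] / q.[w] - p.[a] / q.[a]) < e.
Proof.
move=> qa e0.
have D := cder_div qa (cder_horner p a) (cder_horner q a).
have [d1 d10 h1] := near_ball (cder_continuous D e0).
have qa0 : 0 < cabs q.[a] by rewrite cabs_gt0.
have [d2 d20 h2] := horner_near q a qa0.
exists (Num.min d1 d2); first by rewrite lt_min d10 d20.
move=> w; rewrite lt_min => /andP[/h1 ? /h2 h]; split=> //.
by apply: contraTneq h => ->; rewrite sub0r cabsN ltxx.
Qed.

Definition cusp_pt (i : cusp3) : P1 R := match i with
  | cusp_0 => pt 0 | cusp_1 => pt 1 | cusp_oo => infty end.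

(** Write the fibre polynomial as k (X - a)^m with k nonzero at a. Then h is k over the denominator
    of f at the cusps 0 and 1, and k over the numerator at infinity, where the local parameter is
    1/f. *)
Lemma local_form f a i : fibre_poly f (cusp_pt i) != 0 -> rvalue_at f a = cusp_pt i ->
  exists (h0 : C) (h : C -> C), h0 != 0 /\ forall e : R, 0 < e -> exists2 d : R, 0 < d &
    forall w, 0 < cabs (w - a) < d ->
    [/\ reg f w, cabs (h w - h0) < e &
        reval f w = cusp_loc i ((w - a) ^+ mup a (fibre_poly f (cusp_pt i)) * h w)].
Proof.
move=> P0 fa; have [k ka kE] := mup_factor a P0.
have [dd dd0 hdd] := poly_isolated a (rden_neq0 f).
have fin (c : C) : rvalue_at f a = pt c -> (rden f).[a] != 0.
  by rewrite /rvalue_at; case: ifPn.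
have reg_of w d' : 0 < cabs (w - a) < Num.min d' dd -> reg f w.
  by rewrite lt_min => /and3P[w0 _ w1]; apply: hdd; rewrite w0.
have finE c w : reg f w -> fibre_poly f (pt c) = k * ('X - a%:P) ^+ mup a (fibre_poly f (pt c)) ->
    reval f w = c + (w - a) ^+ mup a (fibre_poly f (pt c)) * (k.[w] / (rden f).[w]).
  move=> rw /(congr1 (fun p => p.[w])); set m := mup _ _.
  rewrite /= [X in X = _]hornerD hornerN hornerZ hornerM horner_exp hornerXsubC => E.
  have d0 : (rden f).[w] != 0 := rw.
  by rewrite mulrA [_ * k.[w]]mulrC -E mulrBl mulfK // addrC subrK.
case: i P0 fa kE => P0 fa kE.
- have da := fin _ fa; exists (k.[a] / (rden f).[a]), (fun w => k.[w] / (rden f).[w]).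
  split; first by rewrite mulf_neq0 ?invr_neq0.
  move=> e e0; have [d d0 hd] := quot_near k da e0.
  exists (Num.min d dd); first by rewrite lt_min d0 dd0.
  move=> w hw; have rw := reg_of w d hw; split=> //.
    by move: hw; rewrite lt_min => /and3P[_ /hd[]].
  by rewrite (finE 0 w rw kE) add0r.
- have da := fin _ fa; exists (k.[a] / (rden f).[a]), (fun w => k.[w] / (rden f).[w]).
  split; first by rewrite mulf_neq0 ?invr_neq0.
  move=> e e0; have [d d0 hd] := quot_near k da e0.
  exists (Num.min d dd); first by rewrite lt_min d0 dd0.
  move=> w hw; have rw := reg_of w d hw; split=> //.
    by move: hw; rewrite lt_min => /and3P[_ /hd[]].
  exact: finE 1 w rw kE.
have da : (rden f).[a] = 0 by apply/eqP; have /rvalue_atE := fa.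
have na := rnum_rden_noroot (introT eqP da : root (rden f) a).
exists (k.[a] / (rnum f).[a]), (fun w => k.[w] / (rnum f).[w]).
split; first by rewrite mulf_neq0 ?invr_neq0.
move=> e e0; have [d d0 hd] := quot_near k na e0.
exists (Num.min d dd); first by rewrite lt_min d0 dd0.
move=> w hw; have rw := reg_of w d hw.
have [nw hw'] : (rnum f).[w] != 0 /\ cabs (k.[w] / (rnum f).[w] - k.[a] / (rnum f).[a]) < e.
  by apply: hd; move: hw; rewrite lt_min => /and3P[].
split=> //; rewrite /reval /cusp_loc [in X in _ / X.[w]]/=.
have := congr1 (fun p => p.[w]) kE; rewrite /= hornerM horner_exp hornerXsubC => ->.
by rewrite mulrA invf_div [k.[w] * _]mulrC.
Qed.

(** For p of degree at most n this is X^n p(1/X). With n the degree of the rational function, the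
    order of vanishing at 0 measures how far the degree of p drops. *)
Definition revp (n : nat) p : {poly C} := \poly_(i < n.+1) p`_(n - i).

Lemma coef_revp n p i : (i <= n)%N -> (revp n p)`_i = p`_(n - i).
Proof. by move=> h; rewrite coef_poly ltnS h. Qed.

Lemma horner_revp n p w : w != 0 -> (size p <= n.+1)%N -> (revp n p).[w] = w ^+ n * p.[w^-1].
Proof.
move=> w0 sp; rewrite /revp horner_poly (horner_coef_wide _ sp) mulr_sumr.
rewrite [RHS](reindex_inj rev_ord_inj) /=; apply: eq_bigr => i _.
rewrite subSS mulrCA; congr (_ * _).
have ni : (i <= n)%N by rewrite -ltnS.
rewrite exprVn -{2}(subnK ni) exprD mulrAC divff ?mul1r // expf_neq0 //.
Qed.

Lemma revp_linear n p q c : revp n (p - c *: q) = revp n p - c *: revp n q.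
Proof.
apply/polyP => i; rewrite !(coef_poly, coefD, coefN, coefZ).
by case: ifP => _; rewrite ?mulr0 ?subr0.
Qed.

Lemma revp0 n p : (revp n p).[0] = p`_n.
Proof. by rewrite horner_coef0 coef_revp // subn0. Qed.

Lemma root_revp0 n p : (size p <= n.+1)%N -> root (revp n p) 0 = (size p <= n)%N.
Proof.
move=> sp; rewrite /root revp0; apply/eqP/idP => [h|h]; last by rewrite nth_default.
move: sp; rewrite leq_eqVlt => /orP[/eqP E|]; last by [].
move: h; have -> : n = (size p).-1 by rewrite E.
rewrite -lead_coefE => /eqP; rewrite lead_coef_eq0 => /eqP p0.
by rewrite p0 size_poly0 in E.
Qed.

Lemma revp_neq0 n p : p != 0 -> (size p <= n.+1)%N -> revp n p != 0.
Proof.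
move=> p0 sp; apply: contra_neq p0 => E; apply/polyP => i; rewrite coef0.
have [ni|ni] := leqP i n; last by rewrite nth_default // (leq_trans sp).
by have := congr1 (fun q : {poly C} => q`_(n - i)) E; rewrite coef_revp ?leq_subr // subKn // coef0.
Qed.

Lemma mup_revp n p : p != 0 -> (size p <= n.+1)%N -> mup 0 (revp n p) = (n.+1 - size p)%N.
Proof.
move=> p0 sp; have sp0 : (0 < size p)%N by rewrite size_poly_gt0.
pose m := (size p).-1.
have sm : size p = m.+1 by rewrite /m prednK.
have mn : (m <= n)%N by rewrite -ltnS -sm.
have -> : revp n p = revp m p * ('X - 0%:P) ^+ (n - m).
  rewrite subr0; apply/polyP => i; rewrite coefMXn coef_poly coef_poly.
  rewrite ltnS; case: (ltnP i (n - m)) => h.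
    case: ifP => // _; rewrite nth_default // sm; lia.
  have -> : (i - (n - m) < m.+1)%N = (i <= n)%N by lia.
  by case: ifP => // h'; congr (p`_ _); lia.
have nr : ~~ root (revp m p) 0 by rewrite root_revp0 sm ?ltnn.
by rewrite mupMr // mup_XsubCX eqxx sm subSS.
Qed.

Definition frac_inv : ratfun R := rX^-1.

Lemma exprV_cancel (F : fieldType) (x : F) n i : x != 0 -> (i <= n)%N ->
  x^-1 ^+ (n - i) * x ^+ n = x ^+ i.
Proof.
move=> x0 ni; rewrite -[in X in _ * x ^+ X](subnK ni) exprD mulrA exprVn mulVf ?mul1r //.
by rewrite expf_neq0.
Qed.

Lemma ev_ratfun_inv n p : (size p <= n.+1)%N ->
  ev_ratfun p frac_inv = tof (revp n p) / tof 'X^n.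
Proof.
move=> sp; have X0 : (rX : ratfun R) != 0 by rewrite tofrac_eq0 polyX_eq0.
have Xn : tof 'X^n = (rX : ratfun R) ^+ n by rewrite rmorphXn.
rewrite Xn; apply: (mulIf (expf_neq0 n X0)); rewrite divfK ?expf_neq0 //.
rewrite /ev_ratfun [X in X.[_]](_ : _ = map_poly (tof \o polyC) p) //.
have sq : (size (map_poly (tof \o polyC) p) <= n.+1)%N by rewrite size_map_poly.
rewrite (horner_coef_wide _ sq) mulr_suml /revp poly_def rmorph_sum /=.
rewrite [LHS](reindex_inj rev_ord_inj) /=; apply: eq_bigr => i _.
rewrite subSS coef_map /= -mul_polyC rmorphM rmorphXn /= -mulrA; congr (_ * _).
have ni : (i <= n)%N by rewrite -ltnS.
exact: exprV_cancel X0 ni.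
Qed.

Lemma rdeg_size f : (size (rnum f) <= (rdeg f).+1)%N /\ (size (rden f) <= (rdeg f).+1)%N.
Proof.
have d0 : (0 < size (rden f))%N by rewrite size_poly_gt0 rden_neq0.
by rewrite /rdeg prednK ?leq_maxl ?leq_maxr // leq_max d0 orbT.
Qed.

Lemma rdeg_attained f : (rnum f)`_(rdeg f) != 0 \/ (rden f)`_(rdeg f) != 0.
Proof.
have d0 := rden_neq0 f.
rewrite /rdeg; have [h|h] := leqP (size (rnum f)) (size (rden f)).
  by right; rewrite -lead_coefE lead_coef_eq0.
left; rewrite -lead_coefE lead_coef_eq0.
by apply: contraTneq h => ->; rewrite size_poly0.
Qed.

(** The reversed numerator and denominator remain coprime: away from 0 by inversion, and at 0
    because one of the two attains the degree of f. *)
Lemma rcomp_invE f : exists2 k : C, k != 0 &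
  rnum (rcomp f frac_inv) = k *: revp (rdeg f) (rnum f) /\
  rden (rcomp f frac_inv) = k *: revp (rdeg f) (rden f).
Proof.
have [sn sd] := rdeg_size f; set n := rdeg f in sn sd *.
have D0 := revp_neq0 (rden_neq0 f) sd.
apply: ratfun_coprime_eq => //; last first.
  rewrite /rcomp -/(ev_ratfun _ _) -/(ev_ratfun (rden f) _) !(ev_ratfun_inv (n := n)) //.
  rewrite invf_div mulrA divfK // tofrac_eq0.
  by rewrite -size_poly_eq0 size_polyXn.
apply: Pdiv.ClosedField.root_coprimep => w; have [->|w0] := eqVneq w 0.
  rewrite /root !revp0 => /eqP E; have [] := rdeg_attained f => //.
  by rewrite -/n E eqxx.
rewrite /root !horner_revp // !mulf_eq0 !expf_eq0 (negPf w0) andbF /=.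
by apply: (coprimep_root (coprime_rnum_rden f)).
Qed.

Lemma fibre_poly_inv f y : exists2 k : C, k != 0 &
  fibre_poly (rcomp f frac_inv) y = k *: revp (rdeg f) (fibre_poly f y).
Proof.
have [k k0 [nE dE]] := rcomp_invE f; exists k => //.
case: y => [c|] //=; rewrite revp_linear nE dE scalerBr !scalerA.
by rewrite mulrC.
Qed.

Lemma fibre_poly_size f y : (size (fibre_poly f y) <= (rdeg f).+1)%N.
Proof.
have [sn sd] := rdeg_size f; case: y => [c|] //=.
rewrite (leq_trans (size_polyD _ _)) // geq_max sn size_polyN.
exact: leq_trans (size_scale_leq _ _) sd.
Qed.

Lemma fibre_poly_neq0 f y : (0 < rdeg f)%N -> fibre_poly f y != 0.
Proof.
case: y => [c|] d0 /=; last exact: rden_neq0.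
apply: contraTneq d0 => /eqP; rewrite subr_eq0 => /eqP E.
have cp := coprime_rnum_rden f; rewrite E in cp.
have sd : size (rden f) = 1%N.
  have [c0|c0] := eqVneq c 0; first by rewrite c0 scale0r coprime0p -size_poly_eq1 in cp; exact/eqP.
  rewrite coprimepZl // coprimepp in cp; exact/eqP.
rewrite -leqNgt /rdeg E sd; have := size_scale_leq c (rden f); rewrite sd.
by move=> h; rewrite (maxn_idPr h).
Qed.

Lemma rvalueE f x y : rvalue f x = y <-> match x with
  | Some a => root (fibre_poly f y) a : Prop
  | None => (size (fibre_poly f y) <= rdeg f)%N end.
Proof.
case: x => [a|] /=; first exact: rvalue_atE.
have [k k0 kE] := fibre_poly_inv f y.
rewrite -[(rX : ratfun R)^-1]/frac_inv; split.
  move=> /rvalue_atE; rewrite kE /root hornerZ mulf_eq0 (negPf k0) /=.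
  by rewrite -/(root _ _) root_revp0 // fibre_poly_size.
move=> h; apply/rvalue_atE; rewrite kE /root hornerZ mulf_eq0 (negPf k0) /=.
by rewrite -/(root _ _) root_revp0 // fibre_poly_size.
Qed.

End Fibres.

(** * Riemann-Hurwitz *)

Section RiemannHurwitz.
Context {R : realType}.
Local Notation C := (Cplx R).
Implicit Types (w z v a c : C) (f g : ratfun R) (p q : {poly C}) (y x : P1 R).

Lemma deriv_eq0_size p : p^`() = 0 -> (size p <= 1)%N.
Proof.
move=> dp; rewrite leqNgt; apply/negP => sp.
have := congr1 (fun q : {poly C} => q`_(size p).-2) dp.
rewrite coef_deriv coef0 => /eqP; rewrite mulrn_eq0 /=.
have -> : (size p).-2.+1 = (size p).-1 by case: (size p) sp => [|[|]].
rewrite -lead_coefE lead_coef_eq0 -size_poly_eq0.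
by case: (size p) sp.
Qed.

(** The numerator of f', whose zeros carry the finite ramification of f. *)
Definition rwr f : {poly C} := (rnum f)^`() * rden f - rnum f * (rden f)^`().

Lemma dvd_deriv_size p : p %| p^`() -> (size p <= 1)%N.
Proof.
have [-> _|p0 pd] := eqVneq p 0; first by rewrite size_poly0.
apply: deriv_eq0_size; apply/eqP; apply: contraT => dp0.
by have := dvdp_leq dp0 pd; rewrite leqNgt lt_size_deriv.
Qed.

Lemma rwr_neq0 f : (0 < rdeg f)%N -> rwr f != 0.
Proof.
apply: contraTneq => /eqP; rewrite subr_eq0 => /eqP E.
have cp := coprime_rnum_rden f.
have sd : (size (rden f) <= 1)%N.
  apply: dvd_deriv_size; have : rden f %| rnum f * (rden f)^`() by rewrite -E dvdp_mull.
  by rewrite Gauss_dvdpr // coprimep_sym.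
have sn : (size (rnum f) <= 1)%N.
  apply: dvd_deriv_size; have : rnum f %| (rnum f)^`() * rden f by rewrite E dvdp_mulr.
  by rewrite Gauss_dvdpl.
have : (maxn (size (rnum f)) (size (rden f)) <= 1)%N by rewrite geq_max sn.
by rewrite -leqNgt /rdeg; case: maxn => [|[|]].
Qed.

(** This expression is unchanged when the numerator is replaced by the fibre polynomial of any
    finite y, so a point of multiplicity m in any fibre is a zero of order at least m - 1. *)
Lemma rwr_fibre f y : rwr f = match y with
  | Some c => (fibre_poly f y)^`() * rden f - fibre_poly f y * (rden f)^`()
  | None => (rnum f)^`() * fibre_poly f y - rnum f * (fibre_poly f y)^`() end.
Proof.
case: y => [c|] //=; rewrite derivB derivZ /rwr -!mul_polyC; ring.
Qed.

Lemma dvd_deriv_exp p a n : ('X - a%:P) ^+ n %| p -> ('X - a%:P) ^+ n.-1 %| p^`().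
Proof.
case: n => [|n]; first by move=> _; rewrite expr0 dvd1p.
move=> /dvdpP[q ->]; rewrite derivM; apply: dvdp_add.
  by rewrite exprS mulrA dvdp_mull.
by rewrite dvdp_mull // deriv_exp derivXsubC mul1r /= -mulr_natr dvdp_mulr.
Qed.

Lemma rwr_dvd f a y : fibre_poly f y != 0 ->
  ('X - a%:P) ^+ (mup a (fibre_poly f y)).-1 %| rwr f.
Proof.
move=> P0; set m := mup _ _.
have h : ('X - a%:P) ^+ m %| fibre_poly f y by rewrite -mup_geq.
have h1 : ('X - a%:P) ^+ m.-1 %| fibre_poly f y.
  by apply: dvdp_trans h; rewrite dvdp_exp2l // leq_pred.
have h2 := dvd_deriv_exp h.
rewrite (rwr_fibre f y); case: (y) h1 h2 => [c|] h1 h2; apply: dvdp_sub;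
  first [exact: dvdp_mulr|exact: dvdp_mull].
Qed.

(** Applied to the fibre through infinity, whose polynomial has smaller degree, the bound drops by
    the multiplicity of infinity. *)
Lemma rwr_size f y : (0 < rdeg f)%N -> (size (rwr f) < rdeg f + size (fibre_poly f y))%N.
Proof.
move=> d0; have P0 := fibre_poly_neq0 y d0.
have sP : (0 < size (fibre_poly f y))%N by rewrite size_poly_gt0.
have sP' := lt_size_deriv P0.
have [sn sd] := rdeg_size f.
have sd' := leq_trans (lt_size_deriv (rden_neq0 f)) sd.
have sn' : (size (rnum f)^`() <= rdeg f)%N.
  have [n0|n0] := eqVneq (rnum f) 0; first by rewrite n0 deriv0 size_poly0.
  by have := leq_trans (lt_size_deriv n0) sn.
have szM p q : (size (p * q)%R <= (size p + size q).-1)%N by exact: size_polyMleq.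
rewrite (rwr_fibre f y); case: (y) P0 sP sP' => [c|] P0 sP sP';
apply: (leq_ltn_trans (size_polyD _ _)); rewrite size_polyN gtn_max;
apply/andP; split; apply: (leq_ltn_trans (szM _ _)); lia.
Qed.

Lemma ramifE f x y : (0 < rdeg f)%N -> rvalue f x = y -> ramif f x =
  match x with Some a => mup a (fibre_poly f y)
  | None => ((rdeg f).+1 - size (fibre_poly f y))%N end.
Proof.
move=> d0; case: x => [a|] /=; rewrite /ramif_at; first by move=> ->.
rewrite -[rX^-1]/(@frac_inv R) => ->; have [k k0 ->] := fibre_poly_inv f y.
by rewrite mupZ // mup_revp ?fibre_poly_neq0 // fibre_poly_size.
Qed.

Lemma mup_count p a (rs : seq C) : p != 0 -> p = lead_coef p *: \prod_(z <- rs) ('X - z%:P) ->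
  mup a p = count_mem a rs.
Proof. by move=> p0 ->; rewrite mupZ ?lead_coef_eq0 // mu_prod_XsubC. Qed.

Lemma sum_mup_le p (s : seq C) : p != 0 -> uniq s -> (\sum_(a <- s) mup a p < size p)%N.
Proof.
move=> p0 us; have [rs pE] := closed_field_poly_normal p.
rewrite (eq_bigr (fun a => count_mem a rs)); last by move=> a _; exact: mup_count.
have -> : size p = (size rs).+1.
  by rewrite pE size_scale ?lead_coef_eq0 // size_prod_XsubC.
rewrite ltnS; elim: rs {pE} => [|r rs IH]; first by rewrite big1.
rewrite (eq_bigr (fun a => (r == a) + count_mem a rs)%N) // big_split /= addnC.
rewrite -addn1 leq_add //.
have -> : (\sum_(a <- s) (r == a) = count_mem r s)%N.
  by rewrite -sum1_count [RHS]big_mkcond; apply: eq_bigr => a _; rewrite /= eq_sym; case: (a == r).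
by rewrite count_uniq_mem // leq_b1.
Qed.

Lemma sum_mup_roots p : p != 0 -> exists s : seq C,
  [/\ uniq s, forall a, a \in s = root p a & (\sum_(a <- s) mup a p).+1 = size p].
Proof.
move=> p0; have [rs pE] := closed_field_poly_normal p.
exists (undup rs); split; first exact: undup_uniq.
  move=> a; rewrite mem_undup pE rootZ ?lead_coef_eq0 //.
  by rewrite root_prod_XsubC.
rewrite (eq_bigr (fun a => count_mem a rs)); last by move=> a _; exact: mup_count.
rewrite pE size_scale ?lead_coef_eq0 // size_prod_XsubC; congr _.+1.
have /perm_size := perm_count_undup rs.
rewrite size_flatten /shape -map_comp sumnE big_map => <-.
by apply: eq_bigr => a _; rewrite /= size_nseq.
Qed.

Lemma sum_P1_split (F : P1 R -> nat) (xs : seq (P1 R)) : uniq xs ->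
  (\sum_(x <- xs) F x <= \sum_(a <- pmap id xs) F (Some a) + F None)%N.
Proof.
move=> ux; have nn (s : seq (P1 R)) : None \notin s ->
    \sum_(x <- s) F x = \sum_(a <- pmap id s) F (Some a).
  elim: s => [|[a|] s IH] //=; rewrite ?big_nil // inE negb_or.
  by move=> /IH h; rewrite !big_cons h.
have [h|h] := boolP (None \in xs); last by rewrite nn // leq_addr.
have E : perm_eq (pmap (@id (option C)) xs) (pmap (@id (option C)) (rem None xs)).
  exact: (perm_pmap (@id (option C)) (perm_to_rem h)).
rewrite (perm_big _ E) (perm_big _ (perm_to_rem h)) big_cons.
by rewrite [X in (_ <= X)%N]addnC leq_add2l nn // mem_rem_uniqF.
Qed.

Theorem riemann_hurwitz_le f (xs : seq (P1 R)) : (0 < rdeg f)%N -> uniq xs ->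
  (\sum_(x <- xs) (ramif f x).-1 <= 2 * rdeg f - 2)%N.
Proof.
move=> d0 ux; apply: (leq_trans (sum_P1_split _ ux)).
set s := pmap id xs; have us : uniq s by apply: (pmap_uniq (g := Some)) ux => -[].
have W0 := rwr_neq0 d0.
have h1 : (\sum_(a <- s) (ramif f (Some a)).-1 < size (rwr f))%N.
  apply: leq_ltn_trans (sum_mup_le W0 us); apply: leq_sum => a _.
  rewrite (ramifE d0 erefl) mup_geq // rwr_dvd // fibre_poly_neq0 //.
(* With n the size of this fibre polynomial and d the degree, the finite points contribute at most d
   + n - 2 and infinity contributes d - n, which sum to 2d - 2. *)
have h2 := rwr_size (rvalue f None) d0.
have h3 : (size (fibre_poly f (rvalue f None)) <= rdeg f)%N.
  by have /rvalueE := erefl (rvalue f None).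
rewrite (ramifE d0 (erefl (rvalue f None))).
move: h1; rewrite -/s; move: (\sum_(a <- s) _)%N => S h1; lia.
Qed.

Lemma fibre_list f y : (0 < rdeg f)%N -> exists xs : seq (P1 R),
  [/\ uniq xs, forall x, x \in xs <-> rvalue f x = y,
      forall x, x \in xs -> (0 < ramif f x)%N
    & (\sum_(x <- xs) ramif f x)%N = rdeg f].
Proof.
move=> d0; have P0 := fibre_poly_neq0 y d0; set P := fibre_poly f y in P0.
have [s [us hs Ss]] := sum_mup_roots P0.
have sP := fibre_poly_size f y; rewrite -/P in sP.
have sP0 : (0 < size P)%N by rewrite size_poly_gt0.
pose inf := if (size P <= rdeg f)%N then [:: None : P1 R] else [::].
pose xs : seq (P1 R) := [seq Some a : P1 R | a <- s] ++ inf.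
have memx x : x \in xs <-> rvalue f x = y.
  rewrite mem_cat; split.
    move=> /orP[/mapP[a]|].
      by rewrite hs => ra ->; apply/rvalueE.
    by rewrite /inf; case: ifP => // h; rewrite inE => /eqP ->; apply/rvalueE.
  move=> /rvalueE; case: x => [a|] h; apply/orP.
    by left; apply/mapP; exists a; rewrite ?hs.
  by right; rewrite /inf h inE.
exists xs; split=> //.
- rewrite cat_uniq map_inj_uniq ?us /=; last by move=> a b [].
  rewrite /inf; case: ifP => _ //=; rewrite andbT orbF.
  by apply/mapP => -[].
- move=> x /memx h; rewrite (ramifE d0 h) -/P; case: x h => [a|] /rvalueE h.
    by rewrite -XsubC_dvd // dvdp_XsubCl.
  by rewrite subn_gt0 ltnS.
have E : (\sum_(x <- xs) ramif f x = \sum_(x <- xs) match x with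
    Some a => mup a P | None => ((rdeg f).+1 - size P) end)%N.
  by apply: eq_big_seq => x /memx h; rewrite (ramifE d0 h).
rewrite E big_cat big_map /= /inf; move: Ss; set S := (\sum_(a <- s) _)%N => Ss.
case: ifP => h; rewrite ?big_cons big_nil; move: (size P) h sP sP0 Ss => n h sP sP0 Ss; lia.
Qed.

(** Three fibres with N points in all have total ramification 3d - N, and each further critical
    value adds at least 1, so 3d - N + 2 <= 2d - 2. *)
Theorem fibres_size_ge f (y0 y1 yoo z1 z2 : P1 R) (xs0 xs1 xsoo : seq (P1 R)) :
  (0 < rdeg f)%N -> uniq [:: y0; y1; yoo; z1; z2] ->
  critical_value f z1 -> critical_value f z2 ->
  (uniq xs0 /\ (forall x, x \in xs0 <-> rvalue f x = y0) /\ (\sum_(x <- xs0) ramif f x)%N = rdeg f) ->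
  (uniq xs1 /\ (forall x, x \in xs1 <-> rvalue f x = y1) /\ (\sum_(x <- xs1) ramif f x)%N = rdeg f) ->
  (uniq xsoo /\ (forall x, x \in xsoo <-> rvalue f x = yoo) /\ (\sum_(x <- xsoo) ramif f x)%N = rdeg f) ->
  (rdeg f + 4 <= size xs0 + size xs1 + size xsoo)%N.
Proof.
move=> d0 uy [x1 v1 r1] [x2 v2 r2] [u0 [m0 s0]] [u1 [m1 s1]] [uoo [moo soo]].
have ram xs : (\sum_(x <- xs) ramif f x <= \sum_(x <- xs) (ramif f x).-1 + size xs)%N.
  rewrite -sum1_size -big_split /=; apply: leq_sum => x _; lia.
have dis (xs ys : seq (P1 R)) y y' : (forall x, x \in xs -> rvalue f x = y) ->
    (forall x, x \in ys -> rvalue f x = y') -> y != y' -> ~~ has (mem xs) ys.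
  move=> hx hy yy'; apply/hasPn => x /hy E; apply: contra_neqN yy' => /hx <-.
  exact: E.
have ux : uniq (xs0 ++ xs1 ++ xsoo ++ [:: x1; x2]).
  move: uy; rewrite /= !inE !negb_or andbT.
  move=> /and4P[/and4P[a1 a2 a3 a4] /and3P[b1 b2 b3] /andP[k1 k2] e1].
  have M0 x : x \in xs0 -> rvalue f x = y0 by move/m0.
  have M1 x : x \in xs1 -> rvalue f x = y1 by move/m1.
  have Moo x : x \in xsoo -> rvalue f x = yoo by move/moo.
  have nin (xs : seq (P1 R)) (x y z : P1 R) : (forall x, x \in xs -> rvalue f x = y) -> rvalue f x = z ->
      y != z -> x \notin xs.
    by move=> h vx yz; apply: contra_neqN yz => /h <-.
  have x21 : x2 != x1 by apply: contra_neq e1 => E; rewrite -v1 -v2 E.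
  rewrite !cat_uniq !has_cat !negb_or u0 u1 uoo /= !inE.
  rewrite (dis _ _ _ _ M0 M1 a1) (dis _ _ _ _ M0 Moo a2) (dis _ _ _ _ M1 Moo b1).
  rewrite (nin _ _ _ _ M0 v1 a3) (nin _ _ _ _ M0 v2 a4) (nin _ _ _ _ M1 v1 b2).
  rewrite (nin _ _ _ _ M1 v2 b3) (nin _ _ _ _ Moo v1 k1) (nin _ _ _ _ Moo v2 k2) /=.
  by rewrite eq_sym x21.
have := riemann_hurwitz_le d0 ux.
rewrite !big_cat /= !big_cons big_nil.
have := ram xs0; have := ram xs1; have := ram xsoo; rewrite s0 s1 soo.
move: (\sum_(x <- xs0) _)%N (\sum_(x <- xs1) _)%N (\sum_(x <- xsoo) _)%N => S0 S1 S2.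
move: (ramif f x1) (ramif f x2) (rdeg f) (size xs0) (size xs1) (size xsoo) r1 r2 d0 => a b d n0 n1 n2 r1 r2 d0.
clear -r1 r2 d0. lia.
Qed.

End RiemannHurwitz.

(** * Non-apparent points of the pullback *)

Section ProjectiveOrder.
Variable K : fieldType.
Implicit Types (D A : 'M[K]_2).

Lemma conj_mxX D A n : D \in unitmx -> (D *m A *m invmx D) ^+ n = D *m (A ^+ n) *m invmx D.
Proof.
move=> Du; elim: n => [|n IH]; first by rewrite !expr0 mulmx1 mulmxV.
rewrite exprSr IH -mulmxE -!mulmxA (mulmxA (invmx D) D) mulVmx // mul1mx.
by rewrite !mulmxA -(mulmxA D) mulmxE -exprSr.
Qed.

Lemma scalar_conj D A : D \in unitmx ->
  is_scalar_mx (D *m A *m invmx D) = is_scalar_mx A.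
Proof.
move=> Du; have key B D' : D' \in unitmx -> is_scalar_mx B -> is_scalar_mx (D' *m B *m invmx D').
  move=> Du' /is_scalar_mxP[x ->]; rewrite scalar_mxC -mulmxA mulmxV // mulmx1.
  exact: scalar_mx_is_scalar.
apply/idP/idP; last exact: key.
have Di : invmx D \in unitmx by rewrite unitmx_inv.
move=> /(key _ _ Di); rewrite invmxK !mulmxA mulVmx // mul1mx -mulmxA mulVmx // mulmx1.
by [].
Qed.

Lemma scalar_power_conj D A n : D \in unitmx ->
  is_scalar_mx ((D *m A *m invmx D) ^+ n) = is_scalar_mx (A ^+ n).
Proof. by move=> Du; rewrite conj_mxX // scalar_conj. Qed.

Lemma scalar_power_mod A n e : A \in unitmx ->
  is_scalar_mx (A ^+ n) -> is_scalar_mx (A ^+ e) -> is_scalar_mx (A ^+ (e %% n)).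
Proof.
move=> Au /is_scalar_mxP[x xE] /is_scalar_mxP[y yE].
have x0 : x != 0.
  apply: contraTneq (unitrX n (Au : A \is a GRing.unit)) => x0.
  by rewrite xE x0 -scalemx1 scale0r unitr0.
have xX m : (x%:M : 'M[K]_2) ^+ m = (x ^+ m)%:M.
  by elim: m => [|m IH]; rewrite ?expr0 // !exprS IH -mulmxE -scalar_mxM.
have {}yE : A ^+ (e %% n) *m (x ^+ (e %/ n))%:M = y%:M.
  by rewrite -yE {3}(divn_eq e n) addnC exprD mulnC exprM xE xX mulmxE.
have -> : A ^+ (e %% n) = (y * (x ^+ (e %/ n))^-1)%:M.
  rewrite scalar_mxM -yE -mulmxA -scalar_mxM divff ?mulmx1 //.
  by rewrite expf_neq0.
exact: scalar_mx_is_scalar.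
Qed.

End ProjectiveOrder.

(** * Local monodromy of the pullback over the cusps *)

Section CuspCovers.
Context {R : realType}.
Local Notation C := (Cplx R).
Local Notation RC := (real_complex R).
Implicit Types (L E : lode R) (w z v a c : C) (f g phi : ratfun R) (p q : {poly C}).
Implicit Types (M A D P Q : 'M[C]_2).
Local Notation tof := (@FracField.tofrac {poly C}).

Lemma cusp_loc_avoid i (u : C) : u != 0 -> cabs u < 1 ->
  cusp_loc i u != 0 /\ cusp_loc i u != 1.
Proof.
move=> u0 u1; have un1 (k : C) : cabs k = 1 -> u != k.
  by move=> k1; apply: contraTneq u1 => ->; rewrite k1 ltxx.
have h1 := un1 1 cabs1; have h2 := un1 (-1) (etrans (cabsN 1) cabs1).
case: i => /=; split=> //.
- by rewrite addrC addr_eq0.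
- by rewrite -subr_eq0 addrC addKr.
- by rewrite invr_eq0.
- by rewrite invr_eq1.
Qed.

(** The common part of finite points and of infinity. The rational function g supplies the local
    form, while f is the map with which solutions are composed; near infinity f is an iterated
    composite that only agrees with g off the puncture. *)
Lemma cusp_cover_of E L (f : C -> C) g a i :
  fibre_poly g (cusp_pt i) != 0 -> rvalue_at g a = cusp_pt i ->
  (exists2 d : R, 0 < d & forall w, 0 < cabs (w - a) < d -> reg g w ->
     [/\ f w = reval g w, forall e : R, 0 < e -> \forall t \near w, cabs (f t - f w) < e
       & f w != 0 -> f w != 1 -> pulls L E f w]) ->
  cusp_cover E L a f i (mup a (fibre_poly g (cusp_pt i))).
Proof.
move=> P0 ga [d1 d10 hd1]; have [h0 [h [h00 hloc]]] := local_form P0 ga.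
have ah0 : 0 < cabs h0 by rewrite cabs_gt0.
have [d2 d20 hd2] := hloc _ (divr_gt0 ah0 (ltr0Sn R 7)).
set e := mup _ _ in hd2 *.
have e0 : (0 < e)%N.
  by rewrite /e -XsubC_dvd // dvdp_XsubCl; apply/rvalue_atE.
(* As |h w| < 2 |h0|, the last two bounds make the cusp parameter smaller than 1, so f avoids 0 and
   1 and E is regular there. *)
pose r0 := Num.min (Num.min d1 d2) (Num.min 1 (cabs h0 * 2)^-1).
exists r0, h0, h; split=> //.
- by rewrite !lt_min d10 d20 ltr01 invr_gt0 mulr_gt0.
- move=> w; rewrite !lt_min => /andP[w0 /andP[/andP[w1 w2] _]].
  have [rg hh rE] := hd2 w (introT andP (conj w0 w2)).
  have [-> _ _] := hd1 w (introT andP (conj w0 w1)) rg.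
  by rewrite rE.
- move=> w; rewrite !lt_min => /andP[w0 /andP[/andP[w1 w2] _]].
  have [rg _ _] := hd2 w (introT andP (conj w0 w2)).
  by have [] := hd1 w (introT andP (conj w0 w1)) rg.
move=> w; rewrite !lt_min => /andP[w0 /andP[/andP[w1 w2] /andP[w3 w4]]].
have [rg hh rE] := hd2 w (introT andP (conj w0 w2)).
have [fE _ hp] := hd1 w (introT andP (conj w0 w1)) rg.
have ch : cabs (h w) < cabs h0 * 2 /\ 0 < cabs (h w).
  have := ler_cabsD (h w - h0) h0; rewrite subrK.
  have := ler_cabsD (h0 - h w) (h w); rewrite subrK (cabs_distC h0).
  by move: hh ah0; lra.
have u0 : (w - a) ^+ e * h w != 0.
  by rewrite mulf_neq0 ?expf_neq0 // -cabs_gt0 //; case: ch.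
have u1 : cabs ((w - a) ^+ e * h w) < 1.
  rewrite cabsM cabsX; have we : cabs (w - a) ^+ e <= cabs (w - a).
    by rewrite -[X in _ <= X]expr1; apply: ler_wiXn2l; rewrite ?cabs_ge0 // ltW.
  apply: (@le_lt_trans _ _ (cabs (w - a) * (cabs h0 * 2))).
    by apply: ler_pM; rewrite ?exprn_ge0 ?cabs_ge0 // ltW; case: ch.
  rewrite -ltr_pdivlMr ?mulr_gt0 // mul1r; exact: w4.
have [f0 f1] := cusp_loc_avoid i u0 u1.
by apply: hp; rewrite fE rE.
Qed.

Lemma cusp_cover_finite E phi a i : hypergeometric E -> (0 < rdeg phi)%N ->
  rvalue phi (pt a) = cusp_pt i ->
  cusp_cover E (pullback phi E) a (reval phi) i (ramif phi (pt a)).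
Proof.
move=> hE d0 va; rewrite (ramifE d0 va).
apply: cusp_cover_of => //; first exact: fibre_poly_neq0.
have [d dd0 hd] := poly_isolated a (rwr_neq0 d0); exists d => // w hw rg.
have [_ cD] := cder_reval rg; split=> //; first exact: cder_continuous cD.
move=> f0 f1; apply: pullback_pulls; last exact: hypergeometric_regular.
rewrite /unramified_at rg /=.
rewrite (cder_derive1 (cder_div rg (cder_horner _ w) (cder_horner _ w))).
by rewrite mulf_neq0 ?invr_neq0 ?expf_neq0 // -!hornerM -hornerN -hornerD hd.
Qed.

Lemma rv_frac_inv w : w != 0 -> rv (@frac_inv R) w w^-1.
Proof.
move=> w0; have := rv_tof 'X w; rewrite hornerX => h.
exact: rvV w0 h.
Qed.

Lemma frac_inv_near w : w != 0 ->
  [/\ reg frac_inv w, reval frac_inv w = w^-1 & unramified_at frac_inv w].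
Proof.
move=> w0; have [rg rE] := rv_reg (rv_frac_inv w0); split=> //.
rewrite /unramified_at rg /=.
have E : \forall t \near w, t^-1 = reval frac_inv t.
  have w0' : 0 < cabs w by rewrite cabs_gt0.
  apply: filterS (cder_continuous (cder_id w) w0') => t ht.
  have t0 : t != 0 by apply: contraTneq ht => ->; rewrite sub0r cabsN ltxx.
  by have [_ ->] := rv_reg (rv_frac_inv t0).
rewrite (cder_derive1 (cder_near E (cderV w0 (cder_id w)))).
by rewrite mulf_neq0 ?invr_neq0 ?expf_neq0 // oppr_eq0 oner_neq0.
Qed.

Lemma cusp_cover_infinity E phi i : hypergeometric E -> (0 < rdeg phi)%N ->
  rvalue phi infty = cusp_pt i ->
  cusp_cover E (pullback frac_inv (pullback phi E)) 0
    (fun w => reval phi (reval frac_inv w)) i (ramif phi infty).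
Proof.
move=> hE d0 va; pose g := rcomp phi frac_inv.
have va' : rvalue_at g 0 = cusp_pt i by exact: va.
have -> : ramif phi infty = mup 0 (fibre_poly g (cusp_pt i)).
  by rewrite /ramif /ramif_at -[rX^-1]/(@frac_inv R) -/g va'.
have P0 : fibre_poly g (cusp_pt i) != 0.
  have [k k0 ->] := fibre_poly_inv phi (cusp_pt i).
  rewrite scaler_eq0 negb_or k0 revp_neq0 ?fibre_poly_neq0 //.
  exact: fibre_poly_size.
apply: cusp_cover_of => //.
have W0 := rwr_neq0 d0.
(* Nonzero reversed polynomials have no zeros in a punctured disc around 0, so near infinity phi has
   neither finite poles nor finite ramification points. *)
have [d1 d10 hd1] := poly_isolated 0 (revp_neq0 W0 (leqnSn _)).
have [_ sd] := rdeg_size phi.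
have [d2 d20 hd2] := poly_isolated 0 (revp_neq0 (rden_neq0 phi) sd).
exists (Num.min d1 d2); first by rewrite lt_min d10 d20.
move=> w; rewrite lt_min => /andP[wp /andP[w1 w2]] rg.
have w0 : w != 0 by rewrite subr0 cabs_gt0 in wp.
have [ri iE ui] := frac_inv_near w0.
have rphi : reg phi w^-1.
  have := hd2 w (introT andP (conj wp w2)); rewrite horner_revp //.
  by rewrite mulf_eq0 negb_or => /andP[].
have gE : reval g w = reval phi w^-1.
  by have [_ ->] := rv_reg (rv_comp (rv_frac_inv w0) rphi).
have uphi : unramified_at phi w^-1.
  rewrite /unramified_at rphi /=.
  rewrite (cder_derive1 (cder_div rphi (cder_horner _ _) (cder_horner _ _))).
  rewrite mulf_neq0 ?invr_neq0 ?expf_neq0 // -!hornerM -hornerN -hornerD.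
  have := hd1 w (introT andP (conj wp w1)); rewrite horner_revp ?leqnSn //.
  by rewrite mulf_eq0 negb_or => /andP[].
have [_ ci] := cder_reval ri; have [_ cphi] := cder_reval rphi.
have c2 := cder_comp (f := reval phi) ci.
rewrite iE in c2.
split; first by rewrite iE gE.
  exact: cder_continuous (c2 _ cphi).
rewrite iE => f0 f1.
have rE := hypergeometric_regular hE f0 f1.
apply: pulls_comp.
  apply: pullback_pulls => //; rewrite iE; exact: pullback_regular.
by rewrite iE; exact: pullback_pulls.
Qed.

(** The identity is a cover of index 1. Through it the given local orders of E become orders of the
    matrices [cusp_mx]. *)
Lemma cusp_cover_self0 E i a : cusp_pt i = pt a -> a = (if i is cusp_1 then 1 else 0) ->
  cusp_cover E E a (fun w => w) i 1.
Proof.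
case: i => // -[<-] _; exists 1, 1, (fun=> 1); split=> //; rewrite ?oner_neq0 //.
- by move=> w _; rewrite subr0 expr1 mulr1 subrr cabs0 cabs1; split; [|lra].
- by move=> w _ e e0; exact: cder_continuous (cder_id w) e e0.
- by move=> w _ U Y oU fY Uw; exact: fund_on_at oU Uw fY.
- by move=> w _; rewrite expr1 mulr1 subrr cabs0 cabs1 /= addrC subrK; split; [|lra].
- by move=> w _ e e0; exact: cder_continuous (cder_id w) e e0.
- by move=> w _ U Y oU fY Uw; exact: fund_on_at oU Uw fY.
Qed.

Lemma cusp_cover_self_oo E : hypergeometric E ->
  cusp_cover E (pullback frac_inv E) 0 (reval frac_inv) cusp_oo 1.
Proof.
move=> hE; exists 1, 1, (fun=> 1).
have nz w : 0 < cabs (w - 0) -> w != 0 by rewrite subr0 cabs_gt0.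
split=> //; rewrite ?oner_neq0 //.
- move=> w /andP[/nz w0 _]; have [_ -> _] := frac_inv_near w0.
  by rewrite subr0 expr1 mulr1 subrr cabs0 cabs1; split; [|lra].
- move=> w /andP[/nz w0 _]; have [ri _ _] := frac_inv_near w0.
  have [_ ci] := cder_reval ri; exact: cder_continuous ci.
move=> w /andP[wp w1] U Y oU fY Uw; have w0 := nz w wp.
have [ri iE ui] := frac_inv_near w0.
apply: (pullback_pulls ui _ oU fY Uw); rewrite iE subr0 in w1 *.
by have [f0 f1] := cusp_loc_avoid cusp_oo w0 w1; exact: hypergeometric_regular.
Qed.

Lemma mxpowE A n : mxpow A n = A ^+ n.
Proof. by elim: n => [|n IH] //; rewrite exprS -IH. Qed.

Lemma order_conj D A (p : option nat) : D \in unitmx ->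
  projective_order (D *m A *m invmx D) p -> projective_order A p.
Proof.
move=> Du; have E n := scalar_power_conj A n Du.
case: p => [n [n0 h1 h2]|h k k0].
  split; [exact: n0|exact: etrans (esym (E n)) h1|move=> k kn].
  by apply: contra (h2 k kn) => hk; exact: etrans (E k) hk.
by apply: contra (h k k0) => hk; exact: etrans (E k) hk.
Qed.

Lemma nonscalar_power A (p : option nat) (e : nat) : A \in unitmx -> projective_order A p ->
  (0 < e)%N -> (if p is Some n then ~~ (n %| e)%N else true) -> ~~ is_scalar_mx (A ^+ e).
Proof.
move=> Au; case: p => [n [n0 sn hn]|h] e0 ne; last exact: h.
have r0 : (0 < e %% n < n)%N by rewrite ltn_mod n0 andbT lt0n.
by apply: contra (hn _ r0); exact: scalar_power_mod.
Qed.

Lemma fund_on_fundamental_system L U (Y : 'I_2 -> C -> C) z : opn U -> fund_on L U Y -> U z ->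
  fundamental_system L z Y.
Proof.
move=> oU fY Uz; split=> [i|c hc i].
  by apply: filterS (oU z Uz) => w; exact: fY.1.
apply: (fund_indep (c := c) (d := fun=> 0) oU fY Uz).
by apply: filterS hc => w ->; rewrite big1 // => j _; rewrite mul0r.
Qed.

(** Small circles stay in a disc carrying a fundamental system, along which the continuation is
    constant. *)
Lemma nonsingular_monodromy L a : ~ singular_at L a -> exists2 r1 : R, 0 < r1 &
  forall r, 0 < r < r1 -> exists2 y, fundamental_system L (circle a r 0) y &
    monodromy_matrix L (circle a r) y 1%:M.
Proof.
move=> ns; have ra : regular_at L a by rewrite /regular_at -negb_or; exact/negP.
have [e e0 he] := near_ball (opn_regular ra).
have [Y fY] := disc_fund e0 (he : forall w, cdisc a e w -> regular_at L w).
exists e => // r /andP[r0 re].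
have inD t : cdisc a e (circle a r t) by rewrite /cdisc /= circle_dist.
exists Y; first exact: fund_on_fundamental_system (@opn_cdisc R a e) fY (inD 0).
move=> i; exists (fun=> Y i); split.
- by apply: filterS (opn_cdisc (inD 0)).
- apply: filterS (opn_cdisc (inD 1)) => w _.
  exact/esym/(lcomb1 Y i w).
move=> t t01; split; last by near=> s => _; apply: filterS (opn_cdisc (inD s)).
by apply: filterS (opn_cdisc (inD t)) => w; exact: fY.1.
Unshelve. all: by end_near. Qed.

Section WithCharts.
Variables (E : lode R) (Y : chart5 -> 'I_2 -> C -> C) (P Q : 'M[C]_2).
Hypotheses (Pu : P \in unitmx) (Qu : Q \in unitmx).
Hypothesis fY : forall k, fund_on E (U5 k) (Y k).
Hypothesis tY : forall k l w, U5 k w -> U5 l w ->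
     forall i, Y k i w = lcomb (trans5 P Q k l) (Y l) i w.

Lemma cusp_mx_unit i : cusp_mx P Q i \in unitmx.
Proof. by case: i => /=; rewrite ?unitmx_mul ?unitmx_inv ?Pu ?Qu. Qed.

Lemma local_monodromy_cusp L a (f : C -> C) i e M : (0 < e)%N -> cusp_cover E L a f i e ->
  local_monodromy_at L a M ->
  exists2 D, D \in unitmx & M = D *m (cusp_mx P Q i) ^+ e *m invmx D.
Proof.
move=> e0 cc hM; have [r1 r10 h] := circle_monodromy Pu Qu e0 fY tY cc.
have [r [[y fy my] r0 rr]] : exists r : R, [/\ exists2 y,
    fundamental_system L (circle a r 0) y & monodromy_matrix L (circle a r) y M, 0 < r & r < r1].
  apply: (@filter_ex _ (0 : R)^'+); near=> r; split; near: r; first exact: hM.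
    exact: nbhs_right_gt.
  exact: nbhs_right_lt.
have [D Du ->] := h r y M (introT andP (conj r0 rr)) fy my.
exists D; first exact: Du.
congr (_ *m _ *m _); exact: mxpowE.
Unshelve. all: by end_near.
Qed.

Lemma cusp_order L a (f : C -> C) i (p : option nat) : cusp_cover E L a f i 1 ->
  (exists2 M, local_monodromy_at L a M & projective_order M p) ->
  projective_order (cusp_mx P Q i) p.
Proof.
move=> cc [M lM pM]; have [D Du ME] := local_monodromy_cusp (ltn0Sn 0) cc lM.
by rewrite ME expr1 in pM; exact: order_conj pM.
Qed.

(** Were the point regular, small circles would have identity monodromy; were its order 1, scalar
    monodromy. Both contradict that the monodromy is conjugate to the e-th power of [cusp_mx]. *)
Lemma cusp_cover_nonapparent L a (f : C -> C) i e : (0 < e)%N -> cusp_cover E L a f i e ->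
  ~~ is_scalar_mx ((cusp_mx P Q i) ^+ e) ->
  singular_at L a /\
  ~ (exists2 M, local_monodromy_at L a M & projective_order M (Some 1%N)).
Proof.
move=> e0 cc nsc; split.
  apply: contrapT => ns; have [r1 r10 h] := circle_monodromy Pu Qu e0 fY tY cc.
  have [r2 r20 h2] := nonsingular_monodromy ns.
  pose r := Num.min r1 r2 / 2.
  have m0 : 0 < Num.min r1 r2 by rewrite lt_min r10 r20.
  have r0 : 0 < r by rewrite divr_gt0.
  have rm : r < Num.min r1 r2 by rewrite /r; lra.
  move: rm; rewrite lt_min => /andP[rr1 rr2].
  have [y fy my] := h2 r (introT andP (conj r0 rr2)).
  have [D Du E1] := h r y _ (introT andP (conj r0 rr1)) fy my.
  move/negP: nsc; apply; rewrite -(scalar_conj _ Du) -mxpowE -E1.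
  exact: scalar_mx_is_scalar.
move=> [M lM [_ sM _]]; have [D Du ME] := local_monodromy_cusp e0 cc lM.
by move/negP: nsc; apply; rewrite -(scalar_conj _ Du) -ME -[M]expr1.
Qed.

Theorem pullback_nonapparent phi x i (p : option nat) : hypergeometric E -> (0 < rdeg phi)%N ->
  rvalue phi x = cusp_pt i -> (0 < ramif phi x)%N ->
  projective_order (cusp_mx P Q i) p ->
  (if p is Some n then ~~ (n %| ramif phi x)%N else true) ->
  non_apparent_singularities (pullback phi E) x.
Proof.
move=> hE d0 vx e0 oA ne.
have ns := nonscalar_power (cusp_mx_unit i) oA e0 ne.
case: x vx e0 ne ns => [a|] vx e0 ne ns.
  have [h1 h2] := cusp_cover_nonapparent e0 (cusp_cover_finite hE d0 vx) ns.
  by split=> // -[_].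
have [h1 h2] := cusp_cover_nonapparent e0 (cusp_cover_infinity hE d0 vx) ns.
by split=> // -[_].
Qed.

Theorem cusp_orders (p0 p1 poo : option nat) : hypergeometric E ->
  local_order E (pt 0) p0 -> local_order E (pt 1) p1 -> local_order E infty poo ->
  [/\ projective_order (cusp_mx P Q cusp_0) p0, projective_order (cusp_mx P Q cusp_1) p1
    & projective_order (cusp_mx P Q cusp_oo) poo].
Proof.
move=> hE h0 h1 hoo; split.
- exact: cusp_order (@cusp_cover_self0 E cusp_0 0 erefl erefl) h0.
- exact: cusp_order (@cusp_cover_self0 E cusp_1 1 erefl erefl) h1.
- exact: cusp_order (cusp_cover_self_oo hE) hoo.
Qed.

End WithCharts.

End CuspCovers.

(** * Elementary two-generator matrix groups *)

Section TraceIdentities.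
Variable K : fieldType.
Implicit Types (A B g N M : 'M[K]_2).

Lemma cayley2 A : A *m A = \tr A *: A - (\det A)%:M.
Proof.
apply/matrixP => i j; rewrite mul2E !mxE det2E trace2.
move: i j; do 2![apply: ord2P]; rewrite /= ?mulr1n ?mulr0n; ring.
Qed.

Lemma cayley2_polar A B :
  B *m A = - (A *m B) + \tr B *: A + \tr A *: B + (\tr (A *m B) - \tr A * \tr B)%:M.
Proof.
apply/matrixP => i j; rewrite !trace2 !mxE !sum2.
move: i j; do 2![apply: ord2P]; rewrite /= ?mulr1n ?mulr0n; ring.
Qed.

Definition coords : Type := (K * K * K * K)%type.

Definition ev4 A B (v : coords) : 'M[K]_2 :=
  let: (a, b, c, d) := v in a%:M + b *: A + c *: B + d *: (A *m B).

(* Right multiplication by A and B on combinations of 1, A, B, A B, for det A = det B = 1, where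
   x, y, z are the traces of A, B, A B. *)
Definition mulA4 (x y z : K) (v : coords) : coords :=
  let: (a, b, c, d) := v in
  (- b + (z - x * y) * c - y * d, a + x * b + y * c + z * d, x * c + d, - c).

Definition mulB4 (x y z : K) (v : coords) : coords :=
  let: (a, b, c, d) := v in (- c, - d, a + y * c, b + y * d).

Section Unimodular.
Variables A B : 'M[K]_2.
Hypotheses (dA : \det A = 1) (dB : \det B = 1).
Let x := \tr A.
Let y := \tr B.
Let z := \tr (A *m B).

Lemma sl2_AA : A *m A = x *: A - 1%:M.
Proof. by rewrite cayley2 dA. Qed.
Lemma sl2_BB : B *m B = y *: B - 1%:M.
Proof. by rewrite cayley2 dB. Qed.

Lemma sl2_ABA : A *m B *m A = B - y%:M + z *: A.
Proof.
rewrite -mulmxA (cayley2_polar A B) -/x -/y -/z !mulmxDr mulmxN mulmxA sl2_AA.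
rewrite mulmxBl mul1mx -!scalemxAr -scalemxAl sl2_AA mul_mx_scalar.
by apply/matrixP => i j; rewrite !mxE; case: (i == j); rewrite ?mulr1n ?mulr0n; ring.
Qed.

Lemma sl2_ABB : A *m B *m B = y *: (A *m B) - A.
Proof. by rewrite -mulmxA sl2_BB mulmxBr mulmx1 scalemxAr. Qed.

Lemma ev4_mulA v : ev4 A B v *m A = ev4 A B (mulA4 x y z v).
Proof.
case: v => [[[a b] c] d]; rewrite /ev4 /mulA4 !mulmxDl -!scalemxAl.
rewrite mul_scalar_mx sl2_AA sl2_ABA (cayley2_polar A B) -/x -/y -/z.
apply/matrixP => i j; rewrite !mxE !sum2.
by case: (i == j); rewrite ?mulr1n ?mulr0n; ring.
Qed.

Lemma ev4_mulB v : ev4 A B v *m B = ev4 A B (mulB4 x y z v).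
Proof.
case: v => [[[a b] c] d]; rewrite /ev4 /mulB4 !mulmxDl -!scalemxAl.
rewrite mul_scalar_mx sl2_BB sl2_ABB.
apply/matrixP => i j; rewrite !mxE !sum2.
by case: (i == j); rewrite ?mulr1n ?mulr0n; ring.
Qed.

Lemma sl2_inv : invmx A = x%:M - A.
Proof.
have Au : A \in unitmx by rewrite unitmxE dA unitr1.
rewrite -[LHS]mulmx1; apply/esym/(canRL (mulKmx Au)); rewrite mulmxBr mul_mx_scalar sl2_AA.
by rewrite opprB addrC subrK.
Qed.

End Unimodular.

(* Every linear form in the entries of g is g |-> tr (N g) for some N, so this is a witness that
   the group generated by A and B is not Zariski dense. *)
Definition covered A B : Prop := exists s : seq 'M[K]_2,
  (forall N, N \in s -> N != 0) /\
  forall g, gen2 A B g -> exists2 N, N \in s & \tr (N *m g) = 0.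

Lemma kill1 g : exists2 N : 'M[K]_2, N != 0 & \tr (N *m g) = 0.
Proof.
have trE i j : \tr (delta_mx i j *m g) = g j i.
  by rewrite trace2 !mul2E !mxE; move: i j; do 2![apply: ord2P];
    rewrite /= ?mul1r ?mul0r ?addr0 ?add0r.
have [g0|g0] := eqVneq (g ord0 ord0) 0.
  exists (delta_mx ord0 ord0); last by rewrite trE.
  by apply/eqP => /matrixP/(_ ord0 ord0); rewrite !mxE => /eqP; rewrite oner_eq0.
exists (g ord_max ord_max *: delta_mx ord0 ord0 - g ord0 ord0 *: delta_mx ord_max ord_max).
  apply/eqP => /matrixP/(_ ord_max ord_max); rewrite !mxE /= mulr0 mulr1 sub0r => /eqP.
  by rewrite oppr_eq0 (negPf g0).
by rewrite mulmxBl -!scalemxAl linearB !linearZ /= !trE mulrC subrr.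
Qed.

Lemma kill2 g h : exists2 N : 'M[K]_2, N != 0 & \tr (N *m g) = 0 /\ \tr (N *m h) = 0.
Proof.
pose G : 'M[K]_(4, 2) := \matrix_(k, l) (let m := if l == ord0 then g else h in
   m (inord (k %/ 2)) (inord (k %% 2))).
have : kermx G != 0.
  rewrite -mxrank_eq0 mxrank_ker -lt0n subn_gt0.
  exact: leq_ltn_trans (rank_leq_col G) _.
move=> /rowV0Pn[u /sub_kermxP uG u0].
pose o (k : nat) : 'I_4 := inord k.
have ur (k : 'I_4) : (k = o 0 \/ k = o 1) \/ (k = o 2 \/ k = o 3).
  case: k => [[|[|[|[|//]]]] hk]; [left; left|left; right|right; left|right; right];
  by apply: val_inj; rewrite /= inordK.
(* The kernel row is folded with the indices exchanged, because tr(N g) pairs the entry (i, j) of N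
   with the entry (j, i) of g. *)
exists (\matrix_(i, j) u 0 (o (j * 2 + i)%N)).
  apply: contra_neq u0 => E; apply/matrixP => i0 k; rewrite (ord1 i0) [RHS]mxE.
  have e (i j : 'I_2) : u 0 (o (j * 2 + i)%N) = 0 by have /matrixP/(_ i j) := E; rewrite !mxE.
  have [[->|->]|[->|->]] := ur k.
  - exact: (e ord0 ord0).
  - exact: (e ord_max ord0).
  - exact: (e ord0 ord_max).
  - exact: (e ord_max ord_max).
have key l : (u *m G) 0 l = 0 by rewrite uG mxE.
have q (k : nat) : (k < 4)%N -> (o k : nat) = k by move=> hk; rewrite /o inordK.
have I0 : inord 0 = ord0 :> 'I_2 by apply: val_inj; rewrite /= inordK.
have I1 : inord 1 = ord_max :> 'I_2 by apply: val_inj; rewrite /= inordK.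
have S4 (f : 'I_4 -> K) : \sum_k f k = f (o 0) + f (o 1) + f (o 2) + f (o 3).
  rewrite !big_ord_recl big_ord0 addr0 !addrA.
  by congr (f _ + f _ + f _ + f _); apply: val_inj; rewrite /= inordK.
split; [have := key ord0|have := key ord_max]; rewrite mxE S4 !mxE !q //= I0 I1 => E;
rewrite trace2 !mul2E !mxE /= -[RHS]E; ring.
Qed.

Lemma gen2_ind_closed A B (V : 'M[K]_2 -> Prop) : V 1%:M ->
  (forall g, V g -> [/\ V (g *m A), V (g *m invmx A), V (g *m B) & V (g *m invmx B)]) ->
  forall g, gen2 A B g -> V g.
Proof. by move=> V1 h g; elim=> // {}g _ /h[]. Qed.

Section Cases.
Variables A B : 'M[K]_2.
Hypotheses (dA : \det A = 1) (dB : \det B = 1).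
Let x := \tr A.
Let y := \tr B.
Let z := \tr (A *m B).

(** Induction over words by way of their coordinates. For the inverses, only some coordinate vector
    of the product is asked for, as 1, A, B, AB may be dependent. *)
Lemma gen2_ev4 (V : coords -> Prop) : V (1, 0, 0, 0) ->
  (forall v, V v -> [/\ V (mulA4 x y z v), V (mulB4 x y z v),
    exists2 w, V w & ev4 A B w = ev4 A B v *m invmx A
    & exists2 w, V w & ev4 A B w = ev4 A B v *m invmx B]) ->
  forall g, gen2 A B g -> exists2 v, V v & g = ev4 A B v.
Proof.
move=> V1 h; apply: gen2_ind_closed.
  by exists (1, 0, 0, 0); rewrite // /ev4 !scale0r !addr0.
move=> g [v Vv ->]; have [hA hB [w1 Vw1 E1] [w2 Vw2 E2]] := h v Vv; split.
- by exists (mulA4 x y z v); rewrite // ev4_mulA.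
- by exists w1.
- by exists (mulB4 x y z v); rewrite // ev4_mulB.
- by exists w2.
Qed.

Lemma gen2_span g : gen2 A B g -> exists v, g = ev4 A B v.
Proof.
move=> /(gen2_ev4 (V := fun=> True))[//||v _ ->]; last by exists v.
move=> [[[a b] c] d] _; split=> //.
  exists (x * a - (- b + (z - x * y) * c - y * d), x * b - (a + x * b + y * c + z * d),
    x * c - (x * c + d), x * d - (- c)) => //.
  rewrite (sl2_inv dA) mulmxBr mul_mx_scalar ev4_mulA // -/x -/y -/z /ev4 /mulA4.
  apply/matrixP => i j; rewrite !mxE.
  by case: (i == j); rewrite ?mulr1n ?mulr0n; ring.
exists (y * a - (- c), y * b - (- d), y * c - (a + y * c), y * d - (b + y * d)) => //.
rewrite (sl2_inv dB) mulmxBr mul_mx_scalar ev4_mulB // -/x -/y -/z /ev4 /mulB4.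
apply/matrixP => i j; rewrite !mxE.
by case: (i == j); rewrite ?mulr1n ?mulr0n; ring.
Qed.

(** Here A^2 = B^2 = -1, so multiplication by a generator exchanges the planes spanned by 1, AB and
    by A, B. One linear form kills each plane. *)
Lemma covered_dihedral : x = 0 -> y = 0 -> covered A B.
Proof.
move=> x0 y0; have [N1 N10 [k1 k2]] := kill2 1%:M (A *m B).
have [N2 N20 [l1 l2]] := kill2 A B.
exists [:: N1; N2]; split; first by move=> N; rewrite !inE => /orP[] /eqP ->.
have iA : invmx A = - A by rewrite (sl2_inv dA) -/x x0 raddf0 sub0r.
have iB : invmx B = - B by rewrite (sl2_inv dB) -/y y0 raddf0 sub0r.
pose V (v : coords) := let: (a, b, c, d) := v in (b = 0 /\ c = 0) \/ (a = 0 /\ d = 0).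
have neg v : ev4 A B (let: (a, b, c, d) := v in (- a, - b, - c, - d)) = - ev4 A B v.
  case: v => [[[a b] c] d]; rewrite /ev4; apply/matrixP => i j; rewrite !mxE.
  by case: (i == j); rewrite ?mulr1n ?mulr0n; ring.
move=> g /(gen2_ev4 (V := V))[||v Vv ->].
- by left.
- have clA v : V v -> V (mulA4 x y z v).
    case: v => [[[a b] c] d] /= [[-> ->]|[-> ->]]; rewrite x0 y0; [right|left]; split; ring.
  have clB v : V v -> V (mulB4 x y z v).
    case: v => [[[a b] c] d] /= [[-> ->]|[-> ->]]; rewrite y0; [right|left]; split; ring.
  have clN v : V v -> V (let: (a, b, c, d) := v in (- a, - b, - c, - d)).
    by case: v => [[[a b] c] d] /= [[-> ->]|[-> ->]]; [left|right]; rewrite oppr0.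
  move=> v Vv; split; [exact: clA|exact: clB| |].
    by eexists; [exact: clN (clA v Vv)|rewrite neg -ev4_mulA // iA mulmxN].
  by eexists; [exact: clN (clB v Vv)|rewrite neg -ev4_mulB // iB mulmxN].
move: v Vv => [[[a b] c] d] [[-> ->]|[-> ->]].
  exists N1; rewrite ?mem_head // /ev4 !scale0r !addr0 mulmxDr linearD /= -scalemxAr linearZ /= k2.
  by rewrite -[a%:M]scalemx1 -scalemxAr linearZ /= k1 !mulr0 addr0.
exists N2; rewrite ?inE ?eqxx ?orbT // /ev4 scale0r addr0 raddf0 add0r mulmxDr linearD /=.
by rewrite -!scalemxAr !linearZ /= l1 l2 !mulr0 addr0.
Qed.

(** The equation says that the commutator A B A^-1 B^-1 has trace 2. The form g |-> tr((AB - BA) g)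
    always kills 1, A and B, and its value at AB is the left-hand side of the equation, so it kills
    the whole span. *)
Lemma covered_reducible : ~~ is_scalar_mx A ->
  x ^+ 2 + y ^+ 2 + z ^+ 2 - x * y * z - 4 = 0 -> covered A B.
Proof.
move=> nA red; pose N := A *m B - B *m A.
have [N0|N0] := eqVneq N 0; last first.
  exists [:: N]; split; first by move=> M; rewrite inE => /eqP ->.
  move=> g /gen2_span[[[[a b] c] d] ->]; exists N; first exact: mem_head.
  have tC (X Y : 'M[K]_2) : \tr (X *m Y) = \tr (Y *m X) by exact: mxtrace_mulC.
  have t1 : \tr (N *m 1%:M) = 0 by rewrite mulmx1 linearB /= tC subrr.
  have tA : \tr (N *m A) = 0 by rewrite mulmxBl linearB /= -[A *m B *m A]mulmxA tC subrr.
  have tB : \tr (N *m B) = 0.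
    by rewrite mulmxBl linearB /= -[B *m A *m B]mulmxA [\tr (B *m _)]tC subrr.
  have tAB : \tr (N *m (A *m B)) = 0.
    have e1 : \tr (A *m B *m (A *m B)) = z ^+ 2 - 2.
      rewrite cayley2 det_mulmx dA dB mulr1 raddfB /= mxtraceZ mxtrace1 -/z; ring.
    have e2 : \tr (B *m A *m (A *m B)) = x * y * z - x ^+ 2 - y ^+ 2 + 2.
      rewrite -mulmxA tC [A *m (A *m B)]mulmxA -[A *m A *m B *m B]mulmxA.
      rewrite (sl2_AA dA) (sl2_BB dB) -/x -/y mulmxBl !mulmxBr mulmx1 mul1mx.
      rewrite -scalemxAl -scalemxAr mulmx1 !raddfB /= !mxtraceZ mxtrace1 -/x -/y -/z; ring.
    rewrite mulmxBl raddfB /= e1 e2 -[RHS]red; ring.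
  rewrite /ev4 -[a%:M]scalemx1 !mulmxDr !linearD /= -!scalemxAr !linearZ /=.
  by rewrite t1 tA tB tAB !mulr0 !addr0.
have AB : A *m B = B *m A by apply/eqP; rewrite -subr_eq0; apply/eqP.
have cg g : gen2 A B g -> g *m A = A *m g.
  move=> /gen2_span[[[[a b] c] d] ->]; rewrite /ev4 !mulmxDl !mulmxDr.
  rewrite -!scalemxAl -!scalemxAr mul_scalar_mx mul_mx_scalar.
  by rewrite -[A *m B *m A]mulmxA -AB.
(* If AB = BA, every word g commutes with A, and tr((AE - EA) g) = tr(E (gA - Ag)) = 0. A suitable E
   exists because A is not scalar. *)
have [E NE] : exists E : 'M[K]_2, A *m E - E *m A != 0.
  apply: contrapT => h; have {}h E : A *m E = E *m A.
    apply/eqP; rewrite -subr_eq0; apply/negPn/negP => hE; apply: h; by exists E.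
  move/negP: nA; apply; apply/is_scalar_mxP; exists (A ord0 ord0).
  have e01 := h (delta_mx ord0 ord_max); have e10 := h (delta_mx ord_max ord0).
  have /matrixP/(_ ord0 ord_max) := e01; have /matrixP/(_ ord0 ord0) := e01.
  have /matrixP/(_ ord_max ord_max) := e10.
  rewrite !mul2E !mxE /= !mulr0 !mul0r !mulr1 !mul1r !addr0 !add0r => a01 a10 a11.
  apply/matrixP => i j; rewrite mxE.
  by move: i j; do 2![apply: ord2P]; rewrite /= ?mulr1n ?mulr0n -?a01 -?a10 -?a11.
exists [:: A *m E - E *m A]; split; first by move=> M; rewrite inE => /eqP ->.
move=> g gg; eexists; first exact: mem_head.
rewrite mulmxBl linearB /= -[E *m A *m g]mulmxA -(cg g gg) mulmxA.
by rewrite -[A *m E *m g]mulmxA mxtrace_mulC subrr.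
Qed.

End Cases.

End TraceIdentities.

(** * Finite groups enumerated by exact computation *)

Section QuadraticIntegers.
Variables m k : int.
(* Traces in the finite cases are quadratic integers: (a, b) : quad stands for a + b t, where
   t^2 = m t + k. *)
Definition quad : Type := (int * int)%type.
Definition qadd (p q : quad) : quad := (p.1 + q.1, p.2 + q.2).
Definition qopp (p : quad) : quad := (- p.1, - p.2).
Definition qmul (p q : quad) : quad :=
  (p.1 * q.1 + k * (p.2 * q.2), p.1 * q.2 + p.2 * q.1 + m * (p.2 * q.2)).

Definition qcoords : Type := (quad * quad * quad * quad)%type.

Definition qmulA (x y z : quad) (v : qcoords) : qcoords :=
  let: (a, b, c, d) := v in
  (qadd (qopp b) (qadd (qmul (qadd z (qopp (qmul x y))) c) (qopp (qmul y d))),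
   qadd a (qadd (qmul x b) (qadd (qmul y c) (qmul z d))), qadd (qmul x c) d, qopp c).

Definition qmulB (y : quad) (v : qcoords) : qcoords :=
  let: (a, b, c, d) := v in (qopp c, qopp d, qadd a (qmul y c), qadd b (qmul y d)).

(* By Cayley-Hamilton, v A^-1 = x v - v A. *)
Definition qinv (x : quad) (v w : qcoords) : qcoords :=
  let: (a, b, c, d) := v in let: (a', b', c', d') := w in
  (qadd (qmul x a) (qopp a'), qadd (qmul x b) (qopp b'),
   qadd (qmul x c) (qopp c'), qadd (qmul x d) (qopp d')).

Definition qsteps (x y z : quad) (v : qcoords) : seq qcoords :=
  let va := qmulA x y z v in let vb := qmulB y v in
  [:: va; vb; qinv x v va; qinv y v vb].

Definition qone : qcoords := ((1, 0), (0, 0), (0, 0), (0, 0)).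

(** A search from the identity in n rounds. It needs no proof of termination, since [qclosed]
    certifies afterwards that the list is stable. *)
Definition qorbit (x y z : quad) (n : nat) : seq qcoords :=
  iter n (fun s => undup (s ++ flatten (map (qsteps x y z) s))) [:: qone].

Definition qclosed (x y z : quad) (s : seq qcoords) : bool :=
  (qone \in s) && all (fun v => all (mem s) (qsteps x y z v)) s.

Variables (K : fieldType) (t : K).
Hypothesis tt : t ^+ 2 = m%:~R * t + k%:~R.
Definition qval (p : quad) : K := p.1%:~R + p.2%:~R * t.
Definition qvals (v : qcoords) : coords K :=
  let: (a, b, c, d) := v in (qval a, qval b, qval c, qval d).

Lemma qval_add p q : qval (qadd p q) = qval p + qval q.
Proof. by rewrite /qval /= !rmorphD /=; ring. Qed.
Lemma qval_opp p : qval (qopp p) = - qval p.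
Proof. by rewrite /qval /= !rmorphN /=; ring. Qed.
Lemma qval_mul p q : qval (qmul p q) = qval p * qval q.
Proof.
rewrite /qval /qmul /= !(rmorphD, rmorphM) /=.
move: (p.1%:~R : K) (p.2%:~R : K) (q.1%:~R : K) (q.2%:~R : K) => a b c d.
transitivity (a * c + (a * d + b * c) * t + b * d * (m%:~R * t + k%:~R)); first by ring.
by rewrite -tt; ring.
Qed.

(** A stable finite list of coordinate vectors represents every word, and each listed matrix is
    killed by a form of its own from [kill1]. *)
Lemma finite_covered (x y z : quad) (A B : 'M[K]_2) (s : seq qcoords) :
  qclosed x y z s -> \det A = 1 -> \det B = 1 ->
  \tr A = qval x -> \tr B = qval y -> \tr (A *m B) = qval z -> covered A B.
Proof.
move=> /andP[s1 /allP sc] dA dB xE yE zE.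
have /choice[f fP] : forall v : qcoords, exists N : 'M[K]_2,
    N != 0 /\ \tr (N *m ev4 A B (qvals v)) = 0.
  by move=> v; have [N N0 NE] := kill1 (ev4 A B (qvals v)); exists N.
exists (map f s); split; first by move=> N /mapP[v _ ->]; have [] := fP v.
suff h g : gen2 A B g -> exists2 v, v \in s & g = ev4 A B (qvals v).
  by move=> g /h[v vs ->]; exists (f v); [exact: map_f|have [] := fP v].
have vA v : qvals (qmulA x y z v) = mulA4 (\tr A) (\tr B) (\tr (A *m B)) (qvals v).
  case: v => [[[a b] c] d]; rewrite /= !(qval_add, qval_opp, qval_mul) xE yE zE.
  by congr (_, _, _, _); ring.
have vB v : qvals (qmulB y v) = mulB4 (\tr A) (\tr B) (\tr (A *m B)) (qvals v).
  case: v => [[[a b] c] d]; rewrite /= !(qval_add, qval_opp, qval_mul) yE.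
  by congr (_, _, _, _); ring.
have vI u v w : ev4 A B (qvals (qinv u v w)) =
    qval u *: ev4 A B (qvals v) - ev4 A B (qvals w).
  case: v w => [[[a b] c] d] [[[a' b'] c'] d'].
  rewrite /= !(qval_add, qval_opp, qval_mul) /ev4; apply/matrixP => i j; rewrite !mxE.
  by case: (i == j); rewrite ?mulr1n ?mulr0n; ring.
move: g; apply: (gen2_ind_closed (V := fun g => exists2 v, v \in s & g = ev4 A B (qvals v))).
  exists qone => //; rewrite /ev4 /qvals /qone /qval /=.
  by rewrite !mulr0z mulr1z !mul0r !addr0 !scale0r !addr0.
move=> _ [v vs ->]; have /and5P[hA hB hAV hBV _] := sc v vs.
split.
- by exists (qmulA x y z v); rewrite // ev4_mulA // vA.
- exists (qinv x v (qmulA x y z v)) => //.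
  by rewrite vI vA -ev4_mulA // (sl2_inv dA) mulmxBr mul_mx_scalar xE.
- by exists (qmulB y v); rewrite // (ev4_mulB A) // vB.
- exists (qinv y v (qmulB y v)) => //.
  by rewrite vI vB -ev4_mulB // (sl2_inv dB) mulmxBr mul_mx_scalar yE.
Qed.

End QuadraticIntegers.

(** The four cases are the binary tetrahedral, octahedral and icosahedral groups, and the
    tetrahedral one again from generators with all three traces 1. The parameters encode t = 0, t^2
    = 2 and t^2 = t + 1, the trace of AB being 1, the square root of 2, and the golden ratio or its
    conjugate. *)
Lemma qclosed_233 : qclosed 0 0 (0, 0) (1, 0) (1, 0) (qorbit 0 0 (0, 0) (1, 0) (1, 0) 8).
Proof. by vm_cast_no_check (erefl true). Qed.
Lemma qclosed_234 : qclosed 0 2 (0, 0) (1, 0) (0, 1) (qorbit 0 2 (0, 0) (1, 0) (0, 1) 12).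
Proof. by vm_cast_no_check (erefl true). Qed.
Lemma qclosed_235 : qclosed 1 1 (0, 0) (1, 0) (0, 1) (qorbit 1 1 (0, 0) (1, 0) (0, 1) 16).
Proof. by vm_cast_no_check (erefl true). Qed.
Lemma qclosed_333 : qclosed 0 0 (1, 0) (1, 0) (1, 0) (qorbit 0 0 (1, 0) (1, 0) (1, 0) 8).
Proof. by vm_cast_no_check (erefl true). Qed.

(** * From projective orders to traces and covered groups *)

Section Orders.
Variable K : fieldType.
Implicit Types (A B g N : 'M[K]_2).

Definition order_mx A n : Prop := [/\ (0 < n)%N, is_scalar_mx (A ^+ n)
  & forall j, (0 < j < n)%N -> ~~ is_scalar_mx (A ^+ j)].

Lemma scalar_lin A (a b : K) : ~~ is_scalar_mx A -> is_scalar_mx (a *: A - b%:M) -> a = 0.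
Proof.
move=> nA /is_scalar_mxP[c cE]; apply: contraNeq nA => a0.
apply/is_scalar_mxP; exists (a^-1 * (c + b)).
rewrite scalar_mxM raddfD /= -cE subrK mul_scalar_mx scalerA mulVf // scale1r //.
Qed.

(** The Chebyshev recurrence for the coefficients of A^n on A and 1. *)
Lemma unimodular_power A : \det A = 1 -> forall n (a b : K),
  A ^+ n = a *: A - b%:M -> A ^+ n.+1 = (\tr A * a - b) *: A - a%:M.
Proof.
move=> dA n a b E; rewrite exprSr E -mulmxE mulmxBl -scalemxAl (sl2_AA dA) mul_scalar_mx.
by apply/matrixP => i j; rewrite !mxE; case: (i == j); rewrite ?mulr1n ?mulr0n; ring.
Qed.

(** A nonscalar A has scalar A^n only if the Chebyshev polynomial of its trace t vanishes: t, t^2 -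
    1, t (t^2 - 2), t^4 - 3 t^2 + 1 and t (t^2 - 1) (t^2 - 3) for n = 2, ..., 6. The factors
    belonging to smaller orders are then cancelled. *)
Lemma trace_of_order A : \det A = 1 ->
  [/\ order_mx A 2 -> \tr A = 0, order_mx A 3 -> \tr A ^+ 2 = 1,
      order_mx A 4 -> \tr A ^+ 2 = 2, order_mx A 5 -> \tr A ^+ 4 - 3 * \tr A ^+ 2 + 1 = 0
    & order_mx A 6 -> \tr A ^+ 2 = 3].
Proof.
move=> dA; set t := \tr A.
have nA n : order_mx A n -> (1 < n)%N -> ~~ is_scalar_mx A.
  by move=> [_ _ nN] n1; rewrite -[A]expr1 nN.
have P := unimodular_power dA; rewrite -/t in P.
have P2 : A ^+ 2 = t *: A - 1%:M by rewrite expr2 -mulmxE (sl2_AA dA).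
have P3 := P _ _ _ P2; have P4 := P _ _ _ P3; have P5 := P _ _ _ P4; have P6 := P _ _ _ P5.
have t2 n : order_mx A n -> (2 < n)%N -> t != 0.
  move=> [_ _ nN] /(nN 2%N); rewrite P2; apply: contraNneq => ->.
  by rewrite scale0r sub0r -raddfN scalar_mx_is_scalar.
have t3 n : order_mx A n -> (3 < n)%N -> t ^+ 2 != 1.
  move=> [_ _ nN] /(nN 3%N); rewrite P3; apply: contraNneq => t21.
  by rewrite -expr2 t21 subrr scale0r sub0r -raddfN scalar_mx_is_scalar.
split=> o; have {}nA := nA _ o isT; have [_ + _] := o.
- by rewrite P2 => /(scalar_lin nA).
- by rewrite P3 => /(scalar_lin nA) E; rewrite -[RHS]addr0 -E; ring.
- rewrite P4 => /(scalar_lin nA) E; apply: (mulfI (t2 _ o isT)).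
  by rewrite -[RHS]addr0 -E; ring.
- by rewrite P5 => /(scalar_lin nA) E; rewrite -[RHS]E; ring.
- rewrite P6 => /(scalar_lin nA) E.
  have h : t * (t ^+ 2 - 1) != 0 by rewrite mulf_neq0 ?(t2 _ o isT) // subr_eq0 (t3 _ o isT).
  by apply: (mulfI h); rewrite -[RHS]addr0 -E; ring.
Qed.

Lemma scalar_scale A (a : K) : a != 0 -> is_scalar_mx (a *: A) = is_scalar_mx A.
Proof.
move=> a0; have h (b : K) B : is_scalar_mx B -> is_scalar_mx (b *: B).
  by move=> /is_scalar_mxP[c ->]; rewrite scale_scalar_mx scalar_mx_is_scalar.
apply/idP/idP; last exact: h.
by move=> /(h a^-1); rewrite scalerA mulVf // scale1r.
Qed.

Lemma scale_mxX A (a : K) n : (a *: A) ^+ n = a ^+ n *: A ^+ n.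
Proof.
elim: n => [|n IH]; first by rewrite !expr0 scale1r.
by rewrite !exprS IH -!mulmxE -scalemxAl -scalemxAr scalerA.
Qed.

Lemma order_scale A (a : K) n : a != 0 -> order_mx A n -> order_mx (a *: A) n.
Proof.
move=> a0 [n0 h1 h2]; split=> // [|j hj]; rewrite scale_mxX scalar_scale ?expf_neq0 //.
exact: h2.
Qed.

Lemma gen2_scale A B (a b : K) g : a != 0 -> b != 0 -> A \in unitmx -> B \in unitmx ->
  gen2 A B g -> exists2 h, gen2 (a *: A) (b *: B) h & exists2 c : K, c != 0 & g = c *: h.
Proof.
move=> a0 b0 Au Bu.
have iV (c : K) M : c != 0 -> M \in unitmx -> invmx (c *: M) = c^-1 *: invmx M.
  by move=> c0 Mu; rewrite invmxZ // unitmxZ // unitfE.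
elim=> [|{}g _ [h hh [c c0 ->]]|{}g _ [h hh [c c0 ->]]|{}g _ [h hh [c c0 ->]]|{}g _ [h hh [c c0 ->]]].
- by exists 1%:M; [exact: gen2_1|exists 1; rewrite ?oner_neq0 // scale1r].
- exists (h *m (a *: A)); first exact: gen2_P.
  exists (c * a^-1); first by rewrite mulf_neq0 // invr_eq0.
  by rewrite -scalemxAr scalerA -mulrA mulVf // mulr1 scalemxAl.
- exists (h *m invmx (a *: A)); first exact: gen2_PV.
  exists (c * a); first by rewrite mulf_neq0.
  by rewrite iV // -scalemxAr scalerA -mulrA mulfV // mulr1 scalemxAl.
- exists (h *m (b *: B)); first exact: gen2_Q.
  exists (c * b^-1); first by rewrite mulf_neq0 // invr_eq0.
  by rewrite -scalemxAr scalerA -mulrA mulVf // mulr1 scalemxAl.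
- exists (h *m invmx (b *: B)); first exact: gen2_QV.
  exists (c * b); first by rewrite mulf_neq0.
  by rewrite iV // -scalemxAr scalerA -mulrA mulfV // mulr1 scalemxAl.
Qed.

Lemma covered_scale A B (a b : K) : a != 0 -> b != 0 -> A \in unitmx -> B \in unitmx ->
  covered (a *: A) (b *: B) -> covered A B.
Proof.
move=> a0 b0 Au Bu [s [s0 sc]]; exists s; split=> // g.
move=> /(gen2_scale a0 b0 Au Bu)[h /sc[N Ns NE] [c _ ->]].
by exists N; rewrite // -scalemxAr linearZ /= NE mulr0.
Qed.

Lemma order_invmx (M : 'M[K]_2) n : M \in unitmx -> order_mx M n -> order_mx (invmx M) n.
Proof.
move=> Mu; have h k : is_scalar_mx (invmx M ^+ k) = is_scalar_mx (M ^+ k).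
  have -> : invmx M ^+ k = invmx (M ^+ k) by exact: (exprVn (M : 'M[K]_2) k).
  have key (N : 'M[K]_2) : is_scalar_mx N -> is_scalar_mx (invmx N).
    by move=> /is_scalar_mxP[c ->]; rewrite invmx_scalar scalar_mx_is_scalar.
  by apply/idP/idP => [/key|/key]; rewrite ?invmxK.
by move=> [n0 h1 h2]; split=> // [|j /h2]; rewrite h.
Qed.

(* The triples p <= q <= r, other than (2, 2, r), with 1/p + 1/q + 1/r >= 1. *)
Definition elliptic_triple (p q r : nat) : bool :=
  [|| [&& p == 2, q == 3 & 2 < r < 7], [&& p == 2, q == 4 & r == 4]
    | [&& p == 3, q == 3 & r == 3]]%N.

(** Signs a and b normalize tr A and tr B. For (2, 3, r) with r = 3, 4, 5 this reaches an enumerated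
    group; (2, 3, 6) and (2, 4, 4) satisfy the reducibility equation. For (3, 3, 3) the product of
    the three traces is 1, a finite group, or -1, a reducible one. *)
Lemma covered_elliptic1 A B (p q r : nat) : \det A = 1 -> \det B = 1 ->
  order_mx A p -> order_mx B q -> order_mx (A *m B) r -> elliptic_triple p q r ->
  covered A B.
Proof.
move=> dA dB oA oB oAB el.
have dAB : \det (A *m B) = 1 by rewrite det_mulmx dA dB mulr1.
have Au : A \in unitmx by rewrite unitmxE dA unitr1.
have Bu : B \in unitmx by rewrite unitmxE dB unitr1.
have nA : ~~ is_scalar_mx A.
  by have [_ _ h] := oA; rewrite -[A]expr1 h //; move: el; rewrite /elliptic_triple; lia.
have [A2 A3 _ _ _] := trace_of_order dA; have [_ B3 B4 _ _] := trace_of_order dB.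
have [_ C3 C4 C5 C6] := trace_of_order dAB.
have red : \tr A ^+ 2 + \tr B ^+ 2 + \tr (A *m B) ^+ 2 - \tr A * \tr B * \tr (A *m B) - 4 = 0 ->
  covered A B by exact: covered_reducible.
have fin m k t x y z s : t ^+ 2 = m%:~R * t + k%:~R -> qclosed m k x y z s ->
    (exists2 a, a ^+ 2 = 1 & exists2 b, b ^+ 2 = 1 &
    [/\ a * \tr A = qval t x, b * \tr B = qval t y & a * b * \tr (A *m B) = qval t z]) ->
    covered A B.
  move=> tt cl [a a2 [b b2 [hx hy hz]]].
  have nz (c : K) : c ^+ 2 = 1 -> c != 0.
    by move=> c2; apply/eqP => c0; move/eqP: c2; rewrite c0 expr0n /= eq_sym oner_eq0.
  apply: (covered_scale (nz _ a2) (nz _ b2) Au Bu).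
  apply: (finite_covered tt cl); rewrite ?detZ ?dA ?dB ?mulr1 ?mxtraceZ //.
  by rewrite -scalemxAl -scalemxAr scalerA mxtraceZ.
have v0 (t : K) : qval t (0, 0) = 0 by rewrite /qval mulr0z mul0r addr0.
have v1 (t : K) : qval t (1, 0) = 1 by rewrite /qval mulr0z mul0r addr0.
have vt (t : K) : qval t (0, 1) = t by rewrite /qval mulr0z mul1r add0r.
have t00 : (0 : K) ^+ 2 = 0%:~R * 0 + 0%:~R by rewrite mulr0z mul0r addr0 expr0n.
have one2 : (1 : K) ^+ 2 = 1 by rewrite expr1n.
move: el; rewrite /elliptic_triple.
case/or3P => [/and3P[/eqP p2 /eqP q3 r36]|/and3P[/eqP p2 /eqP q4 /eqP r4]
  |/and3P[/eqP p3 /eqP q3 /eqP r3]]; subst p q.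
- have {A2}A0 := A2 oA; have {B3}b2 := B3 oB; set b := \tr B in b2 *.
  have bb : b * b = 1 by rewrite -expr2.
  set z := \tr (A *m B) in C3 C4 C5 C6 red *.
  have [r3|r4|r5|r6] : [\/ r = 3%N, r = 4%N, r = 5%N | r = 6%N].
    by move: r36 => /andP[]; case: r {oAB} => [|[|[|[|[|[|[|r]]]]]]] // _ _; constructor.
  + subst r; apply: (fin _ _ _ _ _ _ _ t00 qclosed_233); exists (b * z).
      by rewrite exprMn b2 C3 ?mulr1.
    exists b => //; rewrite !v0 !v1 A0 mulr0 bb; split=> //.
    by rewrite -[RHS](C3 oAB); transitivity (b ^+ 2 * z ^+ 2); [ring|rewrite b2 mul1r].
  + subst r; have t2 : (b * z) ^+ 2 = 0%:~R * (b * z) + 2%:~R.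
      by rewrite exprMn b2 mul1r C4 // mulr0z mul0r add0r.
    apply: (fin _ _ _ _ _ _ _ t2 qclosed_234); exists 1 => //; exists b => //.
    by rewrite v0 v1 vt A0 mulr0 bb mul1r.
  (* The polynomial s^4 - 3 s^2 + 1 factors as (s^2 - s - 1) (s^2 + s - 1). Changing the sign of A,
     of trace 0, selects the first factor. *)
  + subst r; have [a a2 aE] : exists2 a, a ^+ 2 = 1 & (a * b * z) ^+ 2 = a * b * z + 1.
      have /eqP : ((b * z) ^+ 2 - b * z - 1) * ((b * z) ^+ 2 + b * z - 1) = 0.
        rewrite -[RHS](C5 _) //.
        transitivity ((b ^+ 2) ^+ 2 * z ^+ 4 - 3 * (b ^+ 2 * z ^+ 2) + 1); first by ring.
        by rewrite b2 expr1n !mul1r.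
      rewrite mulf_eq0 => /orP[] /eqP h; [exists 1|exists (-1)]; rewrite ?expr1n ?sqrrN ?expr1n //.
        by apply/eqP; rewrite -subr_eq0; apply/eqP; rewrite -[RHS]h; ring.
      by apply/eqP; rewrite -subr_eq0; apply/eqP; rewrite -[RHS]h; ring.
    have t2 : (a * b * z) ^+ 2 = 1%:~R * (a * b * z) + 1%:~R by rewrite mul1r.
    apply: (fin _ _ _ _ _ _ _ t2 qclosed_235); exists a => //; exists b => //.
    by rewrite v0 v1 vt A0 mulr0 bb.
  + subst r; apply: red; rewrite A0 b2 C6 //; ring.
- subst r; apply: red; rewrite (A2 oA) (B4 oB) C4 //; ring.
- subst r; have {A3}a2 := A3 oA; have {B3}b2 := B3 oB.
  have z2 : \tr (A *m B) ^+ 2 = 1 by rewrite C3.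
  set a := \tr A in a2 red *; set b := \tr B in b2 red *; set z := \tr (A *m B) in z2 red *.
  have : (a * b * z) ^+ 2 = 1 by rewrite !exprMn a2 b2 z2 !mulr1.
  move/eqP; rewrite sqrf_eq1 => /orP[] /eqP h.
    apply: (fin _ _ _ _ _ _ _ t00 qclosed_333); exists a => //; exists b => //.
    by rewrite !v1 -!expr2 h.
  by apply: red; rewrite a2 b2 z2 h; ring.
Qed.

Lemma covered_22 A B : \det A = 1 -> \det B = 1 -> order_mx A 2 -> order_mx B 2 -> covered A B.
Proof.
move=> dA dB oA oB; apply: covered_dihedral => //.
  by have [h _ _ _ _] := trace_of_order dA; exact: h.
by have [h _ _ _ _] := trace_of_order dB; exact: h.
Qed.

Lemma covered_elliptic A B (a b : K) (p q : nat) (r : option nat) :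
  A \in unitmx -> B \in unitmx -> a ^+ 2 * \det A = 1 -> b ^+ 2 * \det B = 1 ->
  order_mx A p -> order_mx B q -> (if r is Some n then order_mx (A *m B) n else True) ->
  (p == 2%N) && (q == 2%N) || (if r is Some n then elliptic_triple p q n else false) ->
  covered A B.
Proof.
move=> Au Bu da db oA oB oAB.
have nz (c e : K) : c ^+ 2 * e = 1 -> c != 0.
  by move=> c2; apply/eqP => c0; move/eqP: c2; rewrite c0 expr0n mul0r /= eq_sym oner_eq0.
have a0 := nz _ _ da; have b0 := nz _ _ db.
have d1 : \det (a *: A) = 1 by rewrite detZ.
have d2 : \det (b *: B) = 1 by rewrite detZ.
case/orP => [/andP[/eqP p2 /eqP q2]|el]; apply: (covered_scale a0 b0 Au Bu).
  by subst p q; apply: covered_22 => //; exact: order_scale.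
move: r oAB el => [r|//] oAB.
apply: (covered_elliptic1 d1 d2 (order_scale a0 oA) (order_scale b0 oB)).
rewrite -scalemxAl -scalemxAr scalerA; apply: order_scale => //.
exact: mulf_neq0.
Qed.

End Orders.

(** * Products of linear forms as homogeneous polynomials *)

Section LinearForms.
Variable K : numFieldType.
Implicit Types (N M : 'M[K]_2).

Definition trace_form N : mpoly (2 * 2) K :=
  \sum_(k < 2 * 2) mxvec N^T 0 k *: mpolyX K (mnm1 k).

Lemma trace_formE N M : meval (fun k => mxvec M 0 k) (trace_form N) = \tr (N *m M).
Proof.
rewrite /trace_form raddf_sum /=.
under eq_bigr do rewrite mevalZ mevalXU.
rewrite (reindex _ (curry_mxvec_bij _ _)) /=.
transitivity (\sum_(p : 'I_2 * 'I_2) N p.2 p.1 * M p.1 p.2).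
  by apply: eq_bigr => -[i j] _; rewrite /= !mxvecE mxE.
rewrite -(pair_bigA _ (fun i j => N j i * M i j)) exchange_big /=.
by apply: eq_bigr => i _; rewrite mxE.
Qed.

Lemma trace_form_homog N : trace_form N \is ishomog1 1 (@mdeg (2 * 2)).
Proof. by apply: rpred_sum => k _; apply: rpredZ; rewrite dhomogX; apply/eqP/mdeg1. Qed.

Lemma poly_nonroot (p : {poly K}) : p != 0 -> exists x, p.[x] != 0.
Proof.
move=> p0; apply: contrapT => h.
suff : (size [seq (i%:R : K) | i <- iota 0 (size p)] < size p)%N.
  by rewrite size_map size_iota ltnn.
apply: (max_poly_roots p0).
  apply/allP => x _; apply/negPn/negP => px; apply: h; exists x.
  by apply: contraNneq px => px; apply/rootP.
by rewrite map_inj_uniq ?iota_uniq //; exact: (mulrIn (oner_neq0 _)).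
Qed.

(* On the curve of matrices [1, t; t^2, t^4] every nonzero linear form is a nonzero polynomial
   in t. *)
Lemma forms_avoid (s : seq 'M[K]_2) : (forall N, N \in s -> N != 0) ->
  exists2 M : 'M[K]_2, M \in unitmx & forall N, N \in s -> \tr (N *m M) != 0.
Proof.
move=> s0.
pose q N : {poly K} := (N ord0 ord0)%:P +
  (N ord0 ord_max)%:P * 'X^2 + (N ord_max ord0)%:P * 'X + (N ord_max ord_max)%:P * 'X^4.
have q0 N : N != 0 -> q N != 0.
  apply: contra_neq => E; apply/matrixP => i j; rewrite [RHS]mxE.
  have e k : (q N)`_k = 0 by rewrite E coef0.
  have := e 0%N; have := e 1%N; have := e 2%N; have := e 4%N.
  rewrite /q !coefD !coefCM !coefXn !coefC !coefX /=.
  rewrite !mulr0 !mulr1 !addr0 !add0r => e4 e2 e1 e0.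
  by move: i j; do 2![apply: ord2P].
(* The last factor is the determinant t^4 - t^3 on the curve, included so that the chosen matrix is
   invertible. *)
have P0 : \prod_(N <- s) q N * ('X^4 - 'X^3) != 0.
  rewrite mulf_neq0 ?prodf_seq_neq0 //.
    by apply/allP => N /s0/q0.
  by apply/eqP => /polyP/(_ 4%N); rewrite coefB !coefXn coef0 /= subr0 => /eqP; rewrite oner_eq0.
have [t] := poly_nonroot P0; rewrite hornerM mulf_eq0 negb_or => /andP[tq td].
pose M : 'M[K]_2 := \matrix_(i, j)
  (if i == ord0 then (if j == ord0 then 1 else t) else (if j == ord0 then t ^+ 2 else t ^+ 4)).
exists M.
  rewrite unitmxE unitfE det2E !mxE /=.
  apply: contra_neq td => td; rewrite !hornerE -[RHS]td; ring.
move=> N Ns; have := tq; rewrite horner_prod prodf_seq_neq0 => /allP/(_ N Ns) /=.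
apply: contra_neq => tN; rewrite -[RHS]tN trace2 !mul2E !mxE /= /q.
by rewrite !(hornerD, hornerM, hornerC, hornerXn, hornerX); ring.
Qed.

Lemma product_form (s : seq 'M[K]_2) : (forall N, N \in s -> N != 0) ->
  exists n (f : mpoly (2 * 2) K), [/\ f \is ishomog1 n (@mdeg (2 * 2)),
    (forall M N, N \in s -> \tr (N *m M) = 0 -> meval (fun k => mxvec M 0 k) f = 0)
    & exists2 M : 'M[K]_2, M \in unitmx & meval (fun k => mxvec M 0 k) f != 0].
Proof.
move=> s0; exists (size s), (\prod_(N <- s) trace_form N); split.
- elim: s {s0} => [|N s IH]; first by rewrite big_nil dhomog1.
  by rewrite big_cons; apply: (dhomogM (trace_form_homog N) IH).
- move=> M N Ns tN; rewrite rmorph_prod /=; apply/eqP; rewrite prodf_seq_eq0.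
  by apply/hasP; exists N => //=; rewrite trace_formE tN.
have [M Mu h] := forms_avoid s0; exists M => //; rewrite rmorph_prod prodf_seq_neq0.
by apply/allP => N Ns /=; rewrite trace_formE h.
Qed.

End LinearForms.

(** * Zariski density excludes the elementary orders *)

Section Density.
Context {R : realType}.
Local Notation C := (Cplx R).
Implicit Types (P Q D M g : 'M[C]_2) (E : lode R).

Lemma gen2_invmxl P Q g : gen2 P Q g -> gen2 (invmx P) Q g.
Proof.
elim=> [|h _ hh|h _ hh|h _ hh|h _ hh]; first exact: gen2_1.
- by rewrite -{2}[P]invmxK; exact: gen2_PV.
- exact: gen2_P.
- exact: gen2_Q.
- exact: gen2_QV.
Qed.

(** The trace of (D N D^-1) (D g D^-1) is that of N g, so conjugating the forms adapts them to the
    conjugated group; their product contradicts density at an invertible matrix. *)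
Lemma covered_not_dense P Q D (G : set 'M[C]_2) : D \in unitmx -> covered (invmx P) Q ->
  (forall M, G M -> exists2 g, gen2 P Q g & M = D *m g *m invmx D) -> ~ zariski_dense_PGL2 G.
Proof.
move=> Du [s [s0 sc]] GE dense.
have [|n [f [fh fz [M Mu Mf]]]] := product_form (s := [seq D *m N *m invmx D | N <- s]).
  move=> _ /mapP[N /s0 N0 ->]; apply: contra_neq N0 => e.
  have /= := congr1 (fun X => invmx D *m X *m D) e.
  by rewrite mulmx0 mul0mx -!mulmxA mulVmx // mulmx1 mulKmx.
move/eqP: Mf; apply; apply: dense fh _ M Mu => M' /GE[g /gen2_invmxl/sc[N Ns NE] ->].
apply: (fz _ (D *m N *m invmx D)); first exact: map_f.
by rewrite -!mulmxA mulKmx // mxtrace_mulC -!mulmxA mulVmx // mulmx1.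
Qed.

Lemma sqrt_det M : M \in unitmx -> exists a : C, a ^+ 2 * \det M = 1.
Proof.
rewrite unitmxE unitfE => d0; exists (sqrtC (\det M)^-1).
by rewrite sqrtCK mulVf.
Qed.

(** For orders sorted and at least 2, this says 1/p0 + 1/p1 + 1/poo >= 1; an infinite order then
    occurs only in (2, 2, oo). *)
Definition elementary_orders (p0 p1 poo : option nat) : bool :=
  if (p0, p1) is (Some p, Some q) then
    (p == 2%N) && (q == 2%N) || (if poo is Some n then elliptic_triple p q n else false)
  else false.

Lemma nonelementary_orders E p0 p1 poo : hypergeometric E -> nonelementary E ->
  local_order E (pt 0) p0 -> local_order E (pt 1) p1 -> local_order E infty poo ->
  elementary_orders p0 p1 poo = false.
Proof.
move=> hE [z [y [zE fy dense]]] o0 o1 o2; apply/negP => el.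
have [Y [P [Q [Pu Qu fY tY]]]] := charts5 hE.
have [D Du DE] := monodromy_in_gen hE fY tY zE fy.
have [k0 k1 k2] := cusp_orders Pu Qu fY tY hE o0 o1 o2.
apply: (covered_not_dense Du _ DE dense).
have [a aE] := sqrt_det (cusp_mx_unit Pu Qu cusp_0).
have [b bE] := sqrt_det Qu.
move: el k0 k1 k2 {o0 o1 o2}; rewrite /elementary_orders.
case: p0 => [p|//]; case: p1 => [q|//] el k0 k1 k2.
apply: (covered_elliptic (a := a) (b := b) (r := poo) _ Qu aE bE k0 k1 _ el).
  exact: (cusp_mx_unit Pu Qu cusp_0).
case: poo k2 el => [n|//] k2 _.
have -> : invmx P *m Q = invmx (cusp_mx P Q cusp_oo).
  have Ru := cusp_mx_unit Pu Qu cusp_oo.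
  rewrite -[LHS]mulmx1 -(mulmxV Ru) mulmxA -{2}[cusp_mx P Q cusp_oo]/(invmx Q *m P).
  by rewrite -[invmx P *m Q *m _]mulmxA mulKVmx // mulVmx // mul1mx.
exact: (order_invmx (cusp_mx_unit Pu Qu cusp_oo) k2).
Qed.

End Density.

(** * Counting points in the fibres *)

Definition ndvd (p : option nat) (e : nat) : bool := if p is Some n then ~~ (n %| e)%N else true.

Lemma sumn_min p s : all (leq p) s -> (p * size s <= sumn s)%N.
Proof.
elim: s => [|e s IH] /=; first by rewrite muln0.
by move=> /andP[h /IH h']; rewrite mulnS leq_add.
Qed.

Lemma sumn_nseq_min p s : all (leq p) s -> (sumn s <= p * size s)%N -> s = nseq (size s) p.
Proof.
elim: s => //= e s IH /andP[pe ps]; rewrite mulnS => le.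
have ge := sumn_min ps.
have -> : e = p by lia.
by congr (_ :: _); apply: IH => //; lia.
Qed.

Lemma sumn_excess_one s : all (leq 1) s -> sumn s = (size s).+1 ->
  perm_eq s (2%N :: nseq (size s).-1 1%N).
Proof.
elim: s => //= e s IH /andP[e1 s1] se; have ge := sumn_min s1.
have [E|E] : e = 1%N \/ e = 2%N by lia.
  have {}IH : perm_eq s (2%N :: nseq (size s).-1 1%N) by apply: IH => //; lia.
  case: s se s1 ge IH => [|x s] se s1 ge IH; first by rewrite /= in se; lia.
  rewrite E (perm_trans (y := 1%N :: 2%N :: nseq (size (x :: s)).-1 1%N)) ?perm_cons //.
  exact: permEl (perm_catCA [:: 1%N] [:: 2%N] _).
by rewrite E {1}(sumn_nseq_min s1); [|lia].
Qed.

(** The multiples of p are bounded below by every n <= p instead of by p, which covers lower bounds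
    on an unknown order and also p infinite, where u is empty. *)
Lemma fibre_split p s : all (leq 1) s -> let u := [seq e <- s | ~~ ndvd p e] in
  let v := [seq e <- s | ndvd p e] in
  [/\ perm_eq s (u ++ v), size s = (size u + size v)%N, sumn s = (sumn u + sumn v)%N,
      all (leq 1) v & forall n, le_oo (Some n) p -> all (leq n) u].
Proof.
move=> s1 u v; have pm : perm_eq s (u ++ v) by rewrite perm_sym perm_catC perm_filterC.
split=> //.
- by rewrite (perm_size pm) size_cat.
- by rewrite -sumn_cat; apply: perm_sumn.
- by apply/allP => e; rewrite mem_filter => /andP[_ /(allP s1)].
move=> n np; apply/allP => e; rewrite mem_filter => /andP[+ /(allP s1) /= e1].
case: p np @u @v pm => [m|//] nm _ _ _; rewrite /= negbK => /(dvdn_leq e1).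
exact: leq_trans.
Qed.

(** The total does not exceed the sum of the lower bounds, so every entry equals its bound. *)
Lemma perm_nseq2 (s u v : seq nat) p q : perm_eq s (u ++ v) -> all (leq p) u -> all (leq q) v ->
  (sumn u + sumn v <= p * size u + q * size v)%N -> perm_eq s (nseq (size u) p ++ nseq (size v) q).
Proof.
move=> su up vq le; have gu := sumn_min up; have gv := sumn_min vq.
by rewrite -(sumn_nseq_min up) -?(sumn_nseq_min vq) //; lia.
Qed.

(** A sorted hyperbolic triple is (2, 3, r) with r >= 7, or dominates (2, 4, 5) or (3, 3, 4)
    entrywise. *)
Lemma hyperbolic_orders p0 p1 poo :
  le_oo (Some 2%N) p0 -> le_oo p0 p1 -> le_oo p1 poo -> elementary_orders p0 p1 poo = false ->
  [\/ [/\ p0 = Some 2%N, p1 = Some 3%N & le_oo (Some 7%N) poo],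
      le_oo (Some 4%N) p1 && le_oo (Some 5%N) poo
    | [&& le_oo (Some 3%N) p0, le_oo (Some 3%N) p1 & le_oo (Some 4%N) poo]].
Proof.
rewrite /elementary_orders /elliptic_triple.
case: p0 p1 poo => [m|] [n|] [r|] //= h0 h1 h2 h; try by (constructor 3; lia).
- have [[? ?]|[h'|h']] : (m = 2 /\ n = 3 \/ (4 <= n /\ 5 <= r \/ 3 <= m /\ 4 <= r))%N by lia.
  + by subst; constructor 1; split=> //; lia.
  + by constructor 2; lia.
  + by constructor 3; lia.
- have [[? ?]|[h'|h']] : (m = 2 /\ n = 3 \/ (4 <= n \/ 3 <= m))%N by lia.
  + by subst; constructor 1.
  + by constructor 2; lia.
  + by constructor 3; lia.
- by constructor 2.
Qed.

(* Riemann-Hurwitz, in the form d (1 - 1/p0 - 1/p1 - 1/poo) + 4 <= sum of the a_i (1 - 1/p_i). *)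
Lemma no_large_orders d b0 a0 b1 a1 b2 a2 :
  (0 < d -> d + 4 <= (b0 + a0) + (b1 + a1) + (b2 + a2) -> a0 + a1 + a2 <= 5 ->
  (2 * b0 + a0 <= d /\ 4 * b1 + a1 <= d /\ 5 * b2 + a2 <= d) \/
  (3 * b0 + a0 <= d /\ 3 * b1 + a1 <= d /\ 4 * b2 + a2 <= d) -> False)%N.
Proof. lia. Qed.

(** For (2, 3, 7) the count reads d/42 + 4 <= a0/2 + 2 a1/3 + 6 a2/7. With a0 + a1 + a2 <= 5 the
    right-hand side is at most 30/7, hence d <= 12, and it falls below 4 unless a2 >= 4. If a2 = 5,
    integrality of the fibres over 0 and 1 leaves d = 6 and d = 12. *)
Lemma small_orders d b0 a0 b1 a1 b2 a2 :
  (0 < d -> d + 4 <= (b0 + a0) + (b1 + a1) + (b2 + a2) -> a0 + a1 + a2 <= 5 ->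
  2 * b0 + a0 <= d -> 3 * b1 + a1 <= d -> 7 * b2 + a2 <= d ->
  [\/ [/\ d = 4, a0 = 0, a1 = 1 & a2 = 4] /\ [/\ b0 = 2, b1 = 1 & b2 = 0],
      [/\ d = 6, a0 = 0, a1 = 0 & a2 = 5] /\ [/\ b0 = 3, b1 = 2 & b2 = 0]
    | [/\ d = 12, a0 = 0, a1 = 0 & a2 = 5] /\ [/\ b0 = 6, b1 = 4 & b2 = 1]])%N.
Proof.
move=> d0 rh a5 h0 h1 h2.
have d12 : (d <= 12)%N by lia.
have [a24|a25] : a2 = 4%N \/ a2 = 5%N by lia.
  by constructor 1; split; split; lia.
have [d6|d12'] : d = 6%N \/ d = 12%N by lia.
  by constructor 2; split; split; lia.
by constructor 3; split; split; lia.
Qed.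

Lemma fibre_types p0 p1 poo d s0 s1 soo :
  le_oo (Some 2%N) p0 -> le_oo p0 p1 -> le_oo p1 poo -> elementary_orders p0 p1 poo = false ->
  (0 < d)%N -> all (leq 1) s0 -> all (leq 1) s1 -> all (leq 1) soo ->
  sumn s0 = d -> sumn s1 = d -> sumn soo = d ->
  (d + 4 <= size s0 + size s1 + size soo)%N ->
  (count (ndvd p0) s0 + count (ndvd p1) s1 + count (ndvd poo) soo <= 5)%N ->
  [/\ p0 = Some 2%N, p1 = Some 3%N & le_oo (Some 7%N) poo] /\
  [\/ [/\ d = 4%N, perm_eq s0 [:: 2; 2]%N, perm_eq s1 [:: 3; 1]%N & perm_eq soo [:: 1; 1; 1; 1]%N],
      [/\ d = 6%N, perm_eq s0 [:: 2; 2; 2]%N, perm_eq s1 [:: 3; 3]%N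
        & perm_eq soo [:: 2; 1; 1; 1; 1]%N]
    | [/\ poo = Some 7%N, d = 12%N, perm_eq s0 [:: 2; 2; 2; 2; 2; 2]%N,
        perm_eq s1 [:: 3; 3; 3; 3]%N & perm_eq soo [:: 7; 1; 1; 1; 1; 1]%N]].
Proof.
move=> h0 h1 h2 hyp d0 l0 l1 loo e0 e1 e2 rh; rewrite -!size_filter.
have [q0 n0 m0 v0 u0] := fibre_split p0 l0.
have [q1 n1 m1 v1 u1] := fibre_split p1 l1.
have [q2 n2 m2 v2 u2] := fibre_split poo loo.
rewrite n0 n1 n2 in rh; move: e0 e1 e2; rewrite m0 m1 m2.
move: q0 q1 q2 rh v0 v1 v2 u0 u1 u2 {n0 n1 n2 m0 m1 m2 l0 l1 loo}.
move: [seq _ <- s0 | _] [seq _ <- s0 | _] [seq _ <- s1 | _] [seq _ <- s1 | _]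
  [seq _ <- soo | _] [seq _ <- soo | _] => y0 x0 y1 x1 y2 x2.
move=> q0 q1 q2 rh v0 v1 v2 u0 u1 u2 e0 e1 e2 a5.
have w0 := sumn_min v0; have w1 := sumn_min v1; have w2 := sumn_min v2.
have b0 n hn := sumn_min (u0 n hn).
have b1 n hn := sumn_min (u1 n hn).
have b2 n hn := sumn_min (u2 n hn).
have [[p02 p13 p27]|/andP[p4 p5]|/and3P[p3 p33 p4]] := hyperbolic_orders h0 h1 h2 hyp; last 2 first.
- case: (no_large_orders d0 rh a5); left.
  have := b0 2%N h0; have := b1 4%N p4; have := b2 5%N p5.
  move: e0 e1 e2 w0 w1 w2; clear; lia.
- case: (no_large_orders d0 rh a5); right.
  have := b0 3%N p3; have := b1 3%N p33; have := b2 4%N p4.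
  move: e0 e1 e2 w0 w1 w2; clear; lia.
split=> //; subst p0 p1.
have k0 := b0 2%N isT; have k1 := b1 3%N isT; have k2 := b2 7%N p27.
have t0 := u0 2%N isT; have t1 := u1 3%N isT; have t2 := u2 7%N p27.
have [|||[[D a0 a1 a2] [c0 c1 c2]]|[[D a0 a1 a2] [c0 c1 c2]]|[[D a0 a1 a2] [c0 c1 c2]]] :=
  small_orders d0 rh a5; try by move: e0 e1 e2 w0 w1 w2 k0 k1 k2; clear; lia.
- constructor 1; split=> //.
  + by have := perm_nseq2 q0 t0 v0; rewrite a0 c0; apply; rewrite e0 D.
  + by have := perm_nseq2 q1 t1 v1; rewrite a1 c1; apply; rewrite e1 D.
  + by have := perm_nseq2 q2 t2 v2; rewrite a2 c2; apply; rewrite e2 D.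
- constructor 2; split=> //.
  + by have := perm_nseq2 q0 t0 v0; rewrite a0 c0; apply; rewrite e0 D.
  + by have := perm_nseq2 q1 t1 v1; rewrite a1 c1; apply; rewrite e1 D.
  (* The lower bounds are not attained here: five indices sum to 6, so exactly one of them is 2. *)
  + move: c2 q2 e2; case: x2 {u2 t2 b2 k2 rh} => [|//] _ q2 /=; rewrite add0n => e2.
    by apply: perm_trans q2 _; have := sumn_excess_one v2; rewrite a2 e2 D; apply.
constructor 3; split=> //.
(* The single index divisible by poo is at most 12 - 5 = 7, as five other points lie in the fibre.
   An infinite order would make it exceed every number; 13 suffices against the degree 12. *)
- have E : poo = Some 7%N.
    case: poo p27 u2 {hyp h2 k2 b2 q2} => [n|_ u2].
      move=> /= n7 u2; have := sumn_min (u2 n (leqnn n)).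
      rewrite c2 => h; congr Some; move: n7 h e2 w2; rewrite a2 D; clear; lia.
    by have := sumn_min (u2 13%N isT); move: e2; rewrite c2 D; clear; lia.
  exact: E.
- by have := perm_nseq2 q0 t0 v0; rewrite a0 c0; apply; rewrite e0 D.
- by have := perm_nseq2 q1 t1 v1; rewrite a1 c1; apply; rewrite e1 D.
by have := perm_nseq2 q2 t2 v2; rewrite a2 c2; apply; rewrite e2 D.
Qed.

Lemma size_in_card (T : choiceType) (A : set T) n (l : seq T) :
  (A #= `I_n)%card -> uniq l -> (forall x, x \in l -> A x) -> (size l <= n)%N.
Proof.
move=> An ul lA; have fA : finite_set A by apply/finite_setP; exists n.
have <- := card_fset_set An.
apply: uniq_leq_size => // x /lA Ax; by rewrite in_fset_set // inE.
Qed.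

Lemma uniq_points (R : realType) (a b : Cplx R) : [/\ a != b, a != 0, a != 1, b != 0 & b != 1] ->
  uniq [:: pt 0; pt 1; infty; pt a; pt b].
Proof.
move=> [ab a0 a1 b0 b1].
have ne (c d : Cplx R) : c != d -> ((pt c : P1 R) == pt d) = false.
  by move=> cd; apply/eqP => h; case: h => h; move/eqP: cd.
have no (c : Cplx R) : (((pt c : P1 R) == infty) = false) * ((infty == (pt c : P1 R)) = false).
  by split; apply/eqP.
have n01 : (0 : Cplx R) != 1 by rewrite eq_sym oner_neq0.
have [a0' [a1' [b0' b1']]] : 0 != a /\ 1 != a /\ 0 != b /\ 1 != b by rewrite !(eq_sym _ a) !(eq_sym _ b).
rewrite /= !inE !no (ne _ _ n01) (ne _ _ a0') (ne _ _ a1') (ne _ _ b0') (ne _ _ b1') (ne _ _ ab) //.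
Qed.

Lemma covering_types (R : realType) (E : lode R) (f : ratfun R) p0 p1 poo d (z1 z2 : Cplx R) :
  hypergeometric E -> nonelementary E ->
  local_order E (pt 0) p0 -> local_order E (pt 1) p1 -> local_order E infty poo ->
  le_oo (Some 2%N) p0 -> le_oo p0 p1 -> le_oo p1 poo ->
  ramified_covering f d -> [/\ z1 != z2, z1 != 0, z1 != 1, z2 != 0 & z2 != 1] ->
  critical_value f (pt z1) -> critical_value f (pt z2) ->
  (non_apparent_singularities (pullback f E) #= `I_5)%card ->
  [/\ p0 = Some 2%N, p1 = Some 3%N & le_oo (Some 7%N) poo] /\
  [\/ d = 4%N /\ ramification_type f [:: 2; 2]%N [:: 3; 1]%N [:: 1; 1; 1; 1]%N,
      d = 6%N /\ ramification_type f [:: 2; 2; 2]%N [:: 3; 3]%N [:: 2; 1; 1; 1; 1]%N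
    | [/\ poo = Some 7%N, d = 12%N & ramification_type f [:: 2; 2; 2; 2; 2; 2]%N
        [:: 3; 3; 3; 3]%N [:: 7; 1; 1; 1; 1; 1]%N]].
Proof.
move=> hE nE o0 o1 o2 h0 h1 h2 [d0 fd] zz cr1 cr2 card5.
have el := nonelementary_orders hE nE o0 o1 o2.
have [Y [P [Q [Pu Qu fY tY]]]] := charts5 hE.
have [k0 k1 k2] := cusp_orders Pu Qu fY tY hE o0 o1 o2.
subst d.
have [x0 [u0 m0 r0 s0]] := fibre_list (pt 0) d0.
have [x1 [u1 m1 r1 s1]] := fibre_list (pt 1) d0.
have [x2 [u2 m2 r2 s2]] := fibre_list infty d0.
have pos (x : seq (P1 R)) : (forall y, y \in x -> (0 < ramif f y)%N) ->
    all (leq 1) [seq ramif f y | y <- x].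
  by move=> h; apply/allP => _ /mapP[y /h yx ->].
have sumE (x : seq (P1 R)) : sumn [seq ramif f y | y <- x] = (\sum_(y <- x) ramif f y)%N.
  by rewrite sumnE big_map.
have rh : (rdeg f + 4 <= size x0 + size x1 + size x2)%N.
  apply: (fibres_size_ge d0 _ cr1 cr2 (conj u0 (conj m0 s0)) (conj u1 (conj m1 s1)) (conj u2 (conj m2 s2))).
  exact: uniq_points.
pose nd p (x : seq (P1 R)) := [seq y <- x | ndvd p (ramif f y)].
have a5 : (count (ndvd p0) [seq ramif f y | y <- x0] + count (ndvd p1) [seq ramif f y | y <- x1] +
    count (ndvd poo) [seq ramif f y | y <- x2] <= 5)%N.
  rewrite !count_map -!size_filter -!size_cat; apply: (size_in_card card5).
    rewrite !cat_uniq !filter_uniq // !andbT /=.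
    have dis (a b : P1 R) p q x y : a <> b -> (forall z, z \in x <-> rvalue f z = a) ->
        (forall z, z \in y <-> rvalue f z = b) -> ~~ has (mem (nd q y)) (nd p x).
      move=> ab hx hy; apply/hasPn => z; rewrite mem_filter => /andP[_ /hx za].
      by rewrite /= mem_filter; apply/negP => /andP[_ /hy zb]; apply: ab; rewrite -za.
    have n01 : (pt 0 : P1 R) <> pt 1 by move=> [] /eqP; rewrite eq_sym oner_eq0.
    apply/andP; split; first exact: (dis _ _ p1 p0 _ _ (not_eq_sym n01) m1 m0).
    rewrite has_sym has_cat negb_or; apply/andP; split.
      by apply: (dis (pt 0) infty p0 poo _ _ _ m0 m2).
    by apply: (dis (pt 1) infty p1 poo _ _ _ m1 m2).
  move=> y; rewrite !mem_cat -orbA => /or3P[]; rewrite mem_filter => /andP[/= ny yx].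
  - exact: (pullback_nonapparent Pu Qu fY tY hE d0 (i := cusp_0) (proj1 (m0 y) yx) (r0 y yx) k0 ny).
  - exact: (pullback_nonapparent Pu Qu fY tY hE d0 (i := cusp_1) (proj1 (m1 y) yx) (r1 y yx) k1 ny).
  - exact: (pullback_nonapparent Pu Qu fY tY hE d0 (i := cusp_oo) (proj1 (m2 y) yx) (r2 y yx) k2 ny).
have [p23 H] := fibre_types h0 h1 h2 el d0 (pos _ r0) (pos _ r1) (pos _ r2)
  (etrans (sumE _) s0) (etrans (sumE _) s1) (etrans (sumE _) s2)
  (eq_ind_r (fun n => (_ <= n)%N) rh (f_equal2 addn (f_equal2 addn (size_map _ _) (size_map _ _)) (size_map _ _))) a5.
split=> //.
have ram (y : P1 R) x l : uniq x -> (forall z, z \in x <-> rvalue f z = y) ->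
    perm_eq [seq ramif f z | z <- x] l -> ramification_over f y l by move=> *; exists x.
case: H => [[D l0 l1 l2]|[D l0 l1 l2]|[E7 D l0 l1 l2]]; [constructor 1|constructor 2|constructor 3];
  split=> //; split; [exact: ram m0 l0|exact: ram m1 l1|exact: ram m2 l2| exact: ram m0 l0|exact: ram m1 l1|exact: ram m2 l2| exact: ram m0 l0|exact: ram m1 l1|exact: ram m2 l2].
Qed.

Local Open Scope classical_set_scope.
Local Open Scope card_scope.
Local Open Scope ring_scope.

Theorem mainTheorem8 (R : realType) (E : lode R) (p0 p1 poo : option nat)
    (T : topologicalType) (phi : T -> ratfun R) (d : nat) (c1 c2 : T -> Cplx R) :
  hypergeometric E ->
  nonelementary E ->
  local_order E (pt 0) p0 ->
  local_order E (pt 1) p1 ->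
  local_order E infty poo ->
  le_oo (Some 2%N) p0 -> le_oo p0 p1 -> le_oo p1 poo ->
  two_parameter_family phi d c1 c2 ->
  (forall t, non_apparent_singularities (pullback (phi t) E) #= `I_5) ->
  [\/ [/\ p0 = Some 2%N, p1 = Some 3%N, le_oo (Some 7%N) poo, d = 4%N
        & forall t, ramification_type (phi t)
            [:: 2; 2]%N [:: 3; 1]%N [:: 1; 1; 1; 1]%N],
      [/\ p0 = Some 2%N, p1 = Some 3%N, le_oo (Some 7%N) poo, d = 6%N
        & forall t, ramification_type (phi t)
            [:: 2; 2; 2]%N [:: 3; 3]%N [:: 2; 1; 1; 1; 1]%N]
    | [/\ p0 = Some 2%N, p1 = Some 3%N, poo = Some 7%N, d = 12%N
        & forall t, ramification_type (phi t)
            [:: 2; 2; 2; 2; 2; 2]%N [:: 3; 3; 3; 3]%N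
            [:: 7; 1; 1; 1; 1; 1]%N]].
Proof.
move=> hE nE o0 o1 o2 h0 h1 h2 fam card5; have [[t0 _] cov _ dis crit _ _ _] := fam.
have key t := covering_types hE nE o0 o1 o2 h0 h1 h2 (cov t) (dis t).
have crit1 t : critical_value (phi t) (pt (c1 t)).
  have [_ a0 a1 _ _] := dis t.
  by apply/crit; [case=> /eqP; rewrite (negPf a0)|case=> /eqP; rewrite (negPf a1)|by []|left].
have crit2 t : critical_value (phi t) (pt (c2 t)).
  have [_ _ _ a0 a1] := dis t.
  by apply/crit; [case=> /eqP; rewrite (negPf a0)|case=> /eqP; rewrite (negPf a1)|by []|right].
have {}key t := key t (crit1 t) (crit2 t) (card5 t).
have [[p02 p13 p7] H] := key t0.
(* The degree is common to the whole family and differs between the three cases, so the case found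
   at t0 is the case at every t. *)
case: H => [[D _]|[D _]|[E7 D _]]; [constructor 1|constructor 2|constructor 3];
  split=> // t; have [_ [[D' r]|[D' r]|[_ D' r]]] := key t; by [|rewrite D in D'].
Qed.
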